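(* Let $q$ be a power of $2$ and $m\geqslant2$ an integer with $(m,q)\neq(2,2),(2,8),(6,2)$. Let $L=\mathrm{Sp}_{2m}(q)\leqslant G\leqslant\Gamma\mathrm{Sp}_{2m}(q)$, let $H$ be a solvable subgroup of $\mathrm{P}_m[G]$, let $B$ be a subgroup of $G$ that is maximal among the subgroups of $G$ not containing $L$ and satisfies $B\cap L=\mathrm{O}_{2m}^-(q)$, and let $S_0=\mathrm{GL}_1(q^m)$ be the Singer group in $T=\Gamma\mathrm{L}_1(q^m)$. Then $G=HB$ if and only if, up to conjugation in $G$, $H=U(I){:}S$ with $I\subseteq\{0,1,\ldots,\lfloor m/2\rfloor\}$ and $S\leqslant T$ such that $S$ is transitive on $\mathbb{F}_q^m\setminus\{0\}$ and one of the following holds: (a) $0\in I$; (b) $0\notin I$, $d(I)=1$, and $q=2$; (c) $0\notin I$, $d(I)=2$, $q=2$, and $|T|/|SS_0|$ is odd; (d) $0\notin I$, $d(I)=1$, $q=4$, $G=\Gamma\mathrm{Sp}_{2m}(4)$, and $|T|/|SS_0|$ is odd.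
   Context: Realize the symplectic space as $V=\mathbb{F}_{q^m}\times\mathbb{F}_{q^m}$, viewed as a $2m$-dimensional $\mathbb{F}_q$-space with nondegenerate alternating form $\kappa_0((x,y),(x',y'))=\mathrm{Tr}_{q^m/q}(xy'+yx')$ ($q$ even). $\mathrm{Sp}_{2m}(q)$ is its isometry group and $\Gamma\mathrm{Sp}_{2m}(q)$ the group of all bijective semilinear maps $g$ (with associated field automorphism $\tau$) with $\kappa_0(ug,wg)=\kappa_0(u,w)^\tau$, so $\Gamma\mathrm{Sp}_{2m}(q)/\mathrm{Sp}_{2m}(q)$ is cyclic of order $\log_2q$. Let $U=\mathbb{F}_{q^m}\times\{0\}$ and $W=\{0\}\times\mathbb{F}_{q^m}$ (maximal totally isotropic subspaces). $\mathrm{P}_m[G]=G_U$ is the stabilizer of $U$ in $G$. $\mathrm{O}_{2m}^-(q)<\mathrm{Sp}_{2m}(q)$ is the stabilizer of a quadratic form of minus (elliptic) type on $V$ whose associated bilinear form is $\kappa_0$. $T=\Gamma\mathrm{L}_1(q^m)$ is the subgroup of $\Gamma\mathrm{Sp}_{2m}(q)$ generated by $\ell_\omega\colon(x,y)\mapsto(\omega^{-1}x,\omega y)$ (with $\omega$ a generator of $\mathbb{F}_{q^m}^\times$) and $(x,y)\mapsto(x^2,y^2)$; it stabilizes $U$ and $W$ and acts on $W\cong\mathbb{F}_{q^m}\cong\mathbb{F}_q^m$ as the usual $\Gamma\mathrm{L}_1(q^m)$. The Singer group is $S_0=\langle\ell_\omega\rangle$. Let $M(0)$ be the set of maps $y\mapsto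 ay$ with $a\in\mathbb{F}_{q^m}$. For $1\leqslant i\leqslant\lfloor(m+1)/2\rfloor-1$ let $M(i)$ be the set of maps $\mathbb{F}_{q^m}\to\mathbb{F}_{q^m}$ of the form $y\mapsto ay^{q^i}-a^{q^{m-i}}y^{q^{m-i}}$ with $a\in\mathbb{F}_{q^m}$; if $m$ is even, let $M(m/2)$ be the set of maps $y\mapsto ay^{q^{m/2}}$ with $a\in\mathbb{F}_{q^m}$, $a+a^{q^{m/2}}=0$. Put $U(i)=\{(x,y)\mapsto(x+h(y),y)\mid h\in M(i)\}$, a subgroup of the pointwise stabilizer of $U$ in $\mathrm{Sp}_{2m}(q)$, and $U(I)=\prod_{i\in I}U(i)$ (an internal direct product normalized by $T$). Writing $I\setminus\{0\}=\{i_1,\ldots,i_k\}$, $d(I)=\gcd(i_1,\ldots,i_k)$ if $m/2\in I$, and $d(I)=\gcd(i_1,\ldots,i_k,m)$ if $m/2\notin I$. $A{:}B$ denotes a semidirect product. *)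

(* Defs.v *)
From HB Require Import structures.
From mathcomp Require Import all_boot all_order all_algebra all_fingroup.
From mathcomp Require Import all_solvable all_field.

Set Implicit Arguments.
Unset Strict Implicit.
Unset Printing Implicit Defensive.

Import GroupScope GRing.Theory.
Local Open Scope ring_scope.

(* Throughout, K is the field of order q ^ m (q a power of 2, hypotheses that
   are imposed only in theorems) and F_q is its subfield Fq K q.
   Permutations act on the right: g v is v^g and (g * h) v = h (g v). *)

(* The permutation v |-> f v when f is injective, and the identity otherwise;
   see topermE.  It is only used for injective maps, cf. ell_fun_inj,
   frob_fun_inj and shear_fun_inj below. *)
Definition toperm (X : finType) (f : X -> X) : {perm X} :=
  insubd (1%g : {perm X}) (finfun f).

Lemma topermE (X : finType) (f : X -> X) : injective f -> toperm f =1 f.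
Proof.
move=> f_inj x; rewrite /toperm -pvalE val_insubd.
have -> : injectiveb (finfun f) by apply/injectiveP=> y z; rewrite !ffunE => /f_inj.
by rewrite ffunE.
Qed.

Section Symplectic.

Variables (K : finFieldType) (q m : nat).

Local Notation V := (K * K)%type.

Definition Fq : {set K} := [set c | c ^+ q == c].

Definition trq (z : K) : K := \sum_(i < m) z ^+ (q ^ i)%N.

Definition kappa0 (u v : V) : K := trq (u.1 * v.2 + u.2 * v.1).

Definition vadd (u v : V) : V := (u.1 + v.1, u.2 + v.2).
Definition vscale (c : K) (v : V) : V := (c * v.1, c * v.2).

(* tau is only constrained on Fq; being onto Fq and compatible with + and *,
   its restriction to Fq is a field automorphism. *)
Definition field_aut (tau : {ffun K -> K}) : bool :=
  (tau @: Fq == Fq) &&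
  [forall c in Fq, forall d in Fq,
     (tau (c + d) == tau c + tau d) && (tau (c * d) == tau c * tau d)].

Definition semilinear (tau : K -> K) (g : {perm V}) : bool :=
  [forall u, forall v, g (vadd u v) == vadd (g u) (g v)] &&
  [forall c in Fq, forall v, g (vscale c v) == vscale (tau c) (g v)].

Definition Sp : {set {perm V}} :=
  [set g : {perm V} | semilinear id g &&
     [forall u, forall v, kappa0 (g u) (g v) == kappa0 u v]].

Definition GammaSp : {set {perm V}} :=
  [set g : {perm V} | [exists tau : {ffun K -> K},
     [&& field_aut tau, semilinear tau g &
         [forall u, forall v, kappa0 (g u) (g v) == tau (kappa0 u v)]]]].

Definition Uspace : {set V} := [set v : V | v.2 == 0].
Definition Wspace : {set V} := [set v : V | v.1 == 0].

Definition Pm (G : {set {perm V}}) : {set {perm V}} := 'N_G(Uspace | 'P).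

Definition quadratic_form (Q : V -> K) : Prop :=
  [/\ forall v, Q v \in Fq,
      forall c v, c \in Fq -> Q (vscale c v) = c ^+ 2 * Q v
    & forall u v, Q (vadd u v) = Q u + Q v + kappa0 u v].

Definition subspace (E : {set V}) : bool :=
  [&& (0, 0) \in E,
      [forall u in E, forall v in E, vadd u v \in E]
    & [forall c in Fq, forall v in E, vscale c v \in E]].

Definition dimq (E : {set V}) : nat := trunc_log q #|E|.

Definition totally_singular (Q : V -> K) (E : {set V}) : bool :=
  subspace E && [forall v in E, Q v == 0].

Definition witt_index (Q : V -> K) : nat :=
  (\max_(E : {set V} | totally_singular Q E) dimq E)%N.

(* Quadratic form with polar form kappa0, of minus (elliptic) type: its Witt
   index is one less than half of the dimension 2m of V. *)
Definition minus_form (Q : V -> K) : Prop :=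
  quadratic_form Q /\ (witt_index Q).+1 = m.

Definition Ominus (Q : V -> K) : {set {perm V}} :=
  [set g in Sp | [forall v, Q (g v) == Q v]].

Definition ell_fun (w : {unit K}) (v : V) : V := ((val w)^-1 * v.1, val w * v.2).
Definition frob_fun (v : V) : V := (v.1 ^+ 2, v.2 ^+ 2).
Definition shear_fun (h : K -> K) (v : V) : V := (v.1 + h v.2, v.2).

Lemma ell_fun_inj w : injective (ell_fun w).
Proof.
move=> [x y] [x' y'] [].
have w0 : val w != 0 by rewrite -unitfE; exact: valP w.
by move=> /(mulfI (invr_neq0 w0)) -> /(mulfI w0) ->.
Qed.

Lemma frob_fun_inj : 2 \in [pchar K] -> injective frob_fun.
Proof.
move=> ch2 [x y] [x' y'] []; have inj := fmorph_inj (pFrobenius_aut ch2).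
by move=> /(inj x x') -> /(inj y y') ->.
Qed.

Lemma shear_fun_inj h : injective (shear_fun h).
Proof. by move=> [x y] [x' y'] [] /= + yy'; rewrite yy' => e; rewrite (addIr _ e). Qed.

Definition ell (w : {unit K}) : {perm V} := toperm (ell_fun w).
Definition frob : {perm V} := toperm frob_fun.
Definition shear (h : K -> K) : {perm V} := toperm (shear_fun h).

(* The Singer group S_0 and GammaL_1(q^m), for a generator w of the
   multiplicative group of K. *)
Definition Singer (w : {unit K}) : {set {perm V}} := <[ell w]>%g.
Definition GammaL1 (w : {unit K}) : {set {perm V}} := <<[set ell w; frob]>>%g.

Definition Mi (i : nat) : {set {ffun K -> K}} :=
  if i == 0%N then [set [ffun y => a * y] | a : K]
  else if i.*2 == m then
    [set [ffun y => a * y ^+ (q ^ i)%N] | a : K & a + a ^+ (q ^ i)%N == 0]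
  else [set [ffun y => a * y ^+ (q ^ i)%N
                       - a ^+ (q ^ (m - i))%N * y ^+ (q ^ (m - i))%N] | a : K].

Definition Ui (i : nat) : {set {perm V}} := [set shear h | h : {ffun K -> K} in Mi i].

Definition UI (I : {set 'I_(m./2).+1}) : {set {perm V}} :=
  (\prod_(i in I) Ui i)%g.

End Symplectic.

(* "i.*2 == m for some i in I" says that m is even and m/2 is in I. *)
Definition dI (m : nat) (I : {set 'I_(m./2).+1}) : nat :=
  let d := \big[gcdn/0%N]_(i in I | (0 < i)%N) (i : nat) in
  if [exists i in I, i.*2 == m] then d else gcdn d m.

(* Main.v *)
(** The quadratic forms polarizing to kappa0 are the Q_v(u) = Tr(u1 u2) + kappa0(u, v)^2,
    and if Q_v is of minus type then v1 v2 has absolute trace 1.  As B is the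
    stabilizer of such a form in G, G = HB if and only if H is transitive on
    these v.  A subgroup H of P_m moves v2 through its action on V / U = W; if H
    is solvable and transitive, Huppert's theorem (here in characteristic 2)
    conjugates this action into GammaL_1(q^m).  Schur-Zassenhaus and a Frattini
    argument then give H = N:S up to conjugation, S <= T, where the group of
    shears N is normalized by a subgroup C of the Singer group.  The index of C
    in the Singer group divides the order m f of the Frobenius map, and this
    makes the U(i) irreducible pairwise nonisomorphic C-modules that are not
    centralized by C (this fails for (m,q) = (2,2), (6,2)), so that N = U(I).
    A shear in U(i), i > 0, adds some e + e^(q^i) to v1 v2, so that if 0 is not
    in I, the U(I)-orbits are the fibers of the trace of v1 v2 to the field of
    order 2^k, k = f d(I), and S acts on these traces through field automorphisms.
    Since 2^(k-1) traces are permuted transitively by a group of order at most k,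
    k <= 2. *)
Require Import Defs.
From HB Require Import structures.
From Stdlib Require Import ZArith.
From mathcomp Require Import all_boot all_order all_algebra all_fingroup.
From mathcomp Require Import all_solvable all_field.
From mathcomp Require Import zify ssrZ ring.

Set Implicit Arguments.
Unset Strict Implicit.
Unset Printing Implicit Defensive.

(** * Exponents of shears *)

(** That the U(i) are irreducible and pairwise nonisomorphic over C is arithmetic. A generator of C
    multiplies the coefficient of U(i) by a scalar whose conjugates have exponents 2^j + 2^(j + f
    i), and these must be distinct modulo the order of C, which is (2^N - 1) / t with N = m f and t
    dividing N. Multiplying by a power of 2 rotates the exponents modulo N, and four points on a
    cycle always leave a gap of length N / 4; so both sums can be made smaller than the modulus as
    soon as t is small against 2^(N / 4). This works from N = 25 on, and the smaller cases are
    settled by computation.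

    A second obstacle is the field of scalars. Huppert's theorem is proved over the prime field,
    whereas the conjugating element has to be an isometry of V, hence linear over F_q. The scalars
    of F_q are therefore adjoined to the image of H and kept inside the cyclic group that the
    theorem produces. *)

Definition cyclic_dist (N p x : nat) := if p <= x then x - p else x + N - p.

Lemma cyclic_dist_inj N p x y : p < N -> x < N -> y < N ->
  cyclic_dist N p x = cyclic_dist N p y -> x = y.
Proof. by rewrite /cyclic_dist; case: ifP; case: ifP; lia. Qed.

(** Four points cut the cycle of length [N] into four gaps, one of which is at least [N / 4].
    Counted from the point [p] that ends this gap, all four lie within [3 N / 4]. *)
Lemma sorted_cyclic_gap N a b c d : a <= b -> b <= c -> c <= d -> d < N ->
  exists2 p, p < N & [/\ 4 * cyclic_dist N p a <= 3 * N, 4 * cyclic_dist N p b <= 3 * N,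
    4 * cyclic_dist N p c <= 3 * N & 4 * cyclic_dist N p d <= 3 * N].
Proof.
move=> ab bc cd dN; rewrite /cyclic_dist.
have [h1|h1] := leqP N (4 * (N - d + a)); first by exists a; [lia | split; case: ifP; lia].
have [h2|h2] := leqP N (4 * (b - a)); first by exists b; [lia | split; case: ifP; lia].
have [h3|h3] := leqP N (4 * (c - b)); first by exists c; [lia | split; case: ifP; lia].
by exists d; [lia | split; case: ifP; lia].
Qed.

Lemma cyclic_gap N a b c d : a < N -> b < N -> c < N -> d < N ->
  exists2 p, p < N & [/\ 4 * cyclic_dist N p a <= 3 * N, 4 * cyclic_dist N p b <= 3 * N,
    4 * cyclic_dist N p c <= 3 * N & 4 * cyclic_dist N p d <= 3 * N].
Proof.
pose G a b c d := exists2 p, p < N & [/\ 4 * cyclic_dist N p a <= 3 * N,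
    4 * cyclic_dist N p b <= 3 * N,
    4 * cyclic_dist N p c <= 3 * N & 4 * cyclic_dist N p d <= 3 * N].
have G12 x y z t : G x y z t -> G y x z t by case=> p pN [*]; exists p.
have G23 x y z t : G x y z t -> G x z y t by case=> p pN [*]; exists p.
have G34 x y z t : G x y z t -> G x y t z by case=> p pN [*]; exists p.
move=> aN bN cN dN; rewrite -/(G a b c d).
have ins3 x y z t : x <= y -> y <= z -> z < N -> t < N -> G x y z t.
  move=> xy yz zN tN; have [zt|tz] := leqP z t; first exact: sorted_cyclic_gap.
  apply: G34; have [yt|ty] := leqP y t; first by apply: sorted_cyclic_gap => //; lia.
  apply: G23; have [xt|tx] := leqP x t; first by apply: sorted_cyclic_gap => //; lia.
  by apply: G12; apply: sorted_cyclic_gap => //; lia.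
have ins2 x y z t : x <= y -> y < N -> z < N -> t < N -> G x y z t.
  move=> xy yN zN tN; have [yz|zy] := leqP y z; first exact: ins3.
  apply: G23; have [xz|zx] := leqP x z; first by apply: ins3 => //; lia.
  by apply: G12; apply: ins3 => //; lia.
have [ab|ba] := leqP a b; first exact: ins2.
by apply: G12; apply: ins2 => //; lia.
Qed.

Lemma two_powers_eq a b c d : 2 ^ a + 2 ^ b = 2 ^ c + 2 ^ d ->
  (a = c /\ b = d) \/ (a = d /\ b = c).
Proof.
have P n : 0 < 2 ^ n by rewrite expn_gt0.
have inj x y : 2 * 2 ^ x = 2 * 2 ^ y -> x = y.
  by move=> h; apply: (@expnI 2) => //; lia.
elim: a b c d => [|a IH] [|b] [|c] [|d]; rewrite ?expn0 ?expnS.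
all: try by [left | lia].
all: try by move: (P c) (P d); lia.
all: try by move: (P a) (P b); lia.
all: try by move=> h; left; split=> //; congr _.+1; apply: inj; lia.
all: try by move=> h; right; split=> //; congr _.+1; apply: inj; lia.
move=> h; have [] : (a = c /\ b = d) \/ (a = d /\ b = c); first by apply: IH; lia.
  by case=> -> ->; left.
by case=> -> ->; right.
Qed.

(** The argument needs [N < 2 ^ k] where [k] is [N - 2] minus the integer part of [3 N / 4]. At
    [N = 25] this is 25 < 32, while [N = 24] would give only [k = 4]. *)
Lemma large_quotient N t : 25 <= N -> 0 < t <= N ->
  t * 2 ^ ((3 * N) %/ 4).+1 < 2 ^ N - 1.
Proof.
move=> N25 /andP[_ tN].
have [k ek] : exists k, N = (3 * N) %/ 4 + k.+1 + 1 by exists (N - (3 * N) %/ 4 - 2); lia.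
have k6 : 5 <= k by lia.
have Nk : N < 2 ^ k.
  have : N <= 4 * k.+2 by lia.
  have : 4 * k.+2 + 4 <= 2 ^ k; last by lia.
  elim: k k6 {ek} => // k IH; rewrite leq_eqVlt => /orP[/eqP <- //|k5].
  by have := IH k5; rewrite expnS; lia.
have -> : 2 ^ N = 2 ^ k * 2 * 2 ^ ((3 * N) %/ 4).+1.
  by rewrite -expnSr -expnD; congr (2 ^ _); lia.
have := expn_gt0 2 ((3 * N) %/ 4).+1; move: (2 ^ _.+1) (2 ^ k) Nk => A B Nk A0.
by nia.
Qed.

(** As 2^N = 1 modulo [M], multiplication by [2 ^ (N - p)] rotates the exponents. With [p] from
    [cyclic_gap] both sums drop below [M], so the congruence becomes an equality, to which
    uniqueness of binary expansions applies. *)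
Lemma two_powers_mod N t u v u' v' : 25 <= N -> t %| N -> t %| 2 ^ N - 1 ->
  u < N -> v < N -> u' < N -> v' < N ->
  2 ^ u + 2 ^ v = 2 ^ u' + 2 ^ v' %[mod (2 ^ N - 1) %/ t] ->
  (u = u' /\ v = v') \/ (u = v' /\ v = u').
Proof.
move=> N25 tN tM uN vN u'N v'N e; set M := _ %/ t in e.
have N0 : 0 < N by apply: leq_trans N25.
have t0 : 0 < t <= N by rewrite (dvdn_gt0 N0 tN) dvdn_leq.
have MN : 2 ^ N = 1 %[mod M].
  have -> : 2 ^ N = 2 ^ N - 1 + 1 by rewrite subnK // expn_gt0.
  by rewrite -(divnK tM) -/M -modnDml modnMr add0n.
have Mlt x : t * x < 2 ^ N - 1 -> x < M by rewrite /M ltn_divRL // mulnC.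
clearbody M; have [p pN [du dv du' dv']] := cyclic_gap uN vN u'N v'N.
have rot x : x < N -> 2 ^ cyclic_dist N p x = 2 ^ x * 2 ^ (N - p) %[mod M].
  move=> xN; rewrite -expnD /cyclic_dist; case: leqP => px.
    have -> : x + (N - p) = x - p + N by rewrite addnBA 1?ltnW // addnBAC.
    by rewrite expnD -modnMmr MN modnMmr muln1.
  by rewrite addnBA 1?ltnW.
have e2 : 2 ^ cyclic_dist N p u + 2 ^ cyclic_dist N p v =
          2 ^ cyclic_dist N p u' + 2 ^ cyclic_dist N p v' %[mod M].
  rewrite -modnDm !rot // modnDm -mulnDl -modnMml e modnMml mulnDl.
  by rewrite -[RHS]modnDm !rot // modnDm.
have small x y : 4 * x <= 3 * N -> 4 * y <= 3 * N -> 2 ^ x + 2 ^ y < M.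
  move=> xN yN; apply: Mlt.
  apply: leq_ltn_trans (large_quotient N25 t0); rewrite leq_mul2l.
  apply/orP; right; rewrite expnS mul2n -addnn.
  by apply: leq_add; apply: leq_pexp2l => //; rewrite leq_divRL // mulnC.
move: e2; rewrite (modn_small (small _ _ du dv)) (modn_small (small _ _ du' dv')).
case/two_powers_eq=> [] [].
  by move=> /(cyclic_dist_inj pN uN u'N) -> /(cyclic_dist_inj pN vN v'N) ->; left.
by move=> /(cyclic_dist_inj pN uN v'N) -> /(cyclic_dist_inj pN vN u'N) ->; right.
Qed.

Delimit Scope Z_scope with BinZ.

(** The finite check below involves numbers above 2^24, too large for unary arithmetic, and is run
    on binary integers. *)
Lemma Z_of_nat_modn a b : 0 < b -> Z.of_nat (a %% b) = (Z.of_nat a mod Z.of_nat b)%BinZ.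
Proof.
move=> b0; apply: (Z.mod_unique _ _ (Z.of_nat (a %/ b))).
  by left; have := ltn_pmod a b0; lia.
by have := divn_eq a b; nia.
Qed.

Lemma Z_of_nat_divn a b : 0 < b -> b %| a -> Z.of_nat (a %/ b) = (Z.of_nat a / Z.of_nat b)%BinZ.
Proof.
move=> b0 /dvdnP[k ->]; rewrite mulnK // Nat2Z.inj_mul Z.div_mul //; lia.
Qed.

(* If h has coefficient a at y^(q^i), then y |-> g h(g y) has coefficient
   g^(1 + q^i) a; the factor 2^j comes from the Frobenius conjugates of a. *)
Definition shear_exponent (f i j : nat) : nat := 2 ^ j * (1 + 2 ^ (f * i)).

Definition Zshear_exponent (f i j : nat) : Z :=
  (2 ^ Z.of_nat j * (1 + 2 ^ (Z.of_nat f * Z.of_nat i)))%BinZ.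

(* For 2 i = m the coefficients lie in the subfield of order 2^(m f / 2). *)
Definition Frobenius_period (f m i : nat) : nat :=
  if i.*2 == m then (m * f)./2 else m * f.

(** Here [t] stands for the index of C in the Singer group, so that [M] is the order of C. *)
Definition distinct_check (f m t : nat) : bool :=
  let M := ((2 ^ (Z.of_nat m * Z.of_nat f) - 1) / Z.of_nat t)%BinZ in
  uniq [seq (Zshear_exponent f i j mod M)%BinZ | i <- iota 0 (m./2).+1,
                                     j <- iota 0 (Frobenius_period f m i)].

(* The conditionals, unlike boolean connectives, are evaluated lazily. *)
Definition small_distinct_check : bool :=
  all (fun m => all (fun f => if (25 <= m * f) || ((m == 6) && (f == 1)) then true else
    all (fun t => if t %| m * f then
        if ((2 ^ (Z.of_nat m * Z.of_nat f) - 1) mod Z.of_nat t == 0)%BinZ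
        then distinct_check f m t else true else true)
      (iota 1 24)) (iota 1 12)) (iota 2 24).

(** The omitted pair m = 6, f = 1 fails at t = 3, where 3 * 2^3 = 3 modulo 63 / 3 = 21. *)
Lemma small_distinct_checkT : small_distinct_check.
Proof. by vm_compute. Qed.

Lemma uniq_map_inj (S T : eqType) (F : S -> T) (s : seq S) :
  uniq (map F s) -> {in s &, injective F}.
Proof.
elim: s => // k s IH /= /andP[/mapP ks us] x y; rewrite !inE.
case/predU1P=> [->|xs] /predU1P[->|ys] // e; last exact: IH.
  by case: ks; exists y.
by case: ks; exists x.
Qed.

Lemma uniq_allpairs_dep_inj (T : eqType) (F : nat -> nat -> T)
    (s : seq nat) (p : nat -> seq nat) i j i' j' :
  uniq [seq F i j | i <- s, j <- p i] ->
  i \in s -> j \in p i -> i' \in s -> j' \in p i' -> F i j = F i' j' -> i = i' /\ j = j'.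
Proof.
elim: s => // k s IH /= ; rewrite cat_uniq => /and3P[uk /hasPn disj us].
have out l l' : l \in s -> l' \in p l -> F l l' \notin [seq F k y | y <- p k].
  by move=> ls lp; apply: disj; apply/allpairsPdep; exists l, l'.
rewrite !inE => /predU1P[->|is_] jp /predU1P[->|i's] j'p e.
- by split=> //; apply: (uniq_map_inj uk).
- by case/negP: (out _ _ i's j'p); rewrite -e map_f.
- by case/negP: (out _ _ is_ jp); rewrite e map_f.
exact: IH.
Qed.

Lemma Frobenius_period_le f m i : Frobenius_period f m i <= m * f.
Proof. by rewrite /Frobenius_period; case: ifP => // _; lia. Qed.

Lemma mul_half_index_le f m i : i <= m./2 -> f * i <= (m * f)./2.
Proof. by move=> im; rewrite -divn2 leq_divRL //; nia. Qed.

(** On a cycle of length m f the points j and j + f i differ by f i, at most half of the length,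
    which determines i. The starting point is then determined as well, except that for 2 i = m the
    two points play the same role; the halved period removes this ambiguity. *)
Lemma Frobenius_pair_inj f m i i' j j' r r' :
  0 < f -> i <= m./2 -> i' <= m./2 ->
  j < Frobenius_period f m i -> j' < Frobenius_period f m i' ->
  r < m * f -> r' < m * f ->
  r = j + f * i \/ r + m * f = j + f * i ->
  r' = j' + f * i' \/ r' + m * f = j' + f * i' ->
  (j = j' /\ r = r') \/ (j = r' /\ r = j') -> i = i' /\ j = j'.
Proof.
move=> f0 im i'm; rewrite /Frobenius_period => jP j'P.
have fi k : k <= m./2 -> k.*2 = m /\ 2 * (f * k) = m * f \/ k.*2 <> m /\ 2 * (f * k) < m * f.
  move=> km; have [e|ne] := eqVneq k.*2 m; first by left; split=> //; nia.
  by right; split; [exact/eqP | nia].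
have inj k k' : f * k = f * k' -> k = k' by move/eqP; rewrite eqn_pmul2l // => /eqP.
have [[e1 h1]|[n1 h1]] := fi _ im; have [[e2 h2]|[n2 h2]] := fi _ i'm;
  move: jP j'P; rewrite ?e1 ?e2 ?eqxx ?(introF eqP n1) ?(introF eqP n2); 
  move: h1 h2 (inj i i'); move: (f * i) (f * i') (m * f) => A B N; lia.
Qed.

(** Each exponent is a sum of two powers of 2, so for m f at least 25 [two_powers_mod] reduces the
    claim to [Frobenius_pair_inj]. The remaining cases are in [small_distinct_check]. *)
Lemma shear_exponent_inj f m t i i' j j' :
  0 < f -> 2 <= m -> ~~ ((m == 6) && (f == 1)) ->
  t %| m * f -> t %| 2 ^ (m * f) - 1 -> i <= m./2 -> i' <= m./2 ->
  j < Frobenius_period f m i -> j' < Frobenius_period f m i' ->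
  shear_exponent f i j = shear_exponent f i' j' %[mod (2 ^ (m * f) - 1) %/ t] ->
  i = i' /\ j = j'.
Proof.
move=> f0 m2 n61 tN tM im i'm jP j'P; set M := _ %/ t => e.
have N0 : 0 < m * f by rewrite muln_gt0 f0 (ltnW m2).
have t0 : 0 < t by exact: dvdn_gt0 tN.
have tN' : t <= m * f by exact: dvdn_leq tN.
have MN : 2 ^ (m * f) = 1 %[mod M].
  have -> : 2 ^ (m * f) = 2 ^ (m * f) - 1 + 1 by rewrite subnK // expn_gt0.
  by rewrite -(divnK tM) -/M -modnDml modnMr add0n.
have M0 : 0 < M.
  by rewrite divn_gt0 // dvdn_leq // subn_gt0 -(expn0 2) ltn_exp2l.
have [N25|N25] := leqP 25 (m * f).
  have rot k l : k <= m./2 -> l < Frobenius_period f m k ->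
     exists2 r, r < m * f & [/\ shear_exponent f k l = 2 ^ l + 2 ^ r %[mod M],
       l < m * f & r = l + f * k \/ r + m * f = l + f * k].
    move=> km lP; have lN := leq_trans lP (Frobenius_period_le f m k).
    have es : shear_exponent f k l = 2 ^ l + 2 ^ (l + f * k).
      by rewrite /shear_exponent mulnDr muln1 expnD.
    have fkN : f * k <= m * f by apply: leq_trans (mul_half_index_le f km) _; rewrite -divn2 leq_div.
    have [lt|ge] := ltnP (l + f * k) (m * f).
      by exists (l + f * k); rewrite ?es //; split=> //; left.
    exists (l + f * k - m * f); first by rewrite ltn_subLR // -addSn leq_add.
    split=> //; last by right; rewrite subnK.
    by rewrite es -(subnK ge) expnD -modnDmr -modnMmr MN modnMmr muln1 modnDmr subnK.
  have [r rN [er lN re]] := rot _ _ im jP; have [r' r'N [er' l'N re']] := rot _ _ i'm j'P.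
  have := two_powers_mod N25 tN tM lN rN l'N r'N; rewrite -/M -er -er' => /(_ e).
  exact: Frobenius_pair_inj im i'm jP j'P rN r'N re re'.
have m24 : m \in iota 2 24 by rewrite mem_iota; clear -m2 f0 N25; nia.
have f12 : f \in iota 1 12 by rewrite mem_iota; clear -m2 f0 N25; nia.
have t24 : t \in iota 1 24 by rewrite mem_iota t0 /= ltnS (leq_trans tN').
have /allP chk := small_distinct_checkT; have : all _ (iota 1 12) := chk m m24.
move/allP=> {}chk.
move: (chk f f12) => {chk}; rewrite leqNgt N25 orFb (negPf n61) => /allP chk; move: (chk t t24) => {chk}; rewrite tN.
have ZN : Z.of_nat (2 ^ (m * f) - 1) = (2 ^ (Z.of_nat m * Z.of_nat f) - 1)%BinZ.
  by have := expn_gt0 2 (m * f); clear; lia.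
have -> : ((2 ^ (Z.of_nat m * Z.of_nat f) - 1) mod Z.of_nat t)%BinZ = 0%BinZ.
  by rewrite -ZN -Z_of_nat_modn // (eqP tM).
rewrite eqxx /distinct_check -ZN -Z_of_nat_divn // -/M.
move/uniq_allpairs_dep_inj; apply; rewrite ?mem_iota ?ltnS //.
have Ze k l : Zshear_exponent f k l = Z.of_nat (shear_exponent f k l).
  by rewrite /Zshear_exponent /shear_exponent; clear; lia.
by rewrite !Ze -!Z_of_nat_modn // e.
Qed.

Import GroupScope GRing.Theory.
Local Open Scope ring_scope.

(** * Huppert's theorem in characteristic 2 *)

(** Equality holds at d = 1, where the induction starts. *)
Lemma cubic_bound (d : nat) : (((d.+1 * d.+3) ^ 3 <= 8 * 4 ^ (2 * d).+1))%N.
Proof.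
case: d => // d; elim: d => // d IH.
apply: (@leq_trans (16 * (d.+2 * d.+4) ^ 3)).
  by rewrite -[16%N]/(2 * (2 ^ 3))%N -mulnA -expnMn; apply: leq_trans (leq_pmull _ _);
     rewrite ?leq_exp2r //; nia.
apply: leq_trans (leq_mul (leqnn 16) IH) _.
by rewrite mulnCA leq_mul2l /= -[16%N]/(4 ^ 2)%N -expnD; apply: leq_pexp2l => //; lia.
Qed.

(** Here q is the order of a field of scalars, d the dimension of V over it and c a bound for the
    sizes of fixed spaces; the last hypothesis comes from the double count in [card_classTwo_count].
    Cubing that hypothesis eliminates c. *)
Lemma fixed_space_count_absurd (q d c : nat) :
  (4 <= q)%N -> (0 < d)%N -> (c ^ 3 <= q ^ d)%N ->
  (2 * (q ^ d - 1) <= (q - 1) * (d * d - 1) * (c - 1))%N -> False.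
Proof.
case: d => // d q4 _ c3 h; case: d => [|d] in c3 h *.
  by move: h; rewrite muln1 subnn muln0 mul0n expn1; lia.
set b := (q ^ d.+1)%N; have ab : (q ^ d.+2 = q * b)%N by rewrite expnS.
have b1 : (1 < b)%N.
  by rewrite -(exp1n d.+1) ltn_exp2r //; lia.
rewrite ab in c3 h; set k := ((q - 1) * _)%N in h.
have a1 : (0 < q * b - 1)%N by nia.
have h1 : (8 * (q * b - 1) ^ 3 <= k ^ 3 * (q * b - 1))%N.
  rewrite -[8%N]/(2 ^ 3)%N -expnMn.
  apply: leq_trans (_ : (k * (c - 1)) ^ 3 <= _)%N; first by rewrite leq_exp2r.
  rewrite expnMn leq_mul2l; apply/orP; right.
  by case: c c3 h => // c c3 _; rewrite subn1 /=; move: c3; rewrite !expnS expn0; nia.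
have {h1}h2 : (8 * (q * b - 1) ^ 2 <= k ^ 3)%N.
  by rewrite -(leq_pmul2r a1); apply: leq_trans h1; rewrite -mulnA -expnSr.
have h3 : ((q - 1) ^ 2 * b ^ 2 < (q * b - 1) ^ 2)%N.
  by rewrite -expnMn ltn_exp2r //; nia.
have h4 : (8 * b ^ 2 < (q - 1) * (d.+2 * d.+2 - 1) ^ 3)%N.
  have q0 : (0 < (q - 1) ^ 2)%N by rewrite expn_gt0; lia.
  rewrite -(ltn_pmul2l q0); apply: leq_trans (_ : 8 * (q * b - 1) ^ 2 <= _)%N.
    by rewrite mulnCA ltn_pmul2l.
  by apply: leq_trans h2 _; rewrite /k expnMn mulnA -expnSr.
have : (8 * b ^ 2 < (q - 1) * (8 * q ^ (2 * d).+1))%N.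
  apply: leq_trans h4 _; rewrite leq_mul2l; apply/orP; right.
  apply: leq_trans (_ : 8 * 4 ^ (2 * d).+1 <= _)%N.
    by apply: leq_trans (cubic_bound d); rewrite leq_exp2r //; nia.
  by rewrite leq_mul2l /= leq_exp2r.
rewrite /b -expnM (_ : d.+1 * 2 = (2 * d).+2)%N; last by lia.
by rewrite expnS mulnBl mul1n (mulnCA 8) ltnNge leq_subr.
Qed.

Lemma pred_sqr_lt q a : (q * q <= a -> 1 < q -> q.-1 * q.-1 < a.-1)%N.
Proof. by case: q => // q; case: a => // a /=; nia. Qed.

Section SolvableTransitive.

(** The ring [R] plays the role of the endomorphisms of [V]. It is kept abstract to serve two cases:
    matrices over the prime field acting on row vectors, and K acting on itself by
    multiplication. *)
Variables (R : finUnitRingType) (V : finZmodType) (act : V -> R -> V).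
Local Notation "v ** a" := (act v a) (at level 40, left associativity).
Hypotheses (actDl : forall v w a, (v + w) ** a = v ** a + w ** a)
  (actDr : forall v a b, v ** (a + b) = v ** a + v ** b)
  (actM : forall v a b, v ** (a * b) = v ** a ** b)
  (act1 : forall v, v ** 1 = v)
  (act_faithful : forall a, (forall v, v ** a = 0) -> a = 0)
  (act_unit : forall a, (forall v, v ** a = 0 -> v = 0) -> a \is a GRing.unit)
  (addRR : forall a : R, a + a = 0) (addVV : forall v : V, v + v = 0).
Implicit Types (A X Y Z : {group {unit R}}) (S Phi : {set R}) (v : V).

Definition centr S : {set R} := [set r | [forall s in S, r * s == s * r]].

Lemma centrP S r : reflect {in S, forall s, r * s = s * r} (r \in centr S).
Proof.
by rewrite inE; apply: (iffP forall_inP) => h s sS; apply/eqP; exact: h.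
Qed.

Let oppR (a : R) : - a = a.
Proof. by apply/eqP; rewrite eq_sym -addr_eq0 addRR. Qed.

Let oppV v : - v = v.
Proof. by apply/eqP; rewrite eq_sym -addr_eq0 addVV. Qed.

Let act0l a : 0 ** a = 0.
Proof. by apply: (addrI (0 ** a)); rewrite -actDl !addr0. Qed.

Let act0r v : v ** 0 = 0.
Proof. by apply: (addrI (v ** 0)); rewrite -actDr !addr0. Qed.

Let act_suml I (r : seq I) (F : I -> V) a :
  (\sum_(i <- r) F i) ** a = \sum_(i <- r) F i ** a.
Proof. by elim/big_rec2: _ => // i y x _ <-; rewrite actDl. Qed.


Let unitK (a : {unit R}) : val a * val (a^-1)%g = 1.
Proof. by rewrite -[_ * _]/(val (a * a^-1)%g) mulgV. Qed.

Let unitVK (a : {unit R}) : val (a^-1)%g * val a = 1.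
Proof. by rewrite -[_ * _]/(val (a^-1 * a)%g) mulVg. Qed.

Let actK (a : {unit R}) v : v ** val a ** val (a^-1)%g = v.
Proof. by rewrite -actM unitK act1. Qed.


Let act_inj (a : {unit R}) : injective (fun v => v ** val a).
Proof. by apply: (can_inj (g := fun v => v ** val (a^-1)%g)) => v; exact: actK. Qed.

Let act_eq0 (a : {unit R}) v : (v ** val a == 0) = (v == 0).
Proof. by rewrite -(inj_eq (@act_inj a) v 0) act0l. Qed.

Let unit1 : val (1%g : {unit R}) = 1. Proof. by []. Qed.

Let unitM (x y : {unit R}) : val (x * y)%g = val x * val y. Proof. by []. Qed.

Let unit_eq1 (x : {unit R}) : val x + 1 = 0 -> x = 1%g.
Proof. by move/eqP; rewrite addr_eq0 oppR => /eqP e; apply: val_inj. Qed.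

Let unit_sqr (x : {unit R}) : (x ^+ 2)%g = 1%g -> (val x + 1) * (val x + 1) = 0.
Proof.
move=> x2; rewrite mulrDl mulrDr mulr1 mul1r addrA -(addrA (_ * _)) addRR addr0.
by rewrite -[val x * val x]/(val (x ^+ 2)%g) x2 addRR.
Qed.

(** Nonzero elements act injectively, hence are units by [act_unit], and by finiteness their
    inverses are powers of them. So [Phi] is a field and [V] a vector space over it. *)
Definition subfield_set Phi : Prop :=
  [/\ 0 \in Phi, 1 \in Phi, {in Phi &, forall a b, a + b \in Phi},
      {in Phi &, forall a b, a * b \in Phi}
    & {in Phi &, forall a b, a * b = b * a}]
  /\ (forall a v, a \in Phi -> a != 0 -> v ** a = 0 -> v = 0).

Definition transitive_act A :=
  forall v w : V, v != 0 -> w != 0 -> exists2 a, a \in A & v ** val a = w.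

(* All the annihilators of nonzero vectors are conjugate, hence have the same
   cardinality; applied to v, w and v + w this forces them to be equal. *)
Lemma normalized_subring_field A Phi :
  transitive_act A ->
  [/\ 0 \in Phi, 1 \in Phi, {in Phi &, forall a b, a + b \in Phi},
      {in Phi &, forall a b, a * b \in Phi}
    & {in Phi &, forall a b, a * b = b * a}] ->
  (forall a r, a \in A -> r \in Phi -> val (a^-1)%g * r * val a \in Phi) ->
  subfield_set Phi.
Proof.
move=> Atr Phir nPhi; split=> //; case: Phir => P0 P1 PD PM PC.
pose Ann v := [set r in Phi | v ** r == 0].
have AnnE v r : (r \in Ann v) = (r \in Phi) && (v ** r == 0) by rewrite inE.
have leAnn v (a : {unit R}) : a \in A -> (#|Ann v| <= #|Ann (v ** val a)|)%N.
  move=> aA; rewrite -(card_imset (f := fun r => val (a^-1)%g * r * val a) (Ann v)).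
    apply/subset_leq_card/subsetP=> _ /imsetP[r + ->].
    rewrite !AnnE => /andP[rP /eqP vr]; rewrite nPhi //=.
    by rewrite !actM actK vr act0l.
  move=> r s /(congr1 (fun r => val a * r * val (a^-1)%g)).
  by rewrite -!mulrA unitK !mulr1 !mulrA unitK !mul1r.
have eqAnn v (w : V) : v != 0 -> w != 0 -> #|Ann v| = #|Ann w|.
  move=> v0 w0; apply/eqP; rewrite eqn_leq.
  have [a aA <-] := Atr v w v0 w0; rewrite leAnn //=.
  have va0 : v ** val a != 0 by rewrite act_eq0.
  have [b bA e] := Atr _ v va0 v0.
  by rewrite -[X in (_ <= #|Ann X|)%N]e leAnn.
(* Commutativity gives one inclusion, equality of cardinalities the other. *)
have AnnM v r : r \in Phi -> v ** r != 0 -> Ann (v ** r) = Ann v.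
  move=> rP vr0; have v0 : v != 0 by apply: contraNneq vr0 => ->; rewrite act0l.
  apply/esym/eqP; rewrite eqEcard (eqAnn v (v ** r)) // leqnn andbT.
  apply/subsetP=> s; rewrite !AnnE => /andP[sP /eqP vs]; rewrite sP /=.
  by rewrite -actM PC // actM vs act0l.
move=> a v aP a0 va; apply/eqP/negPn/negP=> v0.
case/negP: a0; apply/eqP/act_faithful=> w; apply/eqP/negPn/negP=> wa.
have w0 : w != 0 by apply: contraNneq wa => ->; rewrite act0l.
have vwa : (v + w) ** a = w ** a by rewrite actDl va add0r.
have e1 : Ann (v + w) = Ann w by rewrite -(AnnM (v + w) a) ?vwa // AnnM.
have sub : Ann w \subset Ann v.
  apply/subsetP=> s sw; have: s \in Ann (v + w) by rewrite e1.
  move: sw; rewrite !AnnE => /andP[-> /eqP ws] /=.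
  by rewrite actDl ws addr0.
have/eqP e2 : Ann w == Ann v by rewrite eqEcard sub (eqAnn v w) ?leqnn.
have: a \in Ann v by rewrite AnnE aP va eqxx.
by rewrite -e2 AnnE aP (negPf wa).
Qed.

Section Field.

Variable Phi : {set R}.
Hypothesis fPhi : subfield_set Phi.

Let P0 : 0 \in Phi. Proof. by case: fPhi => [[]]. Qed.
Let P1 : 1 \in Phi. Proof. by case: fPhi => [[]]. Qed.
Let PD : {in Phi &, forall a b, a + b \in Phi}. Proof. by case: fPhi => [[]]. Qed.
Let PM : {in Phi &, forall a b, a * b \in Phi}. Proof. by case: fPhi => [[]]. Qed.
Let PC : {in Phi &, forall a b, a * b = b * a}. Proof. by case: fPhi => [[]]. Qed.
Let Pinj a v : a \in Phi -> a != 0 -> v ** a = 0 -> v = 0.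
Proof. by case: fPhi => _; apply. Qed.

Let Punit a : a \in Phi -> a != 0 -> a \is a GRing.unit.
Proof. by move=> aP a0; apply: act_unit => v; exact: Pinj. Qed.

Let Pmul_eq0 a b : a \in Phi -> a != 0 -> a * b = 0 -> b = 0.
Proof.
by move=> aP a0 ab; apply: (mulrI (Punit aP a0)); rewrite ab mulr0.
Qed.

Let Pinv a : a \in Phi -> a != 0 -> a^-1 \in Phi.
Proof.
move=> aP a0; have ui := Punit aP a0.
have [l l0 el] : exists2 l, (0 < l)%N & a ^+ l = 1.
  exists #[FinRing.unit R ui]%g; first exact: order_gt0.
  by rewrite -[a]/(val (FinRing.unit R ui)) -FinRing.val_unitX expg_order.
have -> : a^-1 = a ^+ l.-1.
  by apply: (mulrI ui); rewrite divrr // -exprS prednK.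
by elim: (l.-1) => [|j IH]; rewrite ?expr0 // exprS PM.
Qed.

Lemma card_subfield_set_gt1 : (1 < #|Phi|)%N.
Proof. by rewrite (cardD1 0) (cardD1 1) P0 !inE P1 oner_eq0. Qed.

Lemma subfield_set_group_cyclic X : {in X, forall x, val x \in Phi} -> cyclic X.
Proof.
move=> XP.
apply: (@div_ring_mul_group_cyclic _ _ _ (fun x : {unit R} => val x)) => //.
  move=> x /setD1P[x1 xX]; apply: Punit; first by rewrite oppR PD ?XP.
  by rewrite subr_eq0; apply: contraNneq x1 => xE; apply/eqP/val_inj.
apply/centsP=> x xX y yX; apply: val_inj; exact: PC (XP _ xX) (XP _ yX).
Qed.

Definition vspan d (s : 'I_d -> V) : {set V} :=
  [set v | [exists f : {ffun 'I_d -> R},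
     [forall i, f i \in Phi] && (v == \sum_i s i ** f i)]].

Lemma vspanP d (s : 'I_d -> V) v : reflect (exists2 f : 'I_d -> R,
    (forall i, f i \in Phi) & v = \sum_i s i ** f i) (v \in vspan s).
Proof.
rewrite inE; apply: (iffP existsP) => [[f /andP[/forallP fP /eqP->]]|[f fP ->]].
  by exists f.
exists [ffun i => f i]; apply/andP; split; first by apply/forallP=> i; rewrite ffunE.
by apply/eqP/eq_bigr=> i _; rewrite ffunE.
Qed.

(** A basis is built greedily: after k steps the family spans everything or consists of k
    independent vectors, independence being recorded by the cardinality of the span. For k the
    cardinality of [V] the second case is impossible. *)
Lemma card_subfield_set_vec :
  exists d (s : 'I_d -> V), #|{: V}| = (#|Phi| ^ d)%N /\ vspan s = [set: V].
Proof.
suff H k : exists d (s : 'I_d -> V), #|vspan s| = (#|Phi| ^ d)%N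
     /\ (vspan s = [set: V] \/ d = k).
  have [d [s [c [e|e]]]] := H #|{: V}|; first by exists d, s; rewrite -c e cardsT.
  have := max_card [in vspan s]; rewrite c e leqNgt.
  by rewrite ltn_expl ?card_subfield_set_gt1.
elim: k => [|k [d [s [c []]]]].
- exists 0%N, (fun _ => 0); split; last by right.
  rewrite expn0 (_ : vspan _ = [set 0]) ?cards1 //.
  apply/setP=> v; apply/vspanP/set1P=> [[f _ ->]|->]; first by rewrite big_ord0.
  by exists (fun _ => 0) => [[]|] //; rewrite big_ord0.
- by exists d, s; split=> //; left.
move=> ed; have [e|ne] := eqVneq (vspan s) [set: V].
  by exists d, s; split=> //; left.
have /subsetPn[w _ wns] : ~~ ([set: V] \subset vspan s) by rewrite subTset.
pose s' (i : 'I_d.+1) := if unlift ord0 i is Some j then s j else w.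
exists d.+1, s'; split; last by right; rewrite ed.
pose g (p : R * V) := w ** p.1 + p.2.
rewrite expnS -c -cardsX -(card_in_imset (f := g)).
  apply: eq_card=> v; apply/vspanP/imsetP.
    case=> f fP ->.
    exists (f ord0, \sum_i s i ** f (lift ord0 i)).
      by rewrite inE /= fP; apply/vspanP; exists (fun i => f (lift ord0 i)).
    rewrite /g /= big_ord_recl; congr (_ + _); first by rewrite /s' unlift_none.
    by apply: eq_bigr=> i _; rewrite /s' liftK.
  case=> -[a u] /setXP[aP /vspanP[f fP /= ->]] ->.
  exists (fun i => if unlift ord0 i is Some j then f j else a).
    by move=> i; case: (unlift _ _).
  rewrite /g /= big_ord_recl; congr (_ + _); first by rewrite /s' unlift_none.
  by apply: eq_bigr=> i _; rewrite /s' liftK.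
move=> [a u] [b t] /setXP[aP us] /setXP[bP ts] e.
suff ab : a = b by move: e; rewrite /g /= ab => /addrI->.
apply/eqP/negPn/negP=> nab; case/negP: wns.
have abP : a + b \in Phi by exact: PD.
have nab0 : a + b != 0 by rewrite addr_eq0 oppR.
have [f fP fE] := vspanP _ _ us; have [h hP hE] := vspanP _ _ ts.
apply/vspanP; exists (fun i => (f i + h i) * (a + b)^-1) => [i|].
  by rewrite PM ?PD ?Pinv.
have -> : w = w ** (a + b) ** (a + b)^-1 by rewrite -actM divrr ?act1 ?Punit.
have -> : w ** (a + b) = u + t.
  rewrite actDr.
  have -> : w ** a = w ** b + t + u by rewrite -[LHS](addrK u) oppV; congr (_ + u).
  by rewrite (addrC _ (w ** b)) !addrA addVV add0r addrC.
rewrite -[u]/((a, u).2) -[t]/((b, t).2) fE hE -big_split act_suml.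
by apply: eq_bigr=> i _ /=; rewrite -actDr -actM.
Qed.

(** An element commuting with [Phi] acts linearly over it, and is determined by the images of a
    spanning family. *)
Lemma card_centr_le d (s : 'I_d -> V) :
  vspan s = [set: V] -> (#|centr Phi| <= #|{: V}| ^ d)%N.
Proof.
move=> sV; rewrite -[d in X in (_ <= X)%N]card_ord -card_ffun.
rewrite -(card_in_imset (f := fun r => [ffun i => s i ** r])) ?max_card //.
move=> r r' /centrP rC /centrP r'C /ffunP e.
apply/eqP; rewrite -[r' in _ == r']oppR -addr_eq0; apply/eqP/act_faithful=> v.
have /vspanP[f fP ->] : v \in vspan s by rewrite sV.
rewrite actDr !act_suml -big_split big1 // => i _ /=.
by have := e i; rewrite !ffunE -!actM -rC // -r'C // !actM => ->; rewrite addVV.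
Qed.

Section ClassTwo.

(** In the application [X] is a maximal abelian normal subgroup and [Y / X] a minimal normal
    subgroup of its centralizer modulo [X]; so [X] consists of scalars and [Y] has class at most
    two. *)
Variables X Y : {group {unit R}}.
Hypotheses (XP : {in X, forall x, val x \in Phi}) (sXY : X \subset Y)
  (YC : {in Y, forall y, val y \in centr Phi})
  (YX : {in Y &, forall y w, [~ y, w] \in X})
  (ZX : 'Z(Y) \subset X).

Let CC y a : y \in Y -> a \in Phi -> val y * a = a * val y.
Proof. by move=> /YC /centrP/(_ a); apply. Qed.

Let notXP y : y \in Y -> y \notin X -> exists2 w, w \in Y & [~ y, w] != 1%g.
Proof.
move=> yY ynX; apply/exists_inP; apply: contraR ynX => /exists_inPn h.
apply: (subsetP ZX); apply/centerP; split=> // w wY.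
by apply/commgP; move: (h w wY); rewrite negbK.
Qed.

(* The usual proof of Dedekind's lemma: conjugation by an element of Y
   multiplies the terms of a relation by distinct scalars. *)
Lemma transversal_free (T : {set {unit R}}) (f : {unit R} -> R) :
  T \subset Y -> {in T &, forall t u, t != u -> (t * u^-1)%g \notin X} ->
  (forall t, f t \in Phi) -> \sum_(t in T) f t * val t = 0 ->
  {in T, forall t, f t = 0}.
Proof.
move=> TY TX; have [k] := ubnP #|[set t in T | f t != 0]|.
elim: k f => // k IH f lek fP sum0 t1 t1T; apply/eqP/negPn/negP=> ft1.
have [t2 | none] := pickP (fun t2 => [&& t2 \in T, t2 != t1 & f t2 != 0]); last first.
  move: sum0; rewrite (bigD1 t1) //= big1 ?addr0 => [ft0|t /andP[tT tt1]].
    by case/negP: ft1; rewrite -[f t1]mulr1 -(unitK t1) mulrA ft0 mul0r.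
  by have := none t; rewrite tT tt1 /= => /negbFE /eqP ->; rewrite mul0r.
case/and3P=> t2T t21 ft2.
have tY t : t \in T -> t \in Y by exact: subsetP.
(* The quotient of the two representatives lies outside the center, so some [y] multiplies [t1] and
   [t2] by different scalars. *)
have [y yY ny] : exists2 y, y \in Y & [~ (t1 * t2^-1)%g, y] != 1%g.
  apply: notXP; first by rewrite groupM ?groupV ?tY.
  by rewrite TX // eq_sym.
pose z t := val [~ t, y].
have zP t : t \in T -> z t \in Phi.
  by move=> tT; apply: XP; apply: YX; [exact: tY | exact: yY].
have conj t : t \in T -> val (y^-1)%g * val t * val y = z t * val t.
  move=> tT; rewrite -(CC (tY t tT) (zP t tT)) -[RHS]/(val (t * [~ t, y])%g).
  by rewrite commgEl mulKVg /conjg mulgA.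
(* The relation conjugated by [y], plus [z t1] times the original one: the term at [t1] cancels and
   the one at [t2] survives. *)
pose g t := if t \in T then f t * (z t + z t1) else 0.
have gP t : g t \in Phi by rewrite /g; case: ifP => // tT; rewrite PM ?PD ?zP.
have fC t (u : {unit R}) : u \in Y -> val u * f t = f t * val u by move=> uY; rewrite CC.
have e1 : \sum_(t in T) f t * z t * val t = 0.
  have : val (y^-1)%g * (\sum_(t in T) f t * val t) * val y = 0.
    by rewrite sum0 mulr0 mul0r.
  rewrite mulr_sumr mulr_suml => e0; rewrite -[RHS]e0; apply: eq_bigr=> t tT.
  by rewrite -(mulrA (f t)) -conj // !mulrA fC ?groupV.
have e2 : \sum_(t in T) g t * val t = 0.
  transitivity (\sum_(t in T) f t * z t * val t + z t1 * \sum_(t in T) f t * val t).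
    rewrite mulr_sumr -big_split; apply: eq_bigr=> t tT /=; rewrite /g tT.
    by rewrite mulrDr mulrDl mulrA [f t * z t1]PC ?zP.
  by rewrite e1 sum0 mulr0 addr0.
have lt : (#|[set t in T | g t != 0%R]| < k)%N.
  rewrite -ltnS; apply: leq_trans lek; rewrite ltnS; apply/proper_card/properP; split.
    apply/subsetP=> t; rewrite !inE /g => /andP[tT]; rewrite tT /=.
    by apply: contra => /eqP->; rewrite mul0r.
  by exists t1; rewrite !inE t1T // /g t1T addRR mulr0 eqxx.
have := IH g lt gP e2 t2 t2T; rewrite /g t2T => /(Pmul_eq0 (fP _) ft2)/eqP.
rewrite addr_eq0 oppR => /eqP/val_inj e; case/negP: ny; apply/eqP.
have ce t : (t ^ y = t * [~ t, y])%g by rewrite commgEl mulKVg.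
by rewrite commgEl conjMg conjVg !ce e !invMg invgK !mulgA mulgKV !mulgK mulgV.
Qed.

(** Combinations of a transversal of [X] in [Y] with coefficients in [Phi] are pairwise distinct and
    commute with [Phi]. Comparison with [card_centr_le] bounds the exponent. *)
Lemma card_quotient_le d (s : 'I_d -> V) :
  #|{: V}| = (#|Phi| ^ d)%N -> vspan s = [set: V] -> (#|Y : X| <= d * d)%N.
Proof.
move=> cV sV; rewrite -(leq_exp2l _ _ card_subfield_set_gt1) expnM -cV.
apply: leq_trans (card_centr_le sV).
pose T := repr @: rcosets X Y.
have reprT c : c \in rcosets X Y -> X :* repr c = c.
  by case/rcosetsP=> y yY ->; rewrite rcoset_repr.
have cT : #|T| = #|Y : X|.
  by rewrite card_in_imset // => c c' cR c'R e; rewrite -(reprT c) // e reprT.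
have TY : T \subset Y.
  apply/subsetP=> _ /imsetP[c /rcosetsP[y yY ->] ->].
  have := mem_repr_rcoset X y; rewrite mem_rcoset => yr.
  by rewrite -[repr _](mulgKV y) groupM // (subsetP sXY).
have TX : {in T &, forall t u, t != u -> (t * u^-1)%g \notin X}.
  move=> _ _ /imsetP[c cR ->] /imsetP[c' c'R ->]; apply: contra => h.
  by rewrite -(reprT c) // -(reprT c') // (rcoset_eqP (_ : repr c \in X :* repr c')) //
    mem_rcoset.
rewrite -cT -(card_pffun_on 0).
pose F (f : {ffun {unit R} -> R}) := \sum_(t in T) f t * val t.
have inP f : f \in pffun_on 0 (mem T) (mem Phi) ->
    (forall t, f t \in Phi) /\ (forall t, t \notin T -> f t = 0).
  case/pffun_onP=> /subsetP sf fP; have out t : t \notin T -> f t = 0.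
    by move=> tT; apply/eqP; apply: contraNT tT => ft; apply: sf.
  split=> // t; have [tT|/out->//] := boolP (t \in T).
  by apply: fP; apply: image_f.
rewrite -(card_in_imset (f := F)).
  apply/subset_leq_card/subsetP=> _ /imsetP[f /inP[fP _] ->].
  apply/centrP=> a aP; rewrite mulr_suml mulr_sumr; apply: eq_bigr=> t tT.
  by rewrite -mulrA (CC (subsetP TY t tT)) // !mulrA [f t * a]PC.
move=> f g /inP[fP f0] /inP[gP g0] e.
apply/ffunP=> t; have [tT|tT] := boolP (t \in T); last by rewrite f0 ?g0.
apply/eqP; rewrite -[g t]oppR -addr_eq0; apply/eqP.
apply: (transversal_free (f := fun t => f t + g t)) tT => // [u|].
  by rewrite PD.
transitivity (F f + F g); last by rewrite e addRR.
by rewrite -big_split; apply: eq_bigr=> u _ /=; rewrite mulrDl.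
Qed.

Definition fixv (y : {unit R}) : {set V} := [set v | v ** val y == v].

Lemma fixvP y v : reflect (v ** val y = v) (v \in fixv y).
Proof. by rewrite inE; exact: eqP. Qed.

(* The conjugates y, y z and y z^2 of y (z a scalar) have independent fixed
   spaces. *)
Lemma card_fixv y : y \in Y -> y \notin X -> (#|fixv y| ^ 3 <= #|{: V}|)%N.
Proof.
move=> yY ynX; have [w wY nyw] := notXP yY ynX.
pose zeta := val [~ y, w]^-1%g.
have zX : [~ y, w] \in X by rewrite YX.
have zP : zeta \in Phi by rewrite XP ?groupV.
have z1 : zeta + 1 != 0.
  rewrite addr_eq0 oppR; apply: contra nyw => /eqP e; rewrite -invg_eq1; apply/eqP.
  exact: val_inj.
have zy : zeta * val y = val y * zeta by rewrite CC.
(* Translating by [w] multiplies an eigenvalue of [y] by [zeta], so [v0], [u1] and [u2] below belong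
   to 1, [zeta] and [zeta ^ 2]. *)
have shift v a : a \in Phi -> v ** val y = v ** a ->
    (v ** val w) ** val y = v ** val w ** (a * zeta).
  move=> aP e; rewrite -!actM.
  have -> : val w * val y = val y * val w * zeta.
    rewrite -[LHS]/(val (w * y)%g) -[RHS]/(val (y * w * [~ y, w]^-1)%g).
    by congr (val _); rewrite invg_comm commgEl mulgA mulgK conjgE !mulgA mulgV mul1g.
  rewrite !actM e.
  by rewrite -!actM !mulrA (CC wY aP).
rewrite expnS expnS expn1 -!cardsX.
pose g (p : V * (V * V)) := p.1 + p.2.1 ** val w + p.2.2 ** val w ** val w.
rewrite -(card_in_imset (f := g)) ?max_card //.
have key v0 v1 v2 : v0 \in fixv y -> v1 \in fixv y -> v2 \in fixv y ->
    g (v0, (v1, v2)) = 0 -> [/\ v0 = 0, v1 = 0 & v2 = 0].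
  rewrite /g /=; set u1 := v1 ** _; set u2 := v2 ** _ ** _.
  move=> /fixvP y0 /fixvP f1 /fixvP f2 sum0.
  have y1 : u1 ** val y = u1 ** zeta by rewrite /u1 (shift _ 1) ?act1 ?mul1r.
  have y2 : u2 ** val y = u2 ** (zeta * zeta).
    by rewrite /u2 (shift _ zeta) // (shift _ 1) ?act1 ?mul1r.
  (* Applying [y + 1] to the sum kills [v0]; applying [y + zeta] next, in [h3], kills [u1]. *)
  have h1 : (u1 + u2 ** (zeta + 1)) ** (zeta + 1) = 0.
    have : (v0 + u1 + u2) ** val y + (v0 + u1 + u2) = 0 by rewrite sum0 act0l addr0.
    have sq : (zeta + 1) * (zeta + 1) = zeta * zeta + 1.
      by rewrite mulrDl mulrDr mulr1 mul1r addrA -(addrA (zeta * zeta)) addRR addr0.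
    rewrite !actDl y0 y1 y2 addrACA (addrACA v0) addVV add0r => <-.
    by rewrite -actM sq !actDr !act1.
  have zP1 : zeta + 1 \in Phi by rewrite PD.
  have {h1}h2 := Pinj zP1 z1 h1.
  have h3 : u2 ** (zeta * (zeta + 1) * (zeta + 1)) = 0.
    have e1 : (u1 + u2 ** (zeta + 1)) ** val y = 0 by rewrite h2 act0l.
    have e2 : (u1 + u2 ** (zeta + 1)) ** zeta = 0 by rewrite h2 act0l.
    move: e1; rewrite actDl -(actM u2) -(CC yY) // actM y1 y2 -actM => e1.
    move: e2; rewrite actDl -actM => e2.
    move: (congr2 +%R e1 e2); rewrite addr0 addrACA addVV add0r -actDr => <-.
    rewrite (PC zP1 zP) -!mulrA -mulrDr; congr (_ ** (_ * _)).
    by rewrite [LHS]mulrDl mul1r.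
  have zP0 : zeta \in Phi by [].
  have {h3}u20 : u2 = 0.
    have z0 : zeta != 0.
      apply/eqP=> z0; have := unitK [~ y, w]; rewrite -/zeta z0 mulr0 => /eqP.
      by rewrite eq_sym oner_eq0.
    by move: h3; rewrite !actM => /(Pinj zP1 z1)/(Pinj zP1 z1)/(Pinj zP z0).
  have u10 : u1 = 0 by move: h2; rewrite u20 act0l addr0.
  move: sum0; rewrite u10 u20 !addr0 => ->; split=> //.
    by apply/eqP; rewrite -(act_eq0 w) -/u1 u10.
  by apply/eqP; rewrite -(act_eq0 w) -(act_eq0 w) -/u2 u20.
have fixD u v : u \in fixv y -> v \in fixv y -> u + v \in fixv y.
  by move=> /fixvP eu /fixvP ev; apply/fixvP; rewrite actDl eu ev.
move=> [u0 [u1 u2]] [v0 [v1 v2]] /setXP[/= u0F /setXP[/= u1F u2F]].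
move=> /setXP[/= v0F /setXP[/= v1F v2F]] e.
have [] := @key (u0 + v0) (u1 + v1) (u2 + v2); rewrite ?fixD //.
  transitivity (g (u0, (u1, u2)) + g (v0, (v1, v2))); last by rewrite e addVV.
  by rewrite /g /= !actDl [RHS]addrACA; congr (_ + _); rewrite addrACA.
by do 3![move=> /eqP; rewrite addr_eq0 oppV => /eqP ->].
Qed.

(** This is the structure of Frobenius complements. An involution [y] would fix the image of
    [y + 1], so [Y] has odd order. Differences of distinct elements are units, so elementary abelian
    subgroups are cyclic; hence so are the Sylow subgroups, and the nilpotent group [Y] too. *)
Lemma classTwo_semiregular_abelian :
  (forall y v, y \in Y -> v ** val y = v -> v != 0 -> y = 1%g) -> abelian Y.
Proof.
move=> sr; have cX : {in X & Y, forall x y, commute x y}.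
  by move=> x y xX yY; apply: val_inj; apply: esym; exact: CC (XP xX).
have commX p (y w : {unit R}) : y \in Y -> w \in Y -> [~ y ^+ p, w]%g = ([~ y, w] ^+ p)%g.
  move=> yY wY; apply: commXg; apply/commute_sym/cX => //; exact: YX.
have invol y : y \in Y -> (y ^+ 2)%g = 1%g -> y = 1%g.
  move=> yY y2; apply/eqP/negPn/negP=> y1.
  have [v v0] : exists v, v ** (val y + 1) != 0.
    apply/existsP; apply: contraNT y1 => /existsPn h; apply/eqP/unit_eq1.
    apply: act_faithful => v.
    by move/negPn/eqP: (h v).
  set u := v ** _ in v0; case/eqP: y1; apply: (sr y u) => //.
  apply/eqP; rewrite -{2}[u]oppV -addr_eq0 -{2}[u]act1 -actDr /u -actM.
  by rewrite (unit_sqr y2) act0r.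
have oddY : odd #|Y|.
  apply: contraT => ev; have [] := @Cauchy _ 2 Y; rewrite ?dvdn2 // => y yY oy.
  by have := invol y yY; rewrite -oy expg_order => /(_ erefl) y1; rewrite y1 order1 in oy.
have nilY : nilpotent Y.
  apply: small_nil_class; apply: leq_trans (_ : nil_class Y <= 2)%N _ => //.
  rewrite nil_class2 gen_subG; apply/subsetP=> _ /imset2P[y w yY wY ->].
  apply/centerP; split; first by rewrite (subsetP sXY) ?YX.
  by move=> u uY; apply: cX (YX yY wY) uY.
apply: cyclic_abelian; apply: nil_Zgroup_cyclic nilY; apply/forall_inP=> P.
case/SylowP=> p _ sylP; have [sPY pP] := (pHall_sub sylP, pHall_pgroup sylP).
rewrite (odd_pgroup_rank1_cyclic pP (oddSg sPY oddY)) leqNgt; apply/negP.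
case/p_rank_geP=> E /pnElemP[sEP abE dE]; have sEY := subset_trans sEP sPY.
suff cE : cyclic E.
  by move: (abelem_cyclic abE); rewrite cE dE.
apply: (@div_ring_mul_group_cyclic _ _ _ (fun x : {unit R} => val x)) => //.
  move=> x /setD1P[x1 xE]; apply: act_unit => v vx; apply/eqP/negPn/negP=> v0.
  case/eqP: x1; apply: (sr x v) => //; first exact: subsetP sEY _ xE.
  move/eqP: vx; rewrite oppR actDr act1 addr_eq0 oppV; exact: eqP.
exact: abelem_abelian abE.
Qed.

(** The pairs of a nonzero vector and an element of [Y] outside [X] fixing it are counted twice. All
    stabilizers have the same order, and this is at least 3: not 1, since [Y] is not abelian, and
    not 2, since the commutators of an involution of [Y] would be scalars of square 1, hence trivial
    in characteristic 2. No scalar but 1 fixes a nonzero vector. *)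
Lemma card_classTwo_count :
  ~~ abelian Y -> (forall v w : V, v != 0 -> w != 0 ->
     #|[set y in Y | v ** val y == v]| = #|[set y in Y | w ** val y == w]|) ->
  exists2 c, (c ^ 3 <= #|{: V}|)%N &
    (2 * (#|{: V}| - 1) <= (#|Y| - #|X|) * (c - 1))%N.
Proof.
move=> nabY half; have cX : {in X & Y, forall x y, commute x y}.
  by move=> x y xX yY; apply: val_inj; apply: esym; exact: CC (XP xX).
pose St v := [set y in Y | v ** val y == v].
have StE v y : (y \in St v) = (y \in Y) && (v ** val y == v) by rewrite inE.
have XSt v x : x \in X -> v ** val x = v -> v != 0 -> x = 1%g.
  move=> xX xv; apply: contraNeq => x1.
  have : v ** (val x + 1) = 0 by rewrite actDr act1 xv addVV.
  move/Pinj->; rewrite ?PD ?XP //; apply: contra x1 => /eqP e.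
  by apply/eqP/unit_eq1.
have [v1 v10 [y1 y1Y [yv1 y1n1]]] : exists2 v1, v1 != 0 & exists2 y1, y1 \in Y
   & v1 ** val y1 = v1 /\ y1 != 1%g.
  have [|h] := boolP [exists v1 in [set v | v != 0], exists y1 in Y,
      (v1 ** val y1 == v1) && (y1 != 1%g)].
    case/exists_inP=> v1; rewrite inE => v10 /exists_inP[y1 y1Y /andP[/eqP e n1]].
    by exists v1 => //; exists y1.
  case/negP: nabY; apply: classTwo_semiregular_abelian => y v yY yv v0.
  move/exists_inPn: h => /(_ v); rewrite inE v0 => /(_ isT)/exists_inPn/(_ y yY).
  by rewrite yv eqxx /= negbK => /eqP.
have gSt v : group_set (St v).
  apply/group_setP; split=> [|x y]; first by rewrite StE group1 unit1 act1 eqxx.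
  rewrite !StE => /andP[xY /eqP xv] /andP[yY /eqP yv]; rewrite groupM //.
  by rewrite unitM actM xv yv eqxx.
have St3 v : v != 0 -> (3 <= #|St v|)%N.
  move=> v0; rewrite (half v v1) // -/(St v1).
  have y1S : y1 \in St v1 by rewrite StE y1Y yv1 eqxx.
  have y1X : y1 \notin X by apply: contra y1n1 => /XSt/(_ yv1 v10)->.
  have c1 : (1 < #|St v1|)%N.
    rewrite (cardsD1 1%g) (cardsD1 y1 (St v1 :\ _)) in_setD1 !StE group1 y1n1 y1Y.
    by rewrite yv1 unit1 act1 !eqxx.
  rewrite ltn_neqAle c1 andbT; apply/negP=> /eqP c2; have := y1X.
  have -> // : y1 \in X.
  apply: contraT => _; have [w wY nw] := notXP y1Y y1X.
  have o2 : (y1 ^+ 2)%g = 1%g.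
    by have /= := @expg_cardG _ (Group (gSt v1)) y1 y1S; rewrite -c2.
  have : [~ y1, w]%g \in X by rewrite YX.
  have : ([~ y1, w] ^+ 2)%g = 1%g.
    rewrite -commXg ?o2 ?comm1g //; apply/commute_sym/cX => //; exact: YX.
  set z := [~ _, _]; rewrite -/z in nw * => z2 zX; case/negP: nw.
  apply/eqP/unit_eq1; have [//|e] := eqVneq (val z + 1) 0.
  by apply: Pmul_eq0 (unit_sqr z2) => //; rewrite PD ?XP.
pose c := \max_(y in Y :\: X) #|fixv y|.
have cle y : y \in Y -> y \notin X -> (#|fixv y| <= c)%N.
  by move=> yY yX; apply: (leq_bigmax_cond y); rewrite inE yY yX.
have c3 : (c ^ 3 <= #|{: V}|)%N.
  have [e|D0] := posnP #|Y :\: X|.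
    by rewrite /c (cards0_eq e) big_set0 exp0n.
  rewrite /c; have [y yD ->] := eq_bigmax_cond (fun y => #|fixv y|) D0.
  by move: yD; rewrite inE => /andP[yX yY]; rewrite card_fixv.
exists c => //.
pose pairs := [set p : V * {unit R} | [&& p.1 != 0, p.2 \in Y :\: X & p.1 ** val p.2 == p.1]].
apply: (@leq_trans #|pairs|).
  rewrite -sum1dep_card (eq_bigl (fun p : V * {unit R} => (p.1 \in [set~ 0]) &&
     ((p.2 \in Y :\: X) && (p.1 ** val p.2 == p.1)))); last by move=> p; rewrite !inE.
  rewrite -(pair_big_dep (mem [set~ 0]) (fun v y => (y \in Y :\: X) &&
     (v ** val y == v)) (fun _ _ => 1%N)) /=.
  rewrite -[#|{: V}|]cardsT (cardsD1 0 [set: V]) inE addKn mulnC -sum_nat_const.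
  have -> : [set: V] :\ 0 = [set~ 0] by apply/setP=> v; rewrite !inE andbT.
  apply: leq_sum => v; rewrite !inE => v0; rewrite sum1dep_card.
  have := St3 v v0; rewrite (cardsD1 1%g) StE group1 unit1 act1 eqxx ltnS.
  move/leq_trans; apply; apply/subset_leq_card/subsetP=> y.
  rewrite in_setD1 StE => /and3P[y1' yY /eqP yv]; rewrite inE inE yY yv eqxx !andbT.
  by apply: contra y1' => /XSt/(_ yv v0)->.
rewrite -sum1dep_card (eq_bigl (fun p : V * {unit R} => true && 
   ((p.2 \in Y :\: X) && ((p.1 \in [set~ 0]) && (p.1 ** val p.2 == p.1))))); last first.
  by move=> p; rewrite !inE /= andbCA.
rewrite -(pair_big_dep predT (fun v y => (y \in Y :\: X) &&
     ((v \in [set~ 0]) && (v ** val y == v))) (fun _ _ => 1%N)) /=.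
rewrite (exchange_big_dep (fun y => y \in Y :\: X)) /=; last first.
  by move=> v y _ /andP[].
have -> : (#|Y| - #|X| = #|Y :\: X|)%N by rewrite cardsD (setIidPr sXY).
rewrite -sum_nat_const; apply: leq_sum => y yD.
rewrite sum1dep_card; move: (yD); rewrite inE => /andP[yX yY].
apply: leq_trans (leq_sub2r 1 (cle y yY yX)).
have f0 : 0 \in fixv y by apply/fixvP; rewrite act0l.
rewrite (cardsD1 0 (fixv y)) f0 addKn; apply/subset_leq_card/subsetP=> v.
by rewrite in_setD1 !inE => /and3P[_ -> ->].
Qed.

End ClassTwo.

End Field.

Lemma centr_subring S :
  [/\ 0 \in centr S, 1 \in centr S, {in centr S &, forall a b, a + b \in centr S}
    & {in centr S &, forall a b, a * b \in centr S}].
Proof.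
split; first by apply/centrP=> s _; rewrite mulr0 mul0r.
- by apply/centrP=> s _; rewrite mulr1 mul1r.
- by move=> a b /centrP aC /centrP bC; apply/centrP=> s sS; rewrite mulrDr mulrDl aC ?bC.
- move=> a b /centrP aC /centrP bC; apply/centrP=> s sS.
  by rewrite -mulrA bC // !mulrA aC.
Qed.

(* With X a maximal abelian normal subgroup of A, the double centralizer of X
   is a field.  Either X is its own centralizer in A, and then A is too small
   to be transitive unless the field is as large as V, or a minimal normal
   subgroup Y / X of 'C_A(X) / X yields a class two group with too many fixed
   vectors. *)
Theorem solvable_transitive_cyclic A Z :
  (1 < #|{: V}|)%N -> solvable A -> transitive_act A -> Z <| A -> abelian Z ->
  exists e : {unit R}, [/\ A \subset 'N(<[e]>), Z \subset <[e]>, #[e]%g = #|{: V}|.-1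
    & forall v w : V, v != 0 -> w != 0 -> exists2 a, a \in <[e]>%g & v ** val a = w].
Proof.
move=> V1 solA trA nZA abZ.
pose gP (X : {group {unit R}}) := [&& X <| A, abelian X & Z \subset X].
have gZ : gP Z by apply/and3P.
have [X maxX' _] := maxgroup_exists gZ.
have [/and3P[nXA abX sZX] maxX] := maxgroupP maxX'.
have [sXA nXA'] := andP nXA.
pose S := [set val x | x in X]; pose Phi := centr (centr S).
have SC : {subset S <= centr S}.
  move=> _ /imsetP[x xX ->]; apply/centrP=> _ /imsetP[y yX ->].
  by rewrite -!unitM (centsP abX x xX y yX).
have SPhi : {subset S <= Phi}.
  by move=> s sS; apply/centrP=> r /centrP/(_ s sS).
have PhiC : {subset Phi <= centr S}.
  by move=> a /centrP aC; apply/centrP=> s /SC; exact: aC.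
have XP : {in X, forall x, val x \in Phi} by move=> x xX; apply: SPhi; exact: imset_f.
have [P0 P1 PD PM] : [/\ 0 \in Phi, 1 \in Phi, {in Phi &, forall a b, a + b \in Phi}
    & {in Phi &, forall a b, a * b \in Phi}] by exact: centr_subring.
have PC : {in Phi &, forall a b, a * b = b * a} by move=> a b /centrP aC /PhiC; exact: aC.
have nPhi a r : a \in A -> r \in Phi -> val (a^-1)%g * r * val a \in Phi.
  move=> aA /centrP rC; apply/centrP=> s /centrP sC.
  have h : val a * s * val (a^-1)%g \in centr S.
    apply/centrP=> _ /imsetP[x xX ->].
    have xaX : (x ^ a)%g \in X by rewrite memJ_norm // (subsetP nXA').
    have := sC (val (x ^ a)%g) (imset_f _ xaX).
    rewrite conjgE !unitM => /(congr1 (fun r => val a * r * val (a^-1)%g)).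
    by rewrite !mulrA unitK mul1r -!mulrA unitK mulr1 !mulrA.
  have := rC _ h => /(congr1 (fun r => val (a^-1)%g * r * val a)).
  by rewrite !mulrA unitVK mul1r -!mulrA unitVK mulr1 !mulrA.
have CXP : {in 'C(X), forall y, val y \in centr Phi}.
  move=> y /centP yC; apply/centrP=> a /centrP aC; rewrite aC //.
  by apply/centrP=> _ /imsetP[x xX ->]; rewrite -!unitM yC.
clearbody Phi.
have fPhi : subfield_set Phi by apply: (normalized_subring_field trA _ nPhi); split.
have Pu a : a \in Phi -> a != 0 -> a \is a GRing.unit.
  by move=> aP a0; apply: act_unit => v; apply: (fPhi.2 a v).
have [d [s [cV sV]]] := card_subfield_set_vec fPhi.
have q2 := card_subfield_set_gt1 fPhi.
have d0 : (0 < d)%N by case: d s cV {sV} => // s cV; rewrite cV expn0 in V1.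
have leX : (#|X| <= #|Phi|.-1)%N.
  rewrite (cardsD1 0 Phi) P0 -(card_imset _ val_inj).
  apply/subset_leq_card/subsetP=> _ /imsetP[x xX ->]; rewrite in_setD1 XP // andbT.
  by apply: contraTneq (valP x) => ->; rewrite unitr0.
have [eCX|neCX] := eqVneq 'C_A(X) X.
  (* Since [X] is cyclic and its own centralizer, the index of [X] in [A] is the number of
     conjugates of a generator. So [A] has order at most the square of that of [X], which is too
     small for transitivity unless [d = 1]. *)
  have /cyclicP[x Xx] := subfield_set_group_cyclic fPhi XP.
  have leA : (#|A| <= #|X| * #|X|)%N.
    have eX : #|A : X| = #|(x ^: A)%g| by rewrite -index_cent1 -cent_cycle -Xx eCX.
    rewrite -(Lagrange sXA) leq_mul2l eX subset_leq_card ?orbT //.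
    by rewrite (class_sub_norm _ nXA') Xx cycle_id.
  have geA : (#|{: V}|.-1 <= #|A|)%N.
    have /card_gt0P[v] : (0 < #|[set~ (0%R : V)]|)%N.
      by rewrite cardsC1; move: V1; case: #|_| => // [[]].
    rewrite !inE => v0; rewrite -(cardsC1 (0 : V)).
    apply: leq_trans (leq_imset_card (fun a : {unit R} => v ** val a) A).
    apply/subset_leq_card/subsetP=> w; rewrite !inE => w0.
    by have [a aA <-] := trA v w v0 w0; apply: imset_f.
  have d1 : d = 1%N.
    have := leq_trans geA (leq_trans leA (leq_mul leX leX)).
    case: d d0 cV {s sV} => // [[|d]] // _ ->.
    have : (#|Phi| ^ 2 <= #|Phi| ^ d.+2)%N by rewrite leq_exp2l.
    by rewrite expnS expn1 => /pred_sqr_lt; rewrite q2 ltnNge => /(_ isT)/negP.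
  have gE : group_set [set u : {unit R} | val u \in Phi].
    by apply/group_setP; split=> [|a b]; rewrite !inE // => aP bP; exact: (PM (val a) (val b) aP bP).
  have /cyclicP[e ee] : cyclic (Group gE).
    by apply: (subfield_set_group_cyclic fPhi) => u; rewrite inE.
  have inE' a : (a \in <[e]>%g) = (val a \in Phi) by rewrite -ee inE.
  have cE : #[e]%g = #|{: V}|.-1.
    rewrite orderE cV d1 expn1 (cardsD1 0 Phi) P0 /= -ee -(card_imset _ val_inj).
    apply: eq_card => r; rewrite in_setD1; apply/imsetP/andP=> [[u + ->]|[r0 rP]].
      rewrite inE => uP; split=> //.
      by apply: contraTneq (valP u) => ->; rewrite unitr0.
    by exists (FinRing.unit R (Pu r rP r0)); rewrite ?inE.
  exists e; split=> //.
  - apply/subsetP=> a aA; rewrite inE; apply/subsetP=> _ /imsetP[u uE ->].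
    by rewrite inE' conjgE !unitM mulrA; apply: nPhi; rewrite // -inE'.
  - by apply/subsetP=> z zZ; rewrite inE' XP // (subsetP sZX).
  move=> v w v0 w0.
  pose f (a : {unit R}) := v ** val a.
  have f_inj : {in <[e]>%g &, injective f}.
    move=> a b aE bE e1; apply/val_inj/eqP; rewrite -[X in _ == X]oppR -addr_eq0.
    apply: contraNT v0 => ab0; apply/eqP; apply: (fPhi.2 (val a + val b)) => //.
      by rewrite PD -?inE'.
    by rewrite actDr -/(f a) -/(f b) e1 addVV.
  have sub : f @: <[e]>%g \subset [set~ 0].
    by apply/subsetP=> _ /imsetP[a _ ->]; rewrite !inE act_eq0.
  have /eqP imE : f @: <[e]>%g == [set~ 0].
    by rewrite eqEcard sub (card_in_imset f_inj) -orderE cE cardsC1 /=.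
  have : w \in f @: <[e]>%g by rewrite imE !inE.
  by case/imsetP=> a aE ->; exists a.
have sXC : X \subset 'C_A(X) by rewrite subsetI sXA.
have nCA : 'C_A(X) <| A.
  by rewrite /normal subsetIl normsI ?normG ?norms_cent.
have nXC : X <| 'C_A(X) by apply: normalS sXC (subsetIl _ _) nXA.
exfalso.
have CX1 : ('C_A(X) / X)%g != 1%g.
  apply: contra neCX => /eqP e; rewrite eqEsubset sXC andbT.
  by rewrite -quotient_sub1 ?e ?normal_norm.
have [M minM sMC] := minnormal_exists CX1 (quotient_norms X (normal_norm nCA)).
have solM : solvable ('C_A(X) / X)%g.
  by apply: quotient_sol; apply: solvableS (subsetIl _ _) solA.
have [nMA M1 abM] := minnormal_solvable minM sMC solM.
have nMA' : M <| (A / X)%g.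
  by rewrite /normal nMA andbT (subset_trans sMC) // quotientS // subsetIl.
have [Y defM sXY nYA] := inv_quotientN nXA nMA'.
have [sYA nYA'] := andP nYA.
have nXY : X <| Y by apply: normalS sXY sYA nXA.
have sYC : Y \subset 'C_A(X).
  by rewrite -(quotientSGK (normal_norm nXY) sXC) -defM.
have YC : {in Y, forall y, val y \in centr Phi}.
  by move=> y /(subsetP sYC)/setIP[_]; exact: CXP.
have YX : {in Y &, forall y u, [~ y, u]%g \in X}.
  move=> y u yY uY; have /centsP abYX : abelian (Y / X)%g.
    by rewrite -defM; have [p _ abp] := is_abelemP abM; exact: abelem_abelian abp.
  have nX z : z \in Y -> z \in 'N(X) by apply: subsetP; exact: normal_norm.
  rewrite coset_idr ?groupR ?nX // morphR ?nX //; apply/eqP/commgP/abYX;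
    by rewrite mem_quotient.
have ZX : 'Z(Y) \subset X.
  (* The center is abelian, contains [X], and is characteristic in [Y], hence normal in [A]; so
     maximality of [X] applies. *)
  suff -> : 'Z(Y) = X by [].
  apply: (maxX ('Z(Y))%G).
    rewrite /gP center_abelian (char_normal_trans (center_char _) nYA) /=.
    by rewrite (subset_trans sZX) // subsetI sXY centsC (subset_trans sYC) ?subsetIr.
  by rewrite subsetI sXY centsC (subset_trans sYC) ?subsetIr.
have nabY : ~~ abelian Y.
  apply: contra M1 => abY; rewrite defM; apply/eqP/trivgP.
  by rewrite quotient_sub1 ?normal_norm // (subset_trans _ ZX) // subsetI subxx.
have half v w : v != 0 -> w != 0 ->
    #|[set y in Y | v ** val y == v]| = #|[set y in Y | w ** val y == w]|.
  move=> v0 w0; have [a aA <-] := trA v w v0 w0.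
  rewrite -(card_imset _ (conjg_inj a)); apply: eq_card => y.
  have nYa : a \in 'N(Y) by exact: subsetP aA.
  apply/imsetP/idP=> [[u + ->]|].
    rewrite !inE memJ_norm // => /andP[-> /eqP uv].
    by rewrite conjgE !unitM !actM actK uv eqxx.
  rewrite inE => /andP[yY /eqP yv]; exists (y ^ a^-1)%g; last by rewrite conjgKV.
  rewrite inE memJ_norm ?groupV // yY conjgE !unitM invgK !actM yv.
  by rewrite actK eqxx.
have [c c3 cle] := card_classTwo_count fPhi XP sXY YC YX ZX nabY half.
have leYX := card_quotient_le fPhi XP sXY YC YX ZX cV sV.
(* A field of characteristic 2 has no scalar of order 2, and [X] contains nontrivial commutators.
   This puts the order of [Phi] at 4 or more, as [fixed_space_count_absurd] requires. *)
have X3 : (3 <= #|X|)%N.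
  have X1 : X != 1%g :> {set _}.
    apply: contra nabY => /eqP X1; apply/centsP=> y yY u uY.
    by apply/commgP; rewrite -in_set1 -[[set _]]X1 YX.
  rewrite ltn_neqAle cardG_gt1 X1 andbT; apply/negP=> /eqP X2.
  case/negP: X1; rewrite -subG1; apply/subsetP=> z zX; rewrite inE.
  have z2 : (z ^+ 2)%g = 1%g by rewrite X2 expg_cardG.
  apply/eqP/unit_eq1; have [//|e] := eqVneq (val z + 1) 0.
  have zP : val z + 1 \in Phi by rewrite PD ?XP.
  by apply: (mulrI (Pu _ zP e)); rewrite unit_sqr // mulr0.
apply: (@fixed_space_count_absurd #|Phi| d c) => //.
- by rewrite -(ltn_predK q2) ltnS; apply: leq_trans leX.
- by rewrite -cV.
rewrite -cV; apply: leq_trans cle _; rewrite leq_mul2r; apply/orP; right.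
rewrite -(Lagrange sXY) -{2}[#|X|]muln1 -mulnBr; apply: leq_mul; last exact: leq_sub2r.
by rewrite subn1.
Qed.

End SolvableTransitive.

(** * Additive maps in characteristic 2 *)

Section CharTwoField.

Variables (K : finFieldType) (N : nat).
Hypotheses (N0 : (0 < N)%N) (hK : #|K| = (2 ^ N)%N).
Implicit Types (h : K -> K) (x y z : K).

Lemma pchar2K : 2%N \in [pchar K].
Proof. by apply: (@card_finPcharP _ _ N). Qed.

Lemma addrr2 x : x + x = 0.
Proof. exact: addrr_pchar2 pchar2K x. Qed.

Lemma oppr2 x : - x = x.
Proof. exact: oppr_pchar2 pchar2K x. Qed.

Lemma addr2_eq0 x y : (x + y == 0) = (x == y).
Proof. by rewrite addr_eq0 oppr2. Qed.

Lemma pow2D k : {morph (fun x : K => x ^+ (2 ^ k)%N) : x y / x + y}.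
Proof.
move=> x y; apply: exprDn_pchar; rewrite pnatX; apply/orP; left.
by rewrite (eq_pnat _ (pcharf_eq pchar2K)) pnat_id.
Qed.

Lemma pow2_sum k I (r : seq I) (P : pred I) (F : I -> K) :
  (\sum_(i <- r | P i) F i) ^+ (2 ^ k)%N = \sum_(i <- r | P i) F i ^+ (2 ^ k)%N.
Proof.
apply: (big_morph (fun x : K => x ^+ (2 ^ k)%N) (pow2D k)).
by rewrite expr0n expn_eq0.
Qed.

Lemma pow2_pow2 k l x : (x ^+ (2 ^ k)%N) ^+ (2 ^ l)%N = x ^+ (2 ^ (k + l))%N.
Proof. by rewrite -exprM -expnD. Qed.

Lemma pow2_card x : x ^+ (2 ^ N)%N = x.
Proof. by rewrite -hK expf_card. Qed.

Lemma pow2_modn k x : x ^+ (2 ^ (k %% N))%N = x ^+ (2 ^ k)%N.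
Proof.
rewrite [in RHS](divn_eq k N) addnC -pow2_pow2; elim: (k %/ N)%N => [|l IH].
  by rewrite mul0n expr1.
by rewrite mulSn -pow2_pow2 pow2_card.
Qed.

Lemma pow2_inj k : injective (fun x : K => x ^+ (2 ^ k)%N).
Proof.
move=> x y /eqP; rewrite -addr2_eq0 -pow2D expf_eq0 addr2_eq0.
by case/andP=> _ /eqP.
Qed.

Definition linpoly (a : 'I_N -> K) (y : K) : K := \sum_(j < N) a j * y ^+ (2 ^ j)%N.

Lemma linpolyD a : {morph linpoly a : x y / x + y}.
Proof.
by move=> x y; rewrite -big_split; apply: eq_bigr=> j _; rewrite pow2D mulrDr.
Qed.

(** As a polynomial in y this has degree below the order of K, hence too few roots. *)
Lemma linpoly_eq0 a : linpoly a =1 (fun=> 0) -> forall j, a j = 0.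
Proof.
move=> a0; pose p : {poly K} := \sum_(j < N) a j *: 'X^(2 ^ j)%N.
have szp : (size p <= 2 ^ N)%N.
  apply: leq_trans (size_sum _ _ _) _; apply/bigmax_leqP=> j _.
  apply: leq_trans (size_scale_leq _ _) _; rewrite size_polyXn.
  by rewrite ltn_exp2l.
have p0 : p = 0.
  apply/eqP; apply: contraLR szp => p0; rewrite -ltnNge -hK cardE.
  apply: max_poly_roots p0 _ (enum_uniq _); apply/allP=> y _.
  rewrite /root /p horner_sum -[X in _ == X](a0 y); apply/eqP/eq_bigr=> j _.
  by rewrite hornerZ hornerXn.
move=> j; have := congr1 (fun p : {poly K} => p`_(2 ^ j)) p0.
rewrite coef0 coef_sum (bigD1 j) //= coefZ coefXn eqxx mulr1 big1 ?addr0 // => i ij.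
rewrite coefZ coefXn eqn_exp2l // [_ == _ :> nat](_ : _ = (j == i)) //.
by rewrite eq_sym (negPf ij) mulr0.
Qed.

Lemma linpoly_inj a b : linpoly a =1 linpoly b -> a =1 b.
Proof.
move=> ab j; apply/eqP; rewrite -addr2_eq0; apply/eqP.
apply: (@linpoly_eq0 (fun j => a j + b j)) => y; rewrite /linpoly.
under eq_bigr do rewrite mulrDl.
by rewrite big_split /= -!/(linpoly _ _) ab addrr2.
Qed.

Lemma additive0 h : {morph h : x y / x + y} -> h 0 = 0.
Proof. by move=> hD; apply: (addrI (h 0)); rewrite -hD !addr0. Qed.

Lemma additive_sum h I (r : seq I) (P : pred I) (F : I -> K) :
  {morph h : x y / x + y} -> h (\sum_(i <- r | P i) F i) = \sum_(i <- r | P i) h (F i).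
Proof. by move=> hD; apply: (big_morph h hD (additive0 hD)). Qed.

(** The basis comes from [card_subfield_set_vec], for K acting on itself and its prime field. *)
Lemma prime_basis : exists s : 'I_N -> K, forall x, exists f : 'I_N -> bool,
  x = \sum_i s i * (f i)%:R.
Proof.
have fP : subfield_set (fun x y : K => x * y) [set 0; 1].
  split; last by move=> a v _ a0 /eqP; rewrite mulf_eq0 (negPf a0) orbF => /eqP.
  split; rewrite ?inE ?eqxx ?orbT //.
  - by move=> a b; rewrite !inE => /orP[]/eqP-> /orP[]/eqP->;
      rewrite ?addr0 ?add0r ?addrr2 eqxx ?orbT.
  - by move=> a b; rewrite !inE => /orP[]/eqP-> /orP[]/eqP->;
      rewrite ?mulr0 ?mul0r ?mulr1 eqxx ?orbT.
  by move=> a b _ _; rewrite mulrC.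
have [] := card_subfield_set_vec _ _ _ _ _ _ _ fP.
- by move=> v w a; rewrite mulrDl.
- by move=> v a b; rewrite mulrDr.
- by move=> v a b; rewrite mulrA.
- by move=> v; rewrite mulr1.
- by move=> a; rewrite unitfE => h; apply/eqP=> a0; have := h 1; rewrite a0 mulr0 => /(_ erefl)/eqP; rewrite oner_eq0.
- exact: addrr2.
- exact: addrr2.
move=> d [s [cK sK]]; move: cK; rewrite cards2 eq_sym oner_eq0 hK => /eqP.
rewrite eqn_exp2l // => /eqP dN; move: s sK; rewrite -{}dN => s sK.
exists s => x; have : x \in [set: K] by [].
rewrite -sK => /vspanP[g gP ->]; exists (fun i => g i == 1); apply: eq_bigr=> i _.
by have := gP i; rewrite !inE => /orP[]/eqP->; rewrite ?eqxx // eq_sym oner_eq0.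
Qed.

(** Distinct coefficient vectors give distinct additive maps, and an additive map is determined by
    its values on a basis of N elements; so there are no other additive maps. *)
Theorem additive_linpoly h : {morph h : x y / x + y} -> exists a, h =1 linpoly a.
Proof.
move=> hD; have [s sP] := prime_basis.
pose A := [set g : {ffun K -> K} | [forall x, forall y, g (x + y) == g x + g y]].
have AP (g : {ffun K -> K}) : reflect {morph g : x y / x + y} (g \in A).
  rewrite inE; apply: (iffP forallP) => [gD x y|gD x]; first by apply/eqP/(forallP (gD x)).
  by apply/forallP=> y; rewrite gD.
pose lin (a : {ffun 'I_N -> K}) := [ffun y => linpoly a y].
have leA : (#|A| <= #|{ffun 'I_N -> K}|)%N.
  rewrite -(card_in_imset (f := fun g : {ffun K -> K} => [ffun i => g (s i)])) ?max_card //.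
  move=> g g' /AP gD /AP g'D /ffunP e; apply/ffunP=> x; have [c ->] := sP x.
  rewrite !additive_sum //; apply: eq_bigr=> i _; have := e i; rewrite !ffunE.
  by case: (c i); rewrite ?mulr1 // !mulr0 !additive0.
have /eqP eA : lin @: predT == A.
  rewrite eqEcard; apply/andP; split.
    by apply/subsetP=> _ /imsetP[a _ ->]; apply/AP=> x y; rewrite !ffunE linpolyD.
  rewrite card_imset // => a b /ffunP e; apply/ffunP; apply: linpoly_inj => y.
  by have := e y; rewrite !ffunE.
have : finfun h \in A by apply/AP=> x y; rewrite !ffunE.
by rewrite -eA => /imsetP[a _ /ffunP e]; exists a => y; have := e y; rewrite !ffunE.
Qed.

(* Comparing coefficients, only one power of y can occur in h. *)
Lemma additive_semilinear_monomial h (b c : K) :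
  {morph h : x y / x + y} -> (exists y, h y != 0) ->
  {in [pred j | (j < N)%N] &, injective (fun j => b ^+ (2 ^ j)%N)} ->
  (forall y, h (b * y) = c * h y) ->
  exists a j, [/\ a != 0, (j < N)%N & forall y, h y = a * y ^+ (2 ^ j)%N].
Proof.
move=> hD [y0 hy0] binj hb; have [a ha] := additive_linpoly hD.
have e j : a j * b ^+ (2 ^ j)%N = c * a j.
  apply: (@linpoly_inj (fun j => a j * b ^+ (2 ^ j)%N) (fun j => c * a j)) => y.
  transitivity (linpoly a (b * y)).
    by apply: eq_bigr=> i _; rewrite exprMn mulrA.
  by rewrite -ha hb ha /linpoly mulr_sumr; apply: eq_bigr=> i _; rewrite mulrA.
have [j aj0] : exists j, a j != 0.
  apply/existsP; apply: contraNT hy0 => /existsPn a0; rewrite ha /linpoly big1 // => j _.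
  by have := a0 j; rewrite negbK => /eqP ->; rewrite mul0r.
exists (a j), j; split=> // y; rewrite ha /linpoly (bigD1 j) //= big1 ?addr0 // => i ij.
suff -> : a i = 0 by rewrite mul0r.
apply: contraNeq ij => ai0; apply/eqP/val_inj/binj; rewrite ?inE; try exact: ltn_ord.
have ec k : a k != 0 -> b ^+ (2 ^ k)%N = c.
  by move=> ak0; apply: (mulfI ak0); rewrite e mulrC.
by rewrite /= !ec.
Qed.

(* The trace to the subfield of order 2^k, for k dividing N. *)
Definition trk (k : nat) (x : K) : K := \sum_(i < N %/ k) x ^+ (2 ^ (k * i))%N.

Lemma trkD k : {morph trk k : x y / x + y}.
Proof. by move=> x y; rewrite -big_split; apply: eq_bigr=> i _; rewrite pow2D. Qed.

Lemma trk_pow2 k l x : trk k (x ^+ (2 ^ l)%N) = trk k x ^+ (2 ^ l)%N.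
Proof. by rewrite pow2_sum; apply: eq_bigr=> i _; rewrite !pow2_pow2 addnC. Qed.

Lemma trk_fixed k x : (0 < k)%N -> (k %| N)%N -> trk k x ^+ (2 ^ k)%N = trk k x.
Proof.
move=> k0 kN; rewrite pow2_sum /trk.
have : (0 < N %/ k)%N by rewrite divn_gt0 // dvdn_leq.
move e : (N %/ k)%N => l; case: l e => // l e _; rewrite big_ord_recr big_ord_recl /= addrC.
congr (_ + _); last first.
  by apply: eq_bigr=> i _; rewrite pow2_pow2 /bump /= add1n mulnS addnC.
rewrite pow2_pow2 -mulnSr -e mulnC divnK // pow2_card.
by rewrite muln0 expr1.
Qed.

Lemma trk_fixed_mul k l x : (0 < k)%N -> (k %| N)%N -> trk k x ^+ (2 ^ (k * l))%N = trk k x.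
Proof.
move=> k0 kN; elim: l => [|l IH]; first by rewrite muln0 expr1.
by rewrite mulnS -pow2_pow2 trk_fixed.
Qed.

Lemma card_trk_ker k : (0 < k)%N -> (k %| N)%N -> (#|[set x | trk k x == 0%R]| <= 2 ^ (N - k))%N.
Proof.
move=> k0 kN; have := dvdn_leq N0 kN => kN'.
pose p : {poly K} := \sum_(i < N %/ k) 'X^(2 ^ (k * i))%N.
have Nk : (0 < N %/ k)%N by rewrite divn_gt0.
have szp : size p = (2 ^ (N - k)).+1.
  have eN : (N - k = k * (N %/ k).-1)%N.
    by rewrite -subn1 mulnBr muln1 mulnC divnK.
  rewrite /p eN; case: (N %/ k)%N Nk => // l _ /=; rewrite big_ord_recr /=.
  rewrite addrC size_polyDl size_polyXn //; apply: leq_ltn_trans (size_sum _ _ _) _.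
  rewrite ltnS; apply/bigmax_leqP=> i _; rewrite size_polyXn.
  by rewrite ltn_exp2l // ltn_pmul2l.
have p0 : p != 0 by rewrite -size_poly_gt0 szp.
rewrite cardE -ltnS -szp; apply: max_poly_roots p0 _ (enum_uniq _).
apply/allP=> x; rewrite mem_enum inE => /eqP tx; rewrite /root /p horner_sum -[X in _ == X]tx.
by apply/eqP/eq_bigr=> i _; rewrite hornerXn.
Qed.

Lemma trk_AS k l x : (0 < k)%N -> (k %| N)%N -> trk k (x + x ^+ (2 ^ (k * l))%N) = 0.
Proof. by move=> k0 kN; rewrite trkD trk_pow2 trk_fixed_mul ?addrr2. Qed.

Lemma card_additive_fibers h : {morph h : x y / x + y} ->
  (#|K| <= #|h @: setT| * #|[set y | h y == 0%R]|)%N.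
Proof.
move=> hD; rewrite -cardsT -sum1_card (partition_big_imset h) -sum_nat_const /=.
apply: leq_sum => _ /imsetP[y0 _ ->]; rewrite sum1dep_card.
rewrite -(card_imset [set y | h y == 0%R] (addrI y0)); apply/subset_leq_card/subsetP=> y.
rewrite inE => /andP[_ /eqP hy]; apply/imsetP; exists (y0 + y); last first.
  by rewrite addrA addrr2 add0r.
by rewrite inE hD hy addrr2.
Qed.

(** Additive Hilbert 90 by counting: the map y + y^(2^k) has at most 2^k zeros, so its image has at
    least 2^(N - k) elements, the most that the kernel of the trace can have. *)
Lemma trk_ker k : (0 < k)%N -> (k %| N)%N ->
  forall x, trk k x = 0 -> exists y, x = y + y ^+ (2 ^ k)%N.
Proof.
move=> k0 kN; have kN' := dvdn_leq N0 kN.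
pose g y : K := y + y ^+ (2 ^ k)%N.
have gD : {morph g : x y / x + y} by move=> x y; rewrite /g pow2D addrACA.
pose F := [set y : K | g y == 0].
have cF : (#|F| <= 2 ^ k)%N.
  pose p : {poly K} := 'X^(2 ^ k)%N + 'X.
  have szp : size p = (2 ^ k).+1.
    rewrite size_polyDl size_polyXn // size_polyX ltnS.
    by have := k0; rewrite -(@ltn_exp2l 2 0 k) // expn0.
  have p0 : p != 0 by rewrite -size_poly_gt0 szp.
  rewrite cardE -ltnS -szp; apply: max_poly_roots p0 _ (enum_uniq _).
  apply/allP=> x; rewrite mem_enum inE /g => /eqP gx.
  by rewrite /root hornerD hornerXn hornerX addrC gx.
have cK : (#|K| <= #|g @: setT| * #|F|)%N by exact: card_additive_fibers.
have /eqP e : g @: setT == [set x | trk k x == 0].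
  rewrite eqEcard; apply/andP; split.
    apply/subsetP=> _ /imsetP[y _ ->]; rewrite inE /g -[k in (2 ^ k)%N]muln1.
    by rewrite trk_AS.
  apply: leq_trans (card_trk_ker k0 kN) _.
  rewrite -(leq_pmul2r (expn_gt0 2 k)) -expnD subnK // -hK.
  by apply: leq_trans cK _; rewrite leq_mul2l cF orbT.
move=> x /eqP tx; have : x \in [set x | trk k x == 0] by rewrite inE.
by rewrite -e => /imsetP[y _ ->]; exists y.
Qed.

End CharTwoField.

(** * Huppert's theorem for groups of additive permutations of K *)

Section AdditivePermutations.

Variable K : finFieldType.
Implicit Types (g : {perm K}) (x y : K).

Definition additive_perms : {set {perm K}} :=
  [set g : {perm K} | [forall x, forall y, g (x + y) == g x + g y]].

Lemma additive_permsP g : reflect {morph g : x y / x + y} (g \in additive_perms).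
Proof.
rewrite inE; apply: (iffP forallP) => [gD x y|gD x]; first by apply/eqP/(forallP (gD x)).
by apply/forallP=> y; rewrite gD.
Qed.

Lemma additive_perms_group_set : group_set additive_perms.
Proof.
apply/group_setP; split=> [|g h /additive_permsP gD /additive_permsP hD].
  by apply/additive_permsP=> x y; rewrite !perm1.
by apply/additive_permsP=> x y; rewrite !permM gD hD.
Qed.

Canonical additive_perms_group := Group additive_perms_group_set.

(** The dimension is a successor for the square matrices to form a ring. *)
Variable n : nat.
Local Notation N := n.+1.
Hypothesis hK : #|K| = (2 ^ N)%N.
Local Notation R := 'M['F_2]_N.
Local Notation V := 'rV['F_2]_N.
Local Notation mulV := (fun (v : V) (a : R) => v *m a).


Let F2P (c : 'F_2) : c = 0 \/ c = 1.
Proof. by case: c => [[|[|c]] i]; [left | right | ]; try exact: val_inj. Qed.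

Let mx_unit (a : R) : (forall v : V, v *m a = 0 -> v = 0) -> a \is a GRing.unit.
Proof.
move=> inj; rewrite -[_ \is a _]/(a \in unitmx) -row_free_unit -kermx_eq0.
apply/eqP/row_matrixP=> i; rewrite row0; apply: inj.
by rewrite -row_mul mulmx_ker row0.
Qed.

Let mx_faithful (a : R) : (forall v : V, v *m a = 0) -> a = 0.
Proof. by move=> h; apply/row_matrixP=> i; rewrite rowE h row0. Qed.

Let coordinates : exists (phi : V -> K) (gam : K -> V),
  [/\ {morph phi : u v / u + v}, {morph gam : x y / x + y}, cancel phi gam & cancel gam phi].
Proof.
have [s sP] := prime_basis hK.
pose phi (v : V) := \sum_i s i * (v 0 i != 0)%:R.
have phiD : {morph phi : u v / u + v}.
  move=> u v; rewrite -big_split; apply: eq_bigr=> i _ /=; rewrite -mulrDr mxE.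
  congr (_ * _); case: (F2P (u 0 i)) => ->; case: (F2P (v 0 i)) => ->;
    by rewrite ?add0r ?addr0 ?eqxx ?oner_eq0 //= (addrr2 hK).
have ex x : exists v, phi v == x.
  have [f ->] := sP x; exists (\row_i (f i)%:R); apply/eqP/eq_bigr=> i _.
  by rewrite mxE; case: (f i); rewrite ?eqxx ?oner_eq0.
pose gam x : V := odflt 0 [pick v | phi v == x].
have gamK : cancel gam phi.
  move=> x; rewrite /gam; case: pickP => [v /eqP //|none].
  by have [v] := ex x; rewrite none.
have bij : bijective gam.
  by apply: inj_card_bij (can_inj gamK) _; rewrite card_mx card_ord mul1n hK.
have phiK : cancel phi gam by apply/(bij_can_sym bij).
exists phi, gam; split=> // x y.
by apply: (can_inj phiK); rewrite phiD !gamK.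
Qed.

(** The abelian normal subgroup [Z] is carried along for the application to the scalars of F_q:
    lying in the cyclic group generated by [e], they commute with [e]. *)
Theorem solvable_transitive_perm (A Z : {group {perm K}}) :
  A \subset additive_perms -> solvable A ->
  (forall x y, x != 0 -> y != 0 -> exists2 g, g \in A & g x = y) ->
  Z <| A -> abelian Z ->
  exists e : {perm K}, [/\ e \in additive_perms, A \subset 'N(<[e]>),
    Z \subset <[e]>, #[e]%g = (2 ^ N).-1
    & forall x y, x != 0 -> y != 0 -> exists2 g, g \in <[e]>%g & g x = y].
Proof.
move=> sA solA trA nZA abZ; have [phi [gam [phiD gamD phiK gamK]]] := coordinates.
have gam0 : gam 0 = 0 by apply: (addrI (gam 0)); rewrite -gamD !addr0.
have phi0 : phi 0 = 0 by rewrite -gam0 gamK.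
pose mx g : R := \matrix_i gam (g (phi (delta_mx 0 i))).
have mxE' g v : g \in additive_perms -> v *m mx g = gam (g (phi v)).
  move/additive_permsP=> gD; pose G v := gam (g (phi v)).
  have GD : {morph G : u v / u + v} by move=> u w; rewrite /G phiD gD gamD.
  have G0 : G 0 = 0 by apply: (addrI (G 0)); rewrite -GD !addr0.
  rewrite mulmx_sum_row -/(G v) [in RHS](row_sum_delta v) (big_morph G GD G0).
  apply: eq_bigr=> i _; rewrite rowK -/(G _).
  by case: (F2P (v 0 i)) => ->; rewrite ?scale0r ?scale1r ?G0.
have mxM : {in additive_perms &, {morph mx : g h / (g * h)%g >-> g * h}}.
  move=> g h gA hA; apply/row_matrixP=> i; rewrite !rowE -mulmxE mulmxA !mxE' ?groupM //.
  by rewrite gamK permM.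
have mx1 : mx 1%g = 1 by apply/row_matrixP=> i; rewrite !rowE mxE' ?group1 // perm1 phiK mulmx1.
have mxU g : g \in additive_perms -> mx g \is a GRing.unit.
  move=> gA; apply: mx_unit => v; rewrite mxE' // => /(congr1 phi); rewrite gamK phi0.
  move/additive_permsP: gA => gD.
  have g0 : g 0 = 0 by apply: (addrI (g 0)); rewrite -gD !addr0.
  by rewrite -{1}g0 => /perm_inj e; rewrite -[v]phiK e gam0.
pose mu g : {unit R} := insubd (1%g : {unit R}) (mx g).
have muE g : g \in additive_perms -> val (mu g) = mx g.
  by move=> gA; rewrite val_insubd mxU.
have muM : {in additive_perms &, {morph mu : g h / (g * h)%g}}.
  move=> g h gA hA; apply: val_inj; rewrite muE ?groupM // mxM //.
  by rewrite -(muE g) // -(muE h).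
pose mum := Morphism muM.
have inj : 'injm mum.
  apply/injmP=> g h gA hA e; apply/permP=> x.
  have {}e : mx g = mx h.
    exact: etrans (esym (muE g gA)) (etrans (congr1 val (e : mu g = mu h)) (muE h hA)).
  have := congr1 (fun a => gam x *m a) e; rewrite !mxE' // gamK.
  exact: (can_inj gamK).
have surj (u : {unit R}) : u \in mum @* additive_perms.
  pose f x := phi (gam x *m val u).
  have f_inj : injective f.
    apply: (can_inj (g := fun x => phi (gam x *m val (u^-1)%g))) => x.
    rewrite /f phiK -mulmxA (_ : val u *m _ = 1%:M) ?mulmx1 ?gamK //.
    by rewrite -[LHS]/(val (u * u^-1)%g) mulgV.
  have fA : perm f_inj \in additive_perms.
    by apply/additive_permsP=> x y; rewrite !permE /f gamD mulmxDl phiD.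
  apply/morphimP; exists (perm f_inj) => //; apply: val_inj; rewrite [RHS]muE //.
  by apply/row_matrixP=> i; rewrite !rowE mxE' // permE /f !phiK.
have sZA := subset_trans (normal_sub nZA) sA.
have [e' [nA sZ oe tr]] : exists e : {unit R},
    [/\ mum @* A \subset 'N(<[e]>), mum @* Z \subset <[e]>, #[e]%g = #|{: V}|.-1
     & forall v w : V, v != 0 -> w != 0 -> exists2 a, a \in <[e]>%g & mulV v (val a) = w].
  apply: (@solvable_transitive_cyclic R V mulV).
  - by move=> v w a; rewrite mulmxDl.
  - by move=> v a b; rewrite mulmxDr.
  - by move=> v a b; exact: mulmxA.
  - by move=> v; rewrite mulmx1.
  - exact: mx_faithful.
  - exact: mx_unit.
  - by move=> a; rewrite -mulr2n -scaler_nat (_ : 2%:R = 0) ?scale0r //; exact: val_inj.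
  - by move=> v; rewrite -mulr2n -scaler_nat (_ : 2%:R = 0) ?scale0r //; exact: val_inj.
  - by rewrite card_mx card_ord mul1n -(expn0 2) ltn_exp2l.
  - exact: morphim_sol.
  - move=> v w v0 w0.
    have phi_neq0 u : u != 0 -> phi u != 0.
      by apply: contraNneq => /(congr1 gam); rewrite phiK gam0 => ->.
    have [g gA e] := trA _ _ (phi_neq0 _ v0) (phi_neq0 _ w0).
    have gAdd := subsetP sA _ gA.
    by exists (mu g); [exact: mem_morphim | rewrite muE // mxE' // e phiK].
  - exact: morphim_normal.
  - exact: morphim_abelian.
have /morphimP[e eA _ ee] := surj e'.
have imE : <[e']> = mum @* <[e]> by rewrite morphim_cycle // -ee.
have sE : <[e]> \subset additive_perms by rewrite cycle_subG.
exists e; split=> //.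
- by rewrite -(injm_norms inj sA sE) -imE.
- by rewrite -(injmSK inj) // -imE.
- by rewrite -(order_injm inj eA) -ee oe card_mx card_ord mul1n.
move=> x y x0 y0.
have gam_neq0 u : u != 0 -> gam u != 0.
  by apply: contraNneq => /(congr1 phi); rewrite gamK phi0 => ->.
have [u + ue] := tr _ _ (gam_neq0 _ x0) (gam_neq0 _ y0).
rewrite imE => /morphimP[g gAdd gE eu]; exists g => //.
by move: ue; rewrite eu muE // mxE' // gamK => /(can_inj gamK).
Qed.

(* lambda is a Lagrange resolvent of e, nonzero by Dedekind. *)
Lemma regular_diagonalizable (e : {perm K}) (C : {set K}) :
  e \in additive_perms -> #[e]%g = (2 ^ N).-1 ->
  (forall x y, x != 0 -> y != 0 -> exists2 g, g \in <[e]>%g & g x = y) ->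
  (forall c x, c \in C -> e (c * x) = c * e x) ->
  exists lam : {perm K}, [/\ lam \in additive_perms,
    forall c x, c \in C -> lam (c * x) = c * lam x
    & exists2 a, {in [pred j | (j < N)%N] &, injective (fun j => a ^+ (2 ^ j)%N)} &
      forall x, lam (e x) = a * lam x].
Proof.
move=> eA oe tr eC; set k := (2 ^ N).-1 in oe.
have [k' ek] : exists k', k = k'.+1.
  exists k.-1; rewrite prednK // /k -subn1 subn_gt0 -(expn0 2) ltn_exp2l //.
have XA i : {morph (e ^+ i)%g : x y / x + y}.
  by apply/additive_permsP; rewrite groupX.
have XC i c x : c \in C -> (e ^+ i)%g (c * x) = c * (e ^+ i)%g x.
  by move=> cC; elim: i x => [|i IH] x; rewrite ?expg0 ?perm1 // !expgS !permM eC // IH.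
(* By construction [a * lam a (e x) = lam a x], so [lam] turns [e] into multiplication by the
   inverse of [a]. *)
pose lam a x := \sum_(i < k) a ^+ i * (e ^+ i)%g x.
have lamD a : {morph lam a : x y / x + y}.
  by move=> x y; rewrite -big_split; apply: eq_bigr=> i _ /=; rewrite XA mulrDr.
have lamC a c x : c \in C -> lam a (c * x) = c * lam a x.
  by move=> cC; rewrite mulr_sumr; apply: eq_bigr=> i _; rewrite XC // mulrCA.
have lame a x : a != 0 -> a * lam a (e x) = lam a x.
  move=> a0; have ak : a ^+ k = 1.
    by apply: (mulfI a0); rewrite mulr1 -exprS prednK ?expn_gt0 // (pow2_card hK).
  rewrite /lam mulr_sumr; under eq_bigr do rewrite mulrA -exprS -permM -expgS.
  have ek1 : (e ^+ k)%g = 1%g by rewrite -oe expg_order.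
  move: ak ek1; rewrite ek => ak ek1.
  rewrite big_ord_recr [in RHS]big_ord_recl /= addrC ak ek1 expg0 expr0.
  by congr (_ + _); apply: eq_bigr=> i _; rewrite -permM -expgS.
have [a a0 [x0 lam0]] : exists2 a, a != 0 & exists x, lam a x != 0.
  have [|none] := boolP [exists a, (a != 0) && (lam a 1 != 0)].
    by case/existsP=> a /andP[a0 l0]; exists a => //; exists 1.
  (* As a polynomial in [a], the value [lam a 1] has size at most [k] and constant coefficient 1, so
     it cannot vanish at all [k] nonzero elements of K. *)
  pose p : {poly K} := \poly_(i < k) (e ^+ i)%g 1.
  have pE a : p.[a] = lam a 1 by rewrite horner_poly; apply: eq_bigr=> i _; rewrite mulrC.
  have p0 : p = 0.
    apply/eqP; apply/negPn/negP=> p0.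
    have szp : (size p <= k)%N by apply: size_poly.
    have /= := @max_poly_roots _ p (rem 0 (enum K)) p0 _ (rem_uniq _ (enum_uniq _)).
    rewrite size_rem ?mem_enum // -cardE hK -/k ltnNge szp => h; have/h // : all (root p) (rem 0 (enum K)).
    apply/allP=> a; rewrite mem_rem_uniq ?enum_uniq // inE => /andP[a0 _].
    by move/existsPn: none => /(_ a); rewrite a0 /= negbK /root pE.
  have := congr1 (fun p : {poly K} => p`_0) p0; rewrite coef0 coef_poly ek /= expg0 perm1.
  by move/eqP; rewrite oner_eq0.
have lame' x : lam a (e x) = a^-1 * lam a x by rewrite -(lame a x a0) mulKf.
have lamX i x : lam a ((e ^+ i)%g x) = a^-1 ^+ i * lam a x.
  by elim: i x => [|i IH] x; rewrite ?expg0 ?perm1 ?mul1r // expgS permM IH lame' mulrA -exprSr.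
have lam00 : lam a 0 = 0 by apply: (addrI (lam a 0)); rewrite -lamD !addr0.
have lam_neq0 x : x != 0 -> lam a x != 0.
  move=> x_neq0; have x00 : x0 != 0 by apply: contraNneq lam0 => ->; rewrite lam00.
  have [g /cycleP[i ->] e0] := tr _ _ x_neq0 x00.
  by apply: contraNneq lam0 => lx; rewrite -e0 lamX lx mulr0.
have lam_inj : injective (lam a).
  move=> x y e1; apply/eqP; rewrite -(addr2_eq0 hK); apply/negPn/negP=> xy.
  by have /eqP := lam_neq0 _ xy; rewrite lamD e1 (addrr2 hK).
exists (perm lam_inj); split.
- by apply/additive_permsP=> x y; rewrite !permE lamD.
- by move=> c x cC; rewrite !permE lamC.
exists a^-1 => [|x]; last by rewrite !permE lame'.
(* The eigenvalue has the order of [e], that is 2^N - 1, so its first N iterated squares are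
   distinct. *)
have ord i : a^-1 ^+ i = 1 -> (k %| i)%N.
  move=> ai; rewrite -oe order_dvdn; apply/eqP/permP=> x; apply: lam_inj.
  by rewrite lamX ai mul1r perm1.
have key i j : (i <= j)%N -> (j < N)%N -> a^-1 ^+ (2 ^ i)%N = a^-1 ^+ (2 ^ j)%N -> i = j.
  move=> ij jN e1; have ai0 : a^-1 != 0 by rewrite invr_eq0.
  have : a^-1 ^+ (2 ^ j - 2 ^ i)%N = 1.
    apply: (mulfI (expf_neq0 (2 ^ i)%N ai0)).
    by rewrite -exprD subnKC ?leq_exp2l // mulr1 e1.
  move/ord/dvdn_leq => h; apply/eqP; rewrite eqn_leq ij leqNgt; apply/negP=> lt.
  have : (k <= 2 ^ j - 2 ^ i)%N by apply: h; rewrite subn_gt0 ltn_exp2l.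
  have : (2 ^ j.+1 <= 2 ^ N)%N by rewrite leq_exp2l.
  have := expn_gt0 2 i; have := expn_gt0 2 j; rewrite /k (expnS 2 j); move: (2 ^ N)%N (2 ^ j)%N (2 ^ i)%N => A B D; lia.
move=> i j; rewrite !inE => iN jN; have [ij|/ltnW ij] := leqP i j; first exact: key.
by move=> /esym /key ->.
Qed.

(** Conjugation by [lam] turns [e] into multiplication by [a]. An element normalizing the group
    generated by [e] then becomes semilinear for this multiplication, and
    [additive_semilinear_monomial] applies. *)
Lemma normalizes_monomial (e lam g : {perm K}) (a : K) :
  lam \in additive_perms -> g \in additive_perms ->
  {in [pred j | (j < N)%N] &, injective (fun j => a ^+ (2 ^ j)%N)} ->
  (forall x, lam (e x) = a * lam x) -> g \in 'N(<[e]>)%g ->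
  exists b j, [/\ b != 0, (j < N)%N & forall y, (g ^ lam)%g y = b * y ^+ (2 ^ j)%N].
Proof.
move=> lA gA ainj le nge.
have /cycleP[k ek] : (e ^ g)%g \in <[e]>%g by rewrite memJ_norm // cycle_id.
have ge x : g (e x) = (e ^+ k)%g (g x) by rewrite -ek -permJ.
have lamX i x : lam ((e ^+ i)%g x) = a ^+ i * lam x.
  by elim: i x => [|i IH] x; rewrite ?expg0 ?perm1 ?mul1r // expgS permM IH le mulrA -exprSr.
have GA : (g ^ lam)%g \in additive_perms by rewrite groupJ.
apply: (additive_semilinear_monomial hK (b := a) (c := a ^+ k) _ _ ainj).
- exact/additive_permsP.
- by exists ((g ^ lam)^-1%g 1); rewrite permKV oner_eq0.
by move=> y; rewrite -(permKV lam y) -le !permJ ge lamX.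
Qed.

End AdditivePermutations.

(** * Linear maps over the subfield of order q *)

Section OrbitEvaluation.

Variables (K : finFieldType) (N : nat).
Hypotheses (hK : #|K| = (2 ^ N)%N).

Lemma card_pow2_fixed_le k : (0 < k)%N -> (#|[set x : K | x ^+ (2 ^ k)%N == x]| <= 2 ^ k)%N.
Proof.
move=> k0; pose p : {poly K} := 'X^(2 ^ k)%N + 'X.
have szp : size p = (2 ^ k).+1.
  rewrite size_polyDl size_polyXn // size_polyX ltnS.
  by have := k0; rewrite -(@ltn_exp2l 2 0 k) // expn0.
have p0 : p != 0 by rewrite -size_poly_gt0 szp.
rewrite cardE -ltnS -szp; apply: max_poly_roots p0 _ (enum_uniq _).
apply/allP=> x; rewrite mem_enum inE => /eqP gx.
by rewrite /root hornerD hornerXn hornerX gx (addrr2 hK).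
Qed.

(* Polynomials over the prime field are separated by their values at the g i,
   because they have as many roots as the g i have conjugates; there are as
   many of them (in that degree) as tuples of values. *)
Lemma orbit_eval_surj (I : finType) (per : I -> nat) (g : I -> K) :
  (forall i, (0 < per i)%N) ->
  (forall i i' j j', (j < per i)%N -> (j' < per i')%N ->
     g i ^+ (2 ^ j)%N = g i' ^+ (2 ^ j')%N -> i = i' /\ j = j') ->
  (forall i, g i ^+ (2 ^ per i)%N = g i) ->
  forall al : I -> K, (forall i, al i ^+ (2 ^ per i)%N = al i) ->
  exists M (p : 'I_M -> bool), forall i, \sum_(k < M) (p k)%:R * g i ^+ k = al i.
Proof.
(* The bound [M] is the number of all conjugates of all the [g i], one more than the degree of a
   polynomial that they force to be zero. *)
move=> per0 ginj gfix al alfix; pose M := (\sum_i per i)%N.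
pose F i : pred K := [pred x | x ^+ (2 ^ per i)%N == x].
pose ev (p : {ffun 'I_M -> bool}) : {ffun I -> K} :=
  [ffun i => \sum_(k < M) (p k)%:R * g i ^+ k].
have pow_sum p x j : (\sum_(k < M) (p k : bool)%:R * x ^+ k : K) ^+ (2 ^ j)%N
    = \sum_(k < M) (p k)%:R * (x ^+ (2 ^ j)%N) ^+ k.
  rewrite (pow2_sum hK); apply: eq_bigr=> k _; rewrite exprMn -!exprM mulnC.
  by case: (p k); rewrite ?expr1n // expr0n expn_eq0.
have evF p : ev p \in family F.
  by apply/familyP=> i; rewrite inE ffunE pow_sum gfix.
have ev_inj : injective ev.
  move=> p p' /ffunP e; apply/ffunP=> k; apply/eqP/negPn/negP=> nk.
  pose P : {poly K} := \sum_(l < M) ((p l : bool)%:R + (p' l : bool)%:R) *: 'X^l.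
  have P0 : P != 0.
    apply/eqP=> /(congr1 (fun P : {poly K} => P`_k)); rewrite coef0 coef_sum.
    rewrite (bigD1 k) //= coefZ coefXn eqxx mulr1 big1 => [|l lk]; last first.
      by rewrite coefZ coefXn [_ == _](_ : _ = (k == l)) // eq_sym (negPf lk) mulr0.
    move: nk; rewrite addr0; case: (p k); case: (p' k); rewrite ?addr0 ?add0r //.
      by move=> _ /eqP; rewrite oner_eq0.
    by move=> _ /eqP; rewrite oner_eq0.
  have szP : (size P <= M)%N.
    apply: leq_trans (size_sum _ _ _) _; apply/bigmax_leqP=> l _.
    by apply: leq_trans (size_scale_leq _ _) _; rewrite size_polyXn.
  pose rs := [seq g i ^+ (2 ^ j)%N | i <- enum I, j <- iota 0 (per i)].
  have size_rs : size rs = M.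
    by rewrite size_allpairs_dep sumnE big_map big_enum; apply: eq_bigr=> i _; rewrite size_iota.
  have : (size rs < size P)%N.
    apply: max_poly_roots P0 _ _.
      apply/allP=> _ /allpairsPdep[i [j [_ _ ->]]].
      rewrite /root horner_sum; under eq_bigr do rewrite hornerZ hornerXn mulrDl.
      by rewrite big_split /= -!pow_sum; have := e i; rewrite !ffunE => ->; rewrite (addrr2 hK).
    apply: allpairs_uniq_dep; [exact: enum_uniq | by move=> i _; exact: iota_uniq |].
    move=> _ _ /allpairsPdep[i [j [_ jP ->]]] /allpairsPdep[i' [j' [_ j'P ->]]] /= e1.
    move: jP j'P; rewrite !mem_iota => jP j'P.
    by have [-> ->] := ginj i i' j j' jP j'P e1.
  by rewrite size_rs ltnNge szP.
have leF : (#|family F| <= 2 ^ M)%N.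
  rewrite card_family foldrE big_map big_enum /= expn_sum.
  apply: leq_prod => i _; apply: leq_trans (card_pow2_fixed_le (per0 i)).
  by rewrite cardsE.
have /eqP imE : ev @: predT == [set h in family F].
  rewrite eqEcard; apply/andP; split.
    by apply/subsetP=> _ /imsetP[p _ ->]; rewrite inE.
  by rewrite card_imset // cardsE (leq_trans leF) // card_ffun card_bool card_ord.
have : finfun al \in [set h in family F].
  by rewrite inE; apply/familyP=> i; rewrite inE ffunE alfix.
rewrite -imE => /imsetP[p _ /ffunP e]; exists M, p => i.
by have := e i; rewrite !ffunE.
Qed.

End OrbitEvaluation.

Section FrobeniusPolynomials.

Variables (K : finFieldType) (f m : nat).
Hypotheses (f0 : (0 < f)%N) (m0 : (0 < m)%N) (hKq : #|K| = ((2 ^ f) ^ m)%N).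
Local Notation q := (2 ^ f)%N.
Implicit Types (h : K -> K) (x y z c : K) (a : nat -> K).

Let hK : #|K| = (2 ^ (m * f))%N. Proof. by rewrite hKq -expnM mulnC. Qed.

Let N0 : (0 < m * f)%N. Proof. by rewrite muln_gt0 m0 f0. Qed.

Lemma FqP c : reflect (c ^+ q = c) (c \in Fq K q).
Proof. by rewrite inE; exact: eqP. Qed.

Lemma Fq_pow i c : c \in Fq K q -> c ^+ (q ^ i)%N = c.
Proof.
move=> /FqP cq; elim: i => [|i IH]; first by rewrite expn0 expr1.
by rewrite expnS exprM cq.
Qed.

Lemma powqD i : {morph (fun x : K => x ^+ (q ^ i)%N) : x y / x + y}.
Proof. by move=> x y /=; rewrite -expnM (pow2D hK). Qed.

Lemma powq_powq i j x : (x ^+ (q ^ i)%N) ^+ (q ^ j)%N = x ^+ (q ^ (i + j))%N.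
Proof. by rewrite -exprM -expnD. Qed.

Lemma powqm x : x ^+ (q ^ m)%N = x.
Proof. by rewrite -hKq expf_card. Qed.

Lemma trqE z : trq q m z = trk (m * f) f z.
Proof. by rewrite /trk mulnK //; apply: eq_bigr=> i _; rewrite expnM. Qed.

Lemma trqD : {morph @trq K q m : x y / x + y}.
Proof. by move=> x y; rewrite !trqE (trkD hK). Qed.

Lemma trq0 : trq q m (0 : K) = 0.
Proof. exact: additive0 trqD. Qed.

Lemma trq_sum I (r : seq I) (P : pred I) (F : I -> K) :
  trq q m (\sum_(k <- r | P k) F k) = \sum_(k <- r | P k) trq q m (F k).
Proof. exact: (big_morph (trq q m) trqD trq0). Qed.

Lemma trq_Fq z : trq q m z \in Fq K q.
Proof. by apply/FqP; rewrite trqE (trk_fixed N0 hK) // dvdn_mull. Qed.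

Lemma trqZ c z : c \in Fq K q -> trq q m (c * z) = c * trq q m z.
Proof.
move=> cF; rewrite /trq mulr_sumr; apply: eq_bigr=> i _.
by rewrite exprMn (Fq_pow _ cF).
Qed.

Lemma trq_powq i z : trq q m (z ^+ (q ^ i)%N) = trq q m z.
Proof.
rewrite !trqE -expnM (trk_pow2 hK) (trk_fixed_mul N0 hK) // dvdn_mull //.
Qed.

Lemma trq_nondeg x : (forall y, trq q m (x * y) = 0) -> x = 0.
Proof.
move=> h; apply/eqP/negPn/negP=> x0.
have := card_trk_ker K N0 f0 (dvdn_mull m (dvdnn f)); rewrite (_ : [set _ | _] = setT).
  by rewrite cardsT hK leq_exp2l // leqNgt ltn_subrL f0 N0.
by apply/setP=> z; rewrite !inE -trqE -[z](mulVKf x0) h eqxx.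
Qed.

(** F_q is the kernel of y + y^q, whose image lies in the kernel of the trace; the bound on that
    kernel bounds F_q from below. *)
Lemma card_Fq : #|Fq K q| = q.
Proof.
apply/eqP; rewrite eqn_leq (card_pow2_fixed_le hK f0) /=.
pose g y : K := y + y ^+ q.
have gD : {morph g : x y / x + y} by move=> x y; rewrite /g (pow2D hK) addrACA.
have eF : [set y | g y == 0] = Fq K q.
  by apply/setP=> y; rewrite !inE /g (addr2_eq0 hK) eq_sym.
have := card_additive_fibers hK gD; rewrite eF hK => h.
have fN : (f <= m * f)%N by apply: leq_pmull.
rewrite -(leq_pmul2l (expn_gt0 2 (m * f - f))) -expnD subnK //.
apply: leq_trans h _; rewrite leq_mul2r; apply/orP; right.
apply: leq_trans (card_trk_ker K N0 f0 (dvdn_mull m (dvdnn f))).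
apply/subset_leq_card/subsetP=> _ /imsetP[y _ ->]; rewrite inE /g -[f in (2 ^ f)%N]muln1.
by rewrite (trk_AS N0 hK) // dvdn_mull.
Qed.

Definition qpoly a y : K := \sum_(i < m) a i * y ^+ (q ^ i)%N.

Lemma sum_multiples (A : zmodType) (F : nat -> A) :
  \sum_(j < m * f | (f %| j)%N) F j = \sum_(i < m) F (f * i)%N.
Proof.
elim: (m) => [|k IH]; first by rewrite mul0n !big_ord0.
rewrite big_ord_recr /= -IH mulSnr; move: (k * f)%N (mulnC k f) => l el.
rewrite -(big_mkord (fun j => (f %| j)%N) F) (@big_cat_nat _ _ _ l) ?leq_addr //=.
rewrite big_mkord; congr (_ + _); rewrite -{1}[l]add0n big_addn addKn.
rewrite big_mkord (bigD1 (Ordinal f0)) //= ?add0n ?el ?dvdn_mulr //.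
rewrite big1 ?addr0 // => i /andP[]; rewrite dvdn_addl ?dvdn_mulr // => fi i0.
by have := dvdn_leq _ fi; rewrite lt0n i0 => /(_ isT); rewrite leqNgt ltn_ord.
Qed.

Lemma qpolyE a y :
  qpoly a y = linpoly (fun j : 'I_(m * f) => if (f %| j)%N then a (j %/ f)%N else 0) y.
Proof.
rewrite /linpoly; under eq_bigr do rewrite (fun_if ( *%R^~ _)) mul0r.
rewrite -big_mkcond /= (sum_multiples (fun j => a (j %/ f)%N * y ^+ (2 ^ j)%N)).
by apply: eq_bigr=> i _; rewrite mulKn // -expnM.
Qed.

Lemma qpoly_inj a b : qpoly a =1 qpoly b -> forall i, (i < m)%N -> a i = b i.
Proof.
move=> ab i im; have lt : (f * i < m * f)%N by rewrite mulnC ltn_pmul2r.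
have := @linpoly_inj K _ hK _ _ _ (Ordinal lt).
move=> /(_ (fun j => if (f %| j)%N then a (j %/ f)%N else 0)).
move=> /(_ (fun j => if (f %| j)%N then b (j %/ f)%N else 0)) /=.
by rewrite dvdn_mulr // mulKn //; apply=> y; rewrite -!qpolyE.
Qed.

(** A nonzero coefficient at y^(2^j) forces c^(2^j) = c on F_q. If f did not divide j, all of F_q
    would be fixed by the Frobenius power with exponent j mod f, which has too few fixed points. *)
Lemma qlinear_qpoly h : {morph h : x y / x + y} ->
  (forall c y, c \in Fq K q -> h (c * y) = c * h y) -> exists a, h =1 qpoly a.
Proof.
move=> hD hZ; have [b hb] := additive_linpoly hK hD.
have bZ j c : c \in Fq K q -> b j * c ^+ (2 ^ j)%N = c * b j.
  move=> cF; apply: (@linpoly_inj _ _ hK (fun j => b j * c ^+ (2 ^ j)%N) (fun j => c * b j)) => y.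
  transitivity (linpoly b (c * y)); first by apply: eq_bigr=> i _; rewrite exprMn mulrA.
  by rewrite -hb hZ // hb /linpoly mulr_sumr; apply: eq_bigr=> i _; rewrite mulrA.
have b0 (j : 'I_(m * f)) : ~~ (f %| j)%N -> b j = 0.
  move=> fj; apply/eqP/negPn/negP=> bj.
  have r0 : (0 < j %% f)%N by rewrite lt0n.
  have : (#|Fq K q| <= 2 ^ (j %% f))%N.
    apply: leq_trans (card_pow2_fixed_le hK r0); apply/subset_leq_card/subsetP=> c cF.
    rewrite inE; apply/eqP; have := bZ j c cF; rewrite mulrC => /(mulIf bj).
    rewrite {1}(divn_eq j f) expnD exprM mulnC expnM Fq_pow //.
  by rewrite card_Fq leq_exp2l // leqNgt ltn_mod f0.
exists (fun i => if insub (f * i)%N is Some j then b j else 0) => y.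
rewrite qpolyE hb; apply: eq_bigr=> j _; congr (_ * _).
case: ifPn => [fj|/b0 //]; have -> : (f * (j %/ f))%N = j by rewrite mulnC divnK.
by rewrite valK.
Qed.

(** Values in F_q mean h^q = h. Comparing coefficients gives [a i.+1 = a i ^+ q], which is the shape
    of a trace. *)
Lemma trq_riesz h : {morph h : x y / x + y} ->
  (forall c y, c \in Fq K q -> h (c * y) = c * h y) ->
  (forall y, h y \in Fq K q) -> exists b, forall y, h y = trq q m (b * y).
Proof.
move=> hD hZ hF; have [a ha] := qlinear_qpoly hD hZ.
have step i : (i.+1 < m)%N -> a i.+1 = a i ^+ q.
  (* These are the coefficients of h^q, shifted cyclically because y^(q^m) = y. *)
  move=> im; pose b i := if i is k.+1 then a k ^+ q else a m.-1 ^+ q.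
  rewrite -[RHS]/(b i.+1); apply: qpoly_inj im => y.
  transitivity (qpoly a y ^+ q); first by rewrite -ha; apply/esym/FqP.
  transitivity (\sum_(k < m) a k ^+ q * y ^+ (q ^ k.+1)%N).
    by rewrite (pow2_sum hK); apply: eq_bigr=> k _; rewrite exprMn -exprM -expnSr.
  have mE : m = m.-1.+1 by rewrite prednK.
  rewrite /qpoly; move: (powqm y); rewrite mE => ym.
  rewrite big_ord_recr big_ord_recl addrC /= ym.
  by congr (_ + _).
exists (a 0%N) => y; rewrite ha /trq; apply: eq_bigr=> i _.
rewrite exprMn; congr (_ * _); case: i => i /= im.
by elim: i im => [|i IH] im; rewrite ?expn0 ?expr1 // expnSr exprM -IH ?step // ltnW.
Qed.

End FrobeniusPolynomials.

(** * Semilinear isometries *)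

Section SemilinearSymplectic.

Variables (K : finFieldType) (f m : nat).
Hypotheses (f0 : (0 < f)%N) (m0 : (0 < m)%N) (hKq : #|K| = ((2 ^ f) ^ m)%N).
Local Notation q := (2 ^ f)%N.
Local Notation V := (K * K)%type.
Local Notation Fq := (Fq K q).
Local Notation tr := (trq q m).
Local Notation kappa := (@kappa0 K q m).
Local Notation GammaSp := (GammaSp K q m).
Local Notation Sp := (Sp K q m).
Implicit Types (u v w : V) (g : {perm V}) (c d x y z : K).

Lemma cardK2 : #|K| = (2 ^ (m * f))%N. Proof. by rewrite hKq -expnM mulnC. Qed.

Let hK := cardK2.

Let trD := trqD f0 hKq.
Let tr00 := trq0 f0 hKq.
Let trF := trq_Fq f0 m0 hKq.
Let addKK := addrr2 hK.

Lemma Fq0 : 0 \in Fq. Proof. by apply/FqP; rewrite expr0n expn_eq0. Qed.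
Lemma Fq1 : 1 \in Fq. Proof. by apply/FqP; rewrite expr1n. Qed.
Lemma FqD c d : c \in Fq -> d \in Fq -> c + d \in Fq.
Proof. by move=> /FqP cF /FqP dF; apply/FqP; rewrite (pow2D hK) cF dF. Qed.
Lemma FqM c d : c \in Fq -> d \in Fq -> c * d \in Fq.
Proof. by move=> /FqP cF /FqP dF; apply/FqP; rewrite exprMn cF dF. Qed.
Lemma FqV c : c \in Fq -> c^-1 \in Fq.
Proof. by move=> /FqP cF; apply/FqP; rewrite exprVn cF. Qed.

Lemma kappaDl u v w : kappa (vadd u v) w = kappa u w + kappa v w.
Proof. by rewrite /kappa0 -trD; congr tr; rewrite /=; ring. Qed.

Lemma kappaC u v : kappa u v = kappa v u.
Proof. by rewrite /kappa0; congr tr; ring. Qed.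

Lemma kappaDr u v w : kappa w (vadd u v) = kappa w u + kappa w v.
Proof. by rewrite !(kappaC w) kappaDl. Qed.

Lemma kappaZl c u v : c \in Fq -> kappa (vscale c u) v = c * kappa u v.
Proof. by move=> cF; rewrite /kappa0 -trqZ //; congr tr; rewrite /=; ring. Qed.

Lemma kappaZr c u v : c \in Fq -> kappa u (vscale c v) = c * kappa u v.
Proof. by move=> cF; rewrite kappaC kappaZl // kappaC. Qed.

Lemma kappa_self u : kappa u u = 0.
Proof. by rewrite /kappa0 (mulrC u.2) addKK tr00. Qed.

Lemma kappa_Fq u v : kappa u v \in Fq. Proof. exact: trF. Qed.

Lemma kappa_UW x y : kappa (x, 0) (0, y) = tr (x * y).
Proof. by rewrite /kappa0 /= mul0r addr0. Qed.

Lemma kappa_U x v : kappa (x, 0) v = tr (x * v.2).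
Proof. by rewrite /kappa0 /= mul0r addr0. Qed.

Lemma kappa_W y v : kappa (0, y) v = tr (y * v.1).
Proof. by rewrite /kappa0 /= mul0r add0r. Qed.

Lemma kappa_nondeg u : (forall v, kappa u v = 0) -> u = (0, 0).
Proof.
case: u => x y h; congr (_, _); apply: (trq_nondeg f0 m0 hKq) => z.
  by have := h (0, z); rewrite /kappa0 /= mulr0 addr0.
by have := h (z, 0); rewrite /kappa0 /= mulr0 add0r.
Qed.

Lemma vadd_self u : vadd u u = (0, 0).
Proof. by rewrite /vadd !addKK. Qed.

Lemma vaddA u v w : vadd u (vadd v w) = vadd (vadd u v) w.
Proof. by rewrite /vadd /= !addrA. Qed.

Lemma vaddr0 u : vadd u (0, 0) = u.
Proof. by case: u => x y; rewrite /vadd /= !addr0. Qed.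

Lemma vsplit v : v = vadd (v.1, 0) (0, v.2).
Proof. by case: v => x y; rewrite /vadd /= addr0 add0r. Qed.

Lemma vadd_eq0 u v : vadd u v = (0, 0) -> u = v.
Proof.
by case: u v => [x y] [x' y'] [/eqP + /eqP]; rewrite !(addr2_eq0 hK) => /eqP -> /eqP ->.
Qed.

Lemma trq_unit_exists : exists z, tr z == 1.
Proof.
have [z nz] : exists z, tr z != 0.
  apply/existsP; apply: contraT => none; have /eqP : (1 : K) = 0.
    apply: (trq_nondeg f0 m0 hKq) => y; apply/eqP; apply: contraR none => nz.
    by apply/existsP; exists (1 * y).
  by rewrite oner_eq0.
by exists ((tr z)^-1 * z); rewrite trqZ ?FqV ?mulVf.
Qed.

Definition trq_unit : K := xchoose trq_unit_exists.

Lemma trq_unitP c : c \in Fq -> kappa (trq_unit, 0) (0, c) = c.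
Proof.
move=> cF; rewrite kappa_UW mulrC trqZ //; have /eqP -> := xchooseP trq_unit_exists.
exact: mulr1.
Qed.

(* kappa0 takes the value c on (trq_unit, 0) and (0, c), so that tauof g is the
   field automorphism attached to g. *)
Definition tauof g c : K := kappa (g (trq_unit, 0)) (g (0, c)).

Definition similitude (tau : K -> K) g : Prop :=
  [/\ {morph g : u v / vadd u v},
      forall c v, c \in Fq -> g (vscale c v) = vscale (tau c) (g v)
    & forall u v, kappa (g u) (g v) = tau (kappa u v)].

Lemma similitude_tauof tau g : similitude tau g -> {in Fq, tauof g =1 tau}.
Proof. by case=> _ _ gK c cF; rewrite /tauof gK trq_unitP. Qed.

Lemma similitude_ext tau tau' g : {in Fq, tau =1 tau'} -> similitude tau g -> similitude tau' g.
Proof.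
move=> e [gD gZ gK]; split=> // [c v cF|u v]; first by rewrite gZ // e.
by rewrite gK e // kappa_Fq.
Qed.

Definition Fq_aut (tau : K -> K) : Prop :=
  [/\ {in Fq, forall c, tau c \in Fq}, {in Fq &, {morph tau : c d / c + d}},
      {in Fq &, {morph tau : c d / c * d}} & {in Fq &, injective tau}].

Lemma field_autP (tau : {ffun K -> K}) : reflect (Fq_aut tau) (field_aut q tau).
Proof.
apply: (iffP andP) => [[/eqP im /forall_inP h]|[tF tD tM tI]]; split.
- by move=> c cF; rewrite -im imset_f.
- by move=> c d cF dF; have /forall_inP/(_ d dF)/andP[/eqP] := h c cF.
- by move=> c d cF dF; have /forall_inP/(_ d dF)/andP[_ /eqP] := h c cF.
- by apply/imset_injP; rewrite im.
- rewrite eqEcard (card_in_imset tI) leqnn andbT.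
  by apply/subsetP=> _ /imsetP[c cF ->]; exact: tF.
- apply/forall_inP=> c cF; apply/forall_inP=> d dF.
  by rewrite tD ?tM ?eqxx.
Qed.

(** The existentially quantified automorphism is replaced by the canonical [tauof g], which can be
    multiplied and compared. *)
Lemma GammaSpP g : reflect (Fq_aut (tauof g) /\ similitude (tauof g) g) (g \in GammaSp).
Proof.
rewrite inE; apply: (iffP existsP) => [[tau /and3P[/field_autP [tF tD tM tI]]]|[aut [gD gZ gK]]].
  case/andP=> /forallP gD /forallP gZ /forallP gK.
  have sim : similitude tau g.
    split=> [u v|c v cF|u v]; first by have /forallP/(_ v)/eqP := gD u.
      by have /implyP/(_ cF)/forallP/(_ v)/eqP := gZ c.
    by have /forallP/(_ v)/eqP := gK u.
  have e := similitude_tauof sim; split; last first.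
    by apply: similitude_ext sim => c cF; rewrite e.
  split=> [c cF|c d cF dF|c d cF dF|c d cF dF]; rewrite ?e ?FqD ?FqM //.
  - exact: tF.
  - exact: tD.
  - exact: tM.
  - exact: tI.
exists [ffun c => tauof g c]; apply/and3P; split.
- apply/field_autP; case: aut => tF tD tM tI.
  by split=> [c cF|c d cF dF|c d cF dF|c d cF dF]; rewrite !ffunE; [exact: tF|exact: tD|exact: tM|exact: tI].
- apply/andP; split; first by apply/forallP=> u; apply/forallP=> v; rewrite gD.
  by apply/forall_inP=> c cF; apply/forallP=> v; rewrite ffunE gZ.
- by apply/forallP=> u; apply/forallP=> v; rewrite ffunE gK.
Qed.

Lemma similitude_GammaSp tau g : Fq_aut tau -> similitude tau g -> g \in GammaSp.
Proof.
move=> [tF tD tM tI] sim; apply/GammaSpP; have e := similitude_tauof sim; split; last first.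
  by apply: similitude_ext sim => c cF; rewrite e.
by split=> [c cF|c d cF dF|c d cF dF|c d cF dF]; rewrite ?e ?FqD ?FqM //;
  [exact: tF|exact: tD|exact: tM|exact: tI].
Qed.

Lemma Fq_aut_id : Fq_aut id. Proof. by split. Qed.

Lemma SpP g : reflect (similitude id g) (g \in Sp).
Proof.
rewrite inE; apply: (iffP andP) => [[/andP[/forallP gD /forallP gZ] /forallP gK]|[gD gZ gK]].
  split=> [u v|c v cF|u v]; first by have /forallP/(_ v)/eqP := gD u.
    by have /implyP/(_ cF)/forallP/(_ v)/eqP := gZ c.
  by have /forallP/(_ v)/eqP := gK u.
split; last by apply/forallP=> u; apply/forallP=> v; rewrite gK.
apply/andP; split; first by apply/forallP=> u; apply/forallP=> v; rewrite gD.
by apply/forall_inP=> c cF; apply/forallP=> v; rewrite gZ.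
Qed.

Lemma SpM g h : g \in Sp -> h \in Sp -> (g * h)%g \in Sp.
Proof.
move=> /SpP[gD gZ gK] /SpP[hD hZ hK']; apply/SpP; split=> [u v|c v cF|u v]; rewrite !permM.
- by rewrite gD hD.
- by rewrite gZ // hZ.
- by rewrite hK' gK.
Qed.

Lemma Sp_GammaSp : Sp \subset GammaSp.
Proof. by apply/subsetP=> g /SpP; apply: similitude_GammaSp Fq_aut_id. Qed.

Lemma GammaSp_group_set : group_set GammaSp.
Proof.
apply/group_setP; split=> [|g h /GammaSpP[[gF gA gM gI] [gD gZ gK]] /GammaSpP[[hF hA hM hI] [hD hZ hK']]].
  by apply: (similitude_GammaSp Fq_aut_id); split=> [u v|c v _|u v]; rewrite !perm1.
apply: (@similitude_GammaSp (fun c => tauof h (tauof g c))).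
  split=> [c cF|c d cF dF|c d cF dF|c d cF dF e].
  - by rewrite hF ?gF.
  - by rewrite gA // hA ?gF.
  - by rewrite gM // hM ?gF.
  - by apply: gI => //; apply: hI; rewrite ?gF.
split=> [u v|c v cF|u v]; rewrite !permM ?gD ?hD ?gZ ?hZ ?gF //.
by rewrite hK' gK.
Qed.

Canonical GammaSp_group := Group GammaSp_group_set.

Lemma tauofM g h : g \in GammaSp -> h \in GammaSp ->
  {in Fq, forall c, tauof (g * h)%g c = tauof h (tauof g c)}.
Proof.
move=> /GammaSpP[[gF _ _ _] [gD gZ gK]] /GammaSpP[_ [hD hZ hK']].
apply: (@similitude_tauof (fun c => tauof h (tauof g c))).
split=> [u v|c v cF|u v]; rewrite !permM ?gD ?hD ?gZ ?hZ ?gF //.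
by rewrite hK' gK.
Qed.

Lemma tauof_Sp g : g \in GammaSp -> {in Fq, tauof g =1 id} -> g \in Sp.
Proof. by move=> /GammaSpP[_ sim] e; apply/SpP; apply: similitude_ext sim. Qed.

Lemma tauof_id g : g \in Sp -> {in Fq, tauof g =1 id}.
Proof. by move/SpP/similitude_tauof. Qed.

(** Sp is the kernel of the homomorphism that sends g to its field automorphism, hence normal. *)
Lemma SpJ g h : g \in Sp -> h \in GammaSp -> (g ^ h)%g \in Sp.
Proof.
move=> gS hG; have gG := subsetP Sp_GammaSp _ gS.
apply: tauof_Sp => [|c cF]; first by rewrite groupJ.
have hV : (h^-1)%g \in GammaSp by rewrite groupV.
have tF := (proj1 (GammaSpP _ hV)); have [tF' _ _ _] := tF.
have dF := tF' c cF; rewrite conjgE (tauofM hV (groupM gG hG) cF) (tauofM gG hG dF).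
rewrite (tauof_id gS dF) -(tauofM hV hG cF).
by rewrite mulVg (tauof_id (g := 1%g)) //; apply/SpP; split=> [u v|d v _|u v]; rewrite !perm1.
Qed.

Lemma GammaSp_eq0 g : g \in GammaSp -> g (0, 0) = (0, 0).
Proof.
move=> /GammaSpP[_ [gD _ _]]; have := gD (0, 0) (0, 0).
by rewrite vadd_self => ->; rewrite vadd_self.
Qed.

End SemilinearSymplectic.

(** * Shears, diagonal elements and the stabilizer of U *)

Section ParabolicElements.

Variables (K : finFieldType) (f m : nat).
Hypotheses (f0 : (0 < f)%N) (m0 : (0 < m)%N) (hKq : #|K| = ((2 ^ f) ^ m)%N).
Local Notation q := (2 ^ f)%N.
Local Notation V := (K * K)%type.
Local Notation Fq := (Fq K q).
Local Notation tr := (trq q m).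
Local Notation GammaSp := (GammaSp K q m).
Local Notation Sp := (Sp K q m).
Local Notation tauof := (tauof f0 m0 hKq).
Implicit Types (u v w : V) (g : {perm V}) (c d x y z : K) (h k : K -> K).

Let hK := cardK2 hKq.
Let trD := trqD f0 hKq.
Let tr00 := trq0 f0 hKq.
Let trF := trq_Fq f0 m0 hKq.
Let addKK := addrr2 hK.
Let nondeg := trq_nondeg f0 m0 hKq.
Let GSP := GammaSpP f0 m0 hKq.

(** These conditions, the last being self-adjointness for the trace form, make the shear by [h] a
    linear isometry. *)
Definition symmetric_qmap h : Prop :=
  [/\ {morph h : x y / x + y}, forall c y, c \in Fq -> h (c * y) = c * h y
    & forall y z, tr (h y * z) = tr (h z * y)].

Lemma shearE h v : shear h v = (v.1 + h v.2, v.2).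
Proof. by rewrite topermE //; exact: shear_fun_inj. Qed.

Lemma ellE (w : {unit K}) v : ell w v = ((val w)^-1 * v.1, val w * v.2).
Proof. by rewrite topermE //; exact: ell_fun_inj. Qed.

Lemma frobE v : frob K v = (v.1 ^+ 2, v.2 ^+ 2).
Proof. by rewrite topermE //; apply: frob_fun_inj; exact: pchar2K hK. Qed.

Lemma shear_inj h k : shear h = shear k -> h =1 k.
Proof.
move=> e y; have := congr1 (fun g : {perm V} => (g (0, y)).1) e.
by rewrite !shearE /= !add0r.
Qed.

Lemma eq_shear h k : h =1 k -> shear h = shear k.
Proof. by move=> e; apply/permP=> v; rewrite !shearE e. Qed.

Lemma shearM h k : (shear h * shear k)%g = shear (fun y => h y + k y).
Proof. by apply/permP=> v; rewrite permM !shearE /= addrA. Qed.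

Lemma shear0 : shear (fun=> 0 : K) = 1%g.
Proof. by apply/permP=> -[x y]; rewrite shearE perm1 /= addr0. Qed.

Lemma shear_Sp h : symmetric_qmap h -> shear h \in Sp.
Proof.
case=> hD hZ hS; apply/SpP; split=> [u v|c v cF|u v]; rewrite !shearE.
- by rewrite /vadd /= hD addrACA.
- by rewrite /vscale /= hZ // mulrDr.
rewrite /kappa0 /=.
transitivity (tr (u.1 * v.2 + u.2 * v.1) + (tr (h u.2 * v.2) + tr (u.2 * h v.2))).
  by rewrite -!trD; congr tr; ring.
by rewrite hS (mulrC u.2 (h v.2)) addKK addr0.
Qed.

Lemma ell_Sp (w : {unit K}) : ell w \in Sp.
Proof.
have w0 : val w != 0 by rewrite -unitfE; exact: valP w.
apply/SpP; split=> [u v|c v cF|u v]; rewrite !ellE.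
- by rewrite /vadd /= !mulrDr.
- by rewrite /vscale /=; congr (_, _); ring.
by rewrite /kappa0 /=; congr tr; field.
Qed.

Lemma Frobenius_similitude : similitude f m (fun c : K => c ^+ 2) (frob K).
Proof.
have sq : {morph (fun c : K => c ^+ 2) : x y / x + y} := pow2D hK 1.
split=> [u v|c v cF|u v]; rewrite !frobE.
- by rewrite /vadd /= !sq.
- by rewrite /vscale /= !exprMn.
rewrite /kappa0 /= /trq (pow2_sum hK 1); apply: eq_bigr=> i _.
by rewrite -!exprMn -sq exprAC.
Qed.

Lemma Fq_aut_Frobenius : Fq_aut f (fun c : K => c ^+ 2).
Proof.
split=> [c /FqP cF|c d _ _|c d _ _|c d _ _]; first by apply/FqP; rewrite exprAC cF.
- exact: (pow2D hK 1).
- exact: exprMn.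
- exact: (pow2_inj hK (k := 1)).
Qed.

Lemma frob_GammaSp : frob K \in GammaSp.
Proof. exact: similitude_GammaSp Fq_aut_Frobenius Frobenius_similitude. Qed.

(** On U the isometry is the inverse adjoint of [lam], which [trq_riesz] provides. *)
Lemma levi_Sp (lam : {perm K}) : {morph lam : x y / x + y} ->
  (forall c y, c \in Fq -> lam (c * y) = c * lam y) ->
  exists2 g, g \in Sp & exists A : K -> K, forall v, g v = (A v.1, lam v.2).
Proof.
move=> lD lZ.
have lVD : {morph (lam^-1)%g : x y / x + y}.
  by move=> x y; apply: (@perm_inj _ lam); rewrite lD !permKV.
have lVZ c y : c \in Fq -> (lam^-1)%g (c * y) = c * (lam^-1)%g y.
  by move=> cF; apply: (@perm_inj _ lam); rewrite lZ // !permKV.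
have ex x : exists b, [forall y, tr (x * (lam^-1)%g y) == tr (b * y)].
  have [b hb] : exists b, forall y, tr (x * (lam^-1)%g y) = tr (b * y).
    apply: (trq_riesz f0 m0 hKq) => [y z|c y cF|y]; last exact: trF.
      by rewrite lVD mulrDr trD.
    by rewrite (lVZ _ _ cF) mulrCA (trqZ _ _ cF).
  by exists b; apply/forallP=> y; rewrite -hb.
pose A x := xchoose (ex x).
have AP x y : tr (x * y) = tr (A x * lam y).
  by have /forallP/(_ (lam y))/eqP := xchooseP (ex x); rewrite permK.
have A_eq x b : (forall y, tr (x * y) = tr (b * lam y)) -> A x = b.
  move=> h; apply/eqP; rewrite -(addr2_eq0 hK); apply/eqP/nondeg => y.
  by rewrite mulrDl trD -(permKV lam y) -AP h addKK.
have AD : {morph A : x y / x + y}.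
  by move=> x y; apply: A_eq => z; rewrite !mulrDl !trD -!AP.
have AZ c x : c \in Fq -> A (c * x) = c * A x.
  by move=> cF; apply: A_eq => z; rewrite -!mulrA !(trqZ _ _ cF) AP.
have A0 x : A x = 0 -> x = 0.
  by move=> Ax; apply: nondeg => y; rewrite AP Ax mul0r tr00.
pose G v := (A v.1, lam v.2).
have G_inj : injective G.
  move=> [x y] [x' y'] [e /perm_inj ->]; congr (_, _); apply/eqP.
  by rewrite -(addr2_eq0 hK); apply/eqP/A0; rewrite AD e addKK.
exists (perm G_inj); last by exists A => v; rewrite permE.
apply/SpP; split=> [u v|c v cF|u v]; rewrite !permE /G /vadd /vscale /=.
- by rewrite AD lD.
- by rewrite (AZ _ _ cF) (lZ _ _ cF).
by rewrite /kappa0 /= !trD -AP (mulrC (lam u.2)) -AP (mulrC v.1).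
Qed.

Definition stabU g := forall v, ((g v).2 == 0) = (v.2 == 0).

Lemma PmP (G : {group {perm V}}) g :
  reflect (g \in G /\ stabU g) (g \in Pm G).
Proof.
apply: (iffP setIP) => -[gG]; last first.
  move=> st; split=> //; apply/astabsP=> v /=; rewrite !inE; exact: st.
by move/astabsP=> st; split=> // v; have := st v; rewrite /= !inE.
Qed.

(* The action on V / U, identified with W, of an element g stabilizing U. *)
Definition wmap g : {perm K} := toperm (fun y => (g (0, y)).2).

Section Stabilizer.

Variable g : {perm V}.
Hypotheses (gG : g \in GammaSp) (gU : stabU g).

Lemma stab_snd v : (g v).2 = (g (0, v.2)).2.
Proof.
have [_ [gD _ _]] := GSP _ gG.
have /eqP e : (g (v.1, 0)).2 == 0 by rewrite gU.
by rewrite [in LHS](vsplit v) gD /= e add0r.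
Qed.

Lemma wmapE y : wmap g y = (g (0, y)).2.
Proof.
have [_ [gD _ _]] := GSP _ gG; rewrite topermE // => y1 y2 e; apply/eqP.
rewrite -(addr2_eq0 hK) -[_ + _]/((0 : K, y1 + y2).2) -gU.
have -> : (0, y1 + y2) = vadd (0, y1) (0, y2) by rewrite /vadd /= addr0.
by rewrite gD /= e addKK.
Qed.

Lemma wmap_snd v : (g v).2 = wmap g v.2.
Proof. by rewrite stab_snd wmapE. Qed.

Lemma wmapD : {morph wmap g : x y / x + y}.
Proof.
have [_ [gD _ _]] := GSP _ gG; move=> x y; rewrite !wmapE.
have -> : (0, x + y) = vadd (0, x) (0, y) by rewrite /vadd /= addr0.
by rewrite gD.
Qed.

Lemma wmapZ c y : c \in Fq -> wmap g (c * y) = tauof g c * wmap g y.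
Proof.
have [_ [_ gZ _]] := GSP _ gG; move=> cF; rewrite !wmapE.
have -> : (0, c * y) = vscale c (0, y) by rewrite /vscale /= mulr0.
by rewrite gZ.
Qed.

Lemma wmap_additive : wmap g \in additive_perms K.
Proof. apply/additive_permsP; exact: wmapD. Qed.

(** If g is trivial on V / U, its field automorphism is trivial, and g fixes U pointwise because U
    is dual to V / U. *)
Lemma wmap_eq1 : wmap g = 1%g -> exists2 h, symmetric_qmap h & g = shear h.
Proof.
move=> e1; have [[tF _ _ _] [gD gZ gK]] := GSP _ gG.
have w1 v : (g v).2 = v.2 by rewrite wmap_snd e1 perm1.
have t1 c : c \in Fq -> tauof g c = c.
  by move=> cF; have := wmapZ 1 cF; rewrite e1 !perm1 !mulr1.
have gS : g \in Sp by exact: tauof_Sp.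
have gX x : g (x, 0) = (x, 0).
  have e2 : (g (x, 0)).2 = 0 by rewrite w1.
  case e : (g (x, 0)) e2 => [x' y'] /= y'0; congr (_, _) => //.
  apply/eqP; rewrite -(addr2_eq0 hK); apply/eqP/nondeg => y.
  have := gK (x, 0) (0, y); rewrite e y'0 !kappa_U t1 ?trF // w1 /= => e3.
  by rewrite mulrDl trD e3 addKK.
pose h y := (g (0, y)).1; have gE v : g v = (v.1 + h v.2, v.2).
  by rewrite [in LHS](vsplit v) gD gX /vadd /= add0r w1.
exists h; last by apply/permP=> v; rewrite shearE gE.
split.
- move=> x y; rewrite /h.
  have -> : (0, x + y) = vadd (0, x) (0, y) by rewrite /vadd /= addr0.
  by rewrite gD.
- move=> c y cF; rewrite /h.
  have -> : (0, c * y) = vscale c (0, y) by rewrite /vscale /= mulr0.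
  by rewrite gZ // t1.
move=> y z; have := gK (0, y) (0, z); rewrite !gE /kappa0 /= !add0r !mul0r mulr0 addr0 tr00.
rewrite t1 ?Fq0 // trD => /eqP; rewrite (addr2_eq0 hK) => /eqP ->.
by rewrite mulrC.
Qed.

End Stabilizer.

Lemma stabUM g g' : stabU g -> stabU g' -> stabU (g * g')%g.
Proof. by move=> gU g'U v; rewrite permM g'U gU. Qed.

Lemma stabUV g : stabU g -> stabU (g^-1)%g.
Proof. by move=> gU v; rewrite -{2}(permKV g v) gU. Qed.

Lemma wmapM g g' : g \in GammaSp -> stabU g -> g' \in GammaSp -> stabU g' ->
  wmap (g * g')%g = (wmap g * wmap g')%g.
Proof.
move=> gG gU g'G g'U; apply/permP=> y; rewrite permM.
rewrite wmapE ?groupM //; last exact: stabUM.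
by rewrite permM (wmap_snd g'G g'U) -(wmapE gG gU).
Qed.

Lemma shear_stabU h : stabU (shear h).
Proof. by move=> v; rewrite shearE. Qed.

Lemma ell_stabU (w : {unit K}) : stabU (ell w).
Proof.
have w0 : val w != 0 by rewrite -unitfE; exact: valP w.
by move=> v; rewrite ellE /= mulf_eq0 (negPf w0).
Qed.

End ParabolicElements.

(** * Quadratic forms *)

Section QuadraticForms.

Variables (K : finFieldType) (f m : nat).
Hypotheses (f0 : (0 < f)%N) (m0 : (0 < m)%N) (hKq : #|K| = ((2 ^ f) ^ m)%N).
Local Notation q := (2 ^ f)%N.
Local Notation V := (K * K)%type.
Local Notation Fq := (Fq K q).
Local Notation tr := (trq q m).
Local Notation kappa := (@kappa0 K q m).
Local Notation GammaSp := (GammaSp K q m).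
Local Notation tauof := (tauof f0 m0 hKq).
Local Notation tr2 := (trk (m * f) 1).
Implicit Types (u v w : V) (g : {perm V}) (c d x y z : K) (h k : K -> K) (Q : V -> K).

Let hK := cardK2 hKq.
Let N0 : (0 < m * f)%N. Proof. by rewrite muln_gt0 m0 f0. Qed.
Let trD := trqD f0 hKq.
Let tr00 := trq0 f0 hKq.
Let trF := trq_Fq f0 m0 hKq.
Let addKK := addrr2 hK.
Let nondeg := trq_nondeg f0 m0 hKq.
Let GSP := GammaSpP f0 m0 hKq.
Let kDl := kappaDl f0 hKq.
Let kDr := kappaDr f0 hKq.
Let kF := kappa_Fq f0 m0 hKq.
Let kZl := @kappaZl K f m.
Let sqD : {morph (fun x : K => x ^+ 2) : x y / x + y} := pow2D hK 1.
Let FqDK := FqD hKq.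

Definition sqrt2 x : K := x ^+ (2 ^ (m * f).-1)%N.

Lemma sqrt2K x : sqrt2 x ^+ 2 = x.
Proof. by rewrite /sqrt2 -exprM -expnSr prednK // (pow2_card hK). Qed.

Lemma sqr2K x : sqrt2 (x ^+ 2) = x.
Proof. by rewrite /sqrt2 -exprM -expnS prednK // (pow2_card hK). Qed.

Lemma sqrt2D : {morph sqrt2 : x y / x + y}.
Proof. exact: pow2D hK _. Qed.

Lemma sqrt2M : {morph sqrt2 : x y / x * y}.
Proof. by move=> x y; exact: exprMn. Qed.

Lemma sqrt2_Fq c : c \in Fq -> sqrt2 c \in Fq.
Proof. by move=> /FqP cF; apply/FqP; rewrite /sqrt2 exprAC cF. Qed.

Lemma Fq_sqr c : c \in Fq -> c ^+ 2 \in Fq.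
Proof. by move=> cF; rewrite expr2 FqM. Qed.

Definition Qf v u : K := tr (u.1 * u.2) + kappa u v ^+ 2.

Lemma Qf_Fq v u : Qf v u \in Fq.
Proof. by rewrite FqDK ?trF // Fq_sqr // kF. Qed.

Lemma QfZ v c u : c \in Fq -> Qf v (vscale c u) = c ^+ 2 * Qf v u.
Proof.
move=> cF; rewrite /Qf kZl // exprMn mulrDr; congr (_ + _).
by rewrite -(trqZ _ _ (Fq_sqr cF)) /=; congr tr; ring.
Qed.

Lemma QfD v u w : Qf v (vadd u w) = Qf v u + Qf v w + kappa u w.
Proof.
rewrite /Qf kDl sqD.
transitivity (tr (u.1 * u.2) + tr (w.1 * w.2) + kappa u w + (kappa u v ^+ 2 + kappa w v ^+ 2)).
  by congr (_ + _); rewrite /kappa0 -!trD; congr tr; rewrite /=; ring.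
by ring.
Qed.

Lemma Qf_quadratic v : quadratic_form q m (Qf v).
Proof. by split=> [u|c u|u w]; [exact: Qf_Fq|exact: QfZ|exact: QfD]. Qed.

Lemma kappa_rep (lam : V -> K) :
  {morph lam : u v / vadd u v >-> u + v} ->
  (forall c v, c \in Fq -> lam (vscale c v) = c * lam v) ->
  (forall v, lam v \in Fq) -> exists v, forall u, lam u = kappa u v.
Proof.
move=> lD lZ lF.
have [b hb] : exists b, forall x, lam (x, 0) = tr (b * x).
  apply: (trq_riesz f0 m0 hKq) => [x y|c y cF|y]; last exact: lF.
    by rewrite -lD /vadd /= addr0.
  by rewrite -lZ // /vscale /= mulr0.
have [a ha] : exists a, forall y, lam (0, y) = tr (a * y).
  apply: (trq_riesz f0 m0 hKq) => [x y|c y cF|y]; last exact: lF.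
    by rewrite -lD /vadd /= addr0.
  by rewrite -lZ // /vscale /= mulr0.
exists (a, b) => v; rewrite (vsplit v).
by rewrite lD kDl kappa_U // kappa_W //= hb ha; congr (tr _ + tr _); rewrite mulrC.
Qed.

(** Two quadratic forms with the same polar form differ by an additive map that scales by squares.
    Its square root is a linear form, hence of the shape [kappa u v]. *)
Lemma quadratic_form_Qf Q : quadratic_form q m Q -> exists v, Q =1 Qf v.
Proof.
case=> QF QZ QD; pose lam u := sqrt2 (Q u + Qf (0, 0) u).
have [v hv] : exists v, forall u, lam u = kappa u v.
  apply: kappa_rep => [u v|c v cF|v]; last by rewrite sqrt2_Fq // FqDK // Qf_Fq.
    rewrite /lam -sqrt2D; congr sqrt2; rewrite QD QfD.
    transitivity (Q u + Qf (0, 0) u + (Q v + Qf (0, 0) v) + (kappa u v + kappa u v)).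
      by ring.
    by rewrite addKK addr0.
  by rewrite /lam QZ // QfZ // -mulrDr sqrt2M sqr2K.
exists v => u; rewrite {1}/Qf -hv sqrt2K.
have -> : Qf (0, 0) u = tr (u.1 * u.2).
  by rewrite /Qf /kappa0 /= !mulr0 addr0 tr00 expr0n addr0.
by rewrite addrCA addKK addr0.
Qed.

Lemma Qf_diff v v' u : Qf v u + Qf v' u = kappa u (vadd v v') ^+ 2.
Proof. by rewrite /Qf addrACA addKK add0r kDr sqD. Qed.

Lemma Qf_inj v v' : Qf v =1 Qf v' -> v = v'.
Proof.
move=> e; apply: (vadd_eq0 hKq); apply: (kappa_nondeg f0 m0 hKq) => u.
have /eqP := Qf_diff v v' u; rewrite e addKK eq_sym expf_eq0 /= => /eqP.
by rewrite kappaC.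
Qed.

(** The form transported by g has polar form [kappa0] again, since the twists by the field
    automorphisms of g and of its inverse cancel. *)
Lemma form_act_exists v g : g \in GammaSp ->
  exists v', [forall u, Qf v' (g u) == tauof g (Qf v u)].
Proof.
move=> gG; have gVG : (g^-1)%g \in GammaSp by rewrite groupV.
have [[tF tA tM tI] [gD gZ gK]] := GSP _ gG.
have [[tF' _ _ _] [gD' gZ' gK']] := GSP _ gVG.
have ttV c : c \in Fq -> tauof g (tauof (g^-1)%g c) = c.
  move=> cF; rewrite -tauofM // mulVg tauof_id //.
  by apply/SpP; split=> [u w|d w _|u w]; rewrite !perm1.
have [v' hv'] : exists v', (fun u => tauof g (Qf v ((g^-1)%g u))) =1 Qf v'.
  apply: quadratic_form_Qf; split=> [u|c u cF|u w].
  - by rewrite tF ?Qf_Fq.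
  - rewrite gZ' // QfZ ?tF' // tM ?Fq_sqr ?tF' ?Qf_Fq // expr2 tM ?tF' //.
    by rewrite ttV // -expr2.
  have F1 := Qf_Fq v ((g^-1)%g u); have F2 := Qf_Fq v ((g^-1)%g w).
  have F3 := kF ((g^-1)%g u) ((g^-1)%g w).
  by rewrite gD' QfD (tA _ _ (FqDK F1 F2) F3) (tA _ _ F1 F2) gK' ttV ?kF.
by exists v'; apply/forallP=> u; rewrite -hv' permK.
Qed.

(* Qf is the Q_v of the header; g maps the form Qf v to Qf (form_act v g). *)
Definition form_act v g : V :=
  odflt v [pick v' | [forall u, Qf v' (g u) == tauof g (Qf v u)]].

Lemma form_actP v g u : g \in GammaSp -> Qf (form_act v g) (g u) = tauof g (Qf v u).
Proof.
move=> gG; rewrite /form_act; case: pickP => [v' /forallP/(_ u)/eqP //|none].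
by have [v'] := form_act_exists v gG; rewrite none.
Qed.

Lemma form_act_eq v v' g : g \in GammaSp ->
  (forall u, Qf v' (g u) = tauof g (Qf v u)) -> form_act v g = v'.
Proof.
by move=> gG e; apply: Qf_inj => u; rewrite -(permKV g u) form_actP // e.
Qed.

Lemma form_actM v g g' : g \in GammaSp -> g' \in GammaSp ->
  form_act v (g * g')%g = form_act (form_act v g) g'.
Proof.
move=> gG g'G; apply: form_act_eq => [|u]; first by rewrite groupM.
by rewrite permM !form_actP // tauofM // Qf_Fq.
Qed.

Lemma form_act1 v : form_act v 1%g = v.
Proof.
apply: form_act_eq => [|u]; first exact: group1.
rewrite perm1 tauof_id ?Qf_Fq //.
by apply/SpP; split=> [w w'|d w _|w w']; rewrite !perm1.
Qed.

(** An element preserving both U and W preserves the form Tr(u1 u2) up to its field automorphism, so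
    only the square of [kappa u v] moves. *)
Lemma form_act_diagonal v g : g \in GammaSp -> (forall x, (g (x, 0)).2 = 0) ->
  (forall y, (g (0, y)).1 = 0) -> form_act v g = g v.
Proof.
move=> gG gU gW; have [[tF tA tM tI] [gD gZ gK]] := GSP _ gG.
apply: form_act_eq => // u; rewrite {2}/Qf tA ?trF ?Fq_sqr ?kF // expr2 tM ?kF //.
rewrite -gK -expr2; congr (_ + _).
rewrite [in LHS](vsplit u) gD /= gU gW addr0 add0r -(kappa_UW f m u.1 u.2) -gK.
by rewrite /kappa0 gU mul0r addr0.
Qed.

(** The shear changes Tr(u1 u2) by Tr(h(u2) u2), which is additive because [h] is self-adjoint. When
    it is written as the square of Tr(s u2), the action on v becomes affine, with translation part
    [s]. *)
Lemma form_act_shear h s v : symmetric_qmap f m h ->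
  (forall y, tr (h y * y) = tr (s * y) ^+ 2) ->
  form_act v (shear h) = (v.1 + h v.2 + s, v.2).
Proof.
move=> hS hs; have gS := shear_Sp f0 hKq hS; have [_ _ hs'] := hS.
apply: form_act_eq => [|u]; first exact: subsetP (Sp_GammaSp f0 m0 hKq) _ gS.
rewrite tauof_id ?Qf_Fq // shearE /Qf /kappa0 /=.
have -> : (u.1 + h u.2) * u.2 = u.1 * u.2 + h u.2 * u.2 by ring.
have -> : (u.1 + h u.2) * v.2 + u.2 * (v.1 + h v.2 + s) =
   u.1 * v.2 + u.2 * v.1 + (h u.2 * v.2 + u.2 * h v.2) + s * u.2 by ring.
rewrite !trD hs hs' (mulrC u.2 (h v.2)) addKK addr0 !sqD.
transitivity (tr (u.1 * u.2) + (tr (u.1 * v.2) ^+ 2 + tr (u.2 * v.1) ^+ 2) +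
  (tr (s * u.2) ^+ 2 + tr (s * u.2) ^+ 2)); first by ring.
by rewrite addKK addr0.
Qed.

(** On U the form Q_v is the square of [kappa u v], which depends on v2 only. *)
Lemma form_act_snd v g : g \in GammaSp -> stabU g -> (form_act v g).2 = wmap g v.2.
Proof.
move=> gG gU; have [[tF tA tM tI] [gD gZ gK]] := GSP _ gG.
apply/eqP; rewrite -(addr2_eq0 hK); apply/eqP/nondeg => x.
have e := form_actP v ((g^-1)%g (x, 0)) gG; move: e; rewrite permKV.
have : ((g^-1)%g (x, 0)).2 = 0 by apply/eqP; rewrite (stabUV gU).
case e : ((g^-1)%g (x, 0)) => [x' y'] /= y'0.
have gx : g (x', 0) = (x, 0) by have := permKV g (x, 0); rewrite e y'0.
rewrite /Qf y'0 /= !mulr0 tr00 !add0r expr2 tM ?kF // -expr2.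
rewrite -gK gx !kappa_U // => /eqP; rewrite -(addr2_eq0 hK) -sqD expf_eq0 /=.
rewrite -trD -mulrDr (wmap_snd (f := f) (m := m)) // => /eqP.
by rewrite mulrC.
Qed.

(** Every form of minus type has its vector here. Conversely, Sp is transitive on this set by
    [minus_set_transitive], so a single minus form makes all members minus forms. *)
Definition minus_set : {set V} := [set v : V | tr2 (v.1 * v.2) == 1].

Lemma minus_setP v : reflect (tr2 (v.1 * v.2) = 1) (v \in minus_set).
Proof. by rewrite inE; exact: eqP. Qed.

Lemma minus_set_snd v : v \in minus_set -> v.2 != 0.
Proof.
move/minus_setP; apply: contra_eq_neq => ->.
by rewrite mulr0 (additive0 (trkD hK 1)) eq_sym oner_eq0.
Qed.

Lemma tr2_01 x : tr2 x = 0 \/ tr2 x = 1.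
Proof.
have := trk_fixed N0 hK x (ltn0Sn 0) (dvd1n _); rewrite expn1 expr2 => e.
have [->|n0] := eqVneq (tr2 x) 0; [by left | right].
by apply: (mulfI n0); rewrite e mulr1.
Qed.

Lemma tr2_ker x : tr2 x = 0 -> exists y, x = y + y ^+ 2.
Proof. exact: (trk_ker N0 hK (k := 1)). Qed.

(** The K-line through (a, b) has dimension m over F_q, one more than the Witt index of a minus
    form. *)
Lemma singular_plane_not_minus v a b : (a, b) != (0, 0) ->
  (forall y, Qf v (a * y, b * y) = 0) -> ~ minus_form q m (Qf v).
Proof.
move=> ab0 sing [_ wi]; pose E := [set (a * y, b * y) | y : K].
have cE : #|E| = (q ^ m)%N.
  rewrite card_imset // => y z [ay bz]; move: ab0; rewrite xpair_eqE negb_and.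
  by case/orP=> n0; [apply: (mulfI n0 ay) | apply: (mulfI n0 bz)].
have dE : dimq q E = m.
  by rewrite /dimq cE trunc_expnK // -(expn0 2) ltn_exp2l.
have tsE : totally_singular q (Qf v) E.
  apply/andP; split; last by apply/forall_inP=> _ /imsetP[y _ ->]; rewrite sing.
  apply/and3P; split.
  - by apply/imsetP; exists 0; rewrite ?mulr0.
  - apply/forall_inP=> _ /imsetP[y _ ->]; apply/forall_inP=> _ /imsetP[z _ ->].
    by apply/imsetP; exists (y + z); rewrite // /vadd /= !mulrDr.
  - apply/forall_inP=> c cF; apply/forall_inP=> _ /imsetP[y _ ->].
    by apply/imsetP; exists (c * y); rewrite // /vscale /= !(mulrCA c).
have : (dimq q E <= witt_index q (Qf v))%N by apply: (leq_bigmax_cond E).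
by rewrite dE -{1}wi ltnn.
Qed.

Lemma minus_form_minus_set v : minus_form q m (Qf v) -> v \in minus_set.
Proof.
case: v => a b mf; apply/minus_setP => /=.
have [t0|//] := tr2_01 (a * b); exfalso.
have [b0|b0] := eqVneq b 0.
  apply: (@singular_plane_not_minus (a, b) 1 0 _ _ mf) => [|y].
    by rewrite xpair_eqE oner_eq0.
  by rewrite /Qf /kappa0 /= b0 !mul0r !mulr0 addr0 tr00 expr0n addr0.
(* On the vectors (d^2 y, y) the form is the square of Tr((d + d^2 b + a) y), and for d = e / b the
   coefficient is (e + e^2 + a b) / b = 0. *)
have [e ee] := tr2_ker t0; pose d := e / b.
apply: (@singular_plane_not_minus (a, b) (d ^+ 2) 1 _ _ mf) => [|y].
  by rewrite xpair_eqE oner_eq0 andbF.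
rewrite /Qf /kappa0 /= mul1r.
have -> : d ^+ 2 * y * y = (d * y) ^+ 2 by ring.
have trq_sqr z : tr (z ^+ 2) = tr z ^+ 2.
  by rewrite !trqE // (trk_pow2 hK f 1).
rewrite trq_sqr -sqD -trD (_ : _ + _ = 0) ?tr00 ?expr0n //.
transitivity ((a * b + e + e ^+ 2) / b * y); first by rewrite /d; field.
by rewrite ee -addrA addKK mul0r mul0r.
Qed.

Lemma subspace_GammaSp (E : {set V}) g : g \in GammaSp -> subspace q E -> subspace q (g @: E).
Proof.
move=> gG /and3P[E0 /forall_inP ED /forall_inP EZ].
have [_ [gD gZ _]] := GSP _ gG.
have gVG : (g^-1)%g \in GammaSp by rewrite groupV.
have [[tF' _ _ _] [_ gZ' _]] := GSP _ gVG.
apply/and3P; split.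
- by apply/imsetP; exists (0, 0); rewrite // (GammaSp_eq0 f0 m0 hKq gG).
- apply/forall_inP=> _ /imsetP[u uE ->]; apply/forall_inP=> _ /imsetP[v vE ->].
  by rewrite -gD imset_f //; have /forall_inP := ED u uE; apply.
apply/forall_inP=> c cF; apply/forall_inP=> _ /imsetP[u uE ->].
have -> : vscale c (g u) = g (vscale (tauof (g^-1)%g c) u).
  by apply: (@perm_inj _ (g^-1)%g); rewrite permK gZ' // permK.
by rewrite imset_f //; have /forall_inP := EZ _ (tF' c cF); apply.
Qed.

Lemma witt_index_form_act v g : g \in GammaSp ->
  (witt_index q (Qf v) <= witt_index q (Qf (form_act v g)))%N.
Proof.
move=> gG; apply/bigmax_leqP=> E /andP[sE /forall_inP singE].
have -> : dimq q E = dimq q (g @: E) by rewrite /dimq card_imset //; exact: perm_inj.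
apply: leq_bigmax_cond; rewrite /totally_singular subspace_GammaSp //=.
apply/forall_inP=> _ /imsetP[u uE ->]; rewrite form_actP // (eqP (singE u uE)).
have [[tF tA _ _] _] := GSP _ gG.
by have := tA 0 0 (Fq0 _ _) (Fq0 _ _); rewrite addKK => ->; rewrite addKK.
Qed.

Lemma form_actVK v g : g \in GammaSp -> form_act (form_act v g) (g^-1)%g = v.
Proof. by move=> gG; rewrite -form_actM ?groupV // mulgV form_act1. Qed.

Lemma minus_form_act v g : g \in GammaSp ->
  minus_form q m (Qf v) -> minus_form q m (Qf (form_act v g)).
Proof.
move=> gG [_ wi]; split; first exact: Qf_quadratic.
rewrite -[RHS]wi; congr _.+1; apply/eqP.
rewrite eqn_leq witt_index_form_act // andbT -{2}(form_actVK v gG).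
by rewrite witt_index_form_act // groupV.
Qed.

End QuadraticForms.

(** * Minus forms and the factorization criterion *)

Section MinusStabilizer.

Variables (K : finFieldType) (f m : nat).
Hypotheses (f0 : (0 < f)%N) (m2 : (2 <= m)%N) (hKq : #|K| = ((2 ^ f) ^ m)%N).
Local Notation q := (2 ^ f)%N.
Local Notation V := (K * K)%type.
Local Notation Fq := (Fq K q).
Local Notation tr := (trq q m).
Local Notation kappa := (@kappa0 K q m).
Local Notation GammaSp := (GammaSp K q m).
Local Notation Sp := (Sp K q m).
Let m0 : (0 < m)%N := ltnW m2.
Local Notation tauof := (tauof f0 m0 hKq).
Local Notation form_act := (form_act f0 m0 hKq).
Local Notation minus_set := (minus_set K f m).
Local Notation Qf := (Qf f m).
Implicit Types (u v w : V) (g : {perm V}) (c d x y z : K) (h k : K -> K) (Q : V -> K).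

Let hK := cardK2 hKq.
Let tr00 := trq0 f0 hKq.
Let addKK := addrr2 hK.
Let kDl := kappaDl f0 hKq.
Let kDr := kappaDr f0 hKq.
Let kF := kappa_Fq f0 m0 hKq.
Let kZl := @kappaZl K f m.
Let kZr := @kappaZr K f m.
Let sSG := Sp_GammaSp f0 m0 hKq.
Let sqrK := sqrt2K f0 m0 hKq.

Lemma trq_sqr z : tr (z ^+ 2) = tr z ^+ 2.
Proof. by rewrite !trqE // (trk_pow2 hK f 1). Qed.

Lemma symmetric_qmap_scale c : symmetric_qmap f m (fun y => c * y).
Proof.
split=> [x y|d y _|y z]; first exact: mulrDr; first by ring.
by congr tr; ring.
Qed.

(** Here Tr(c y^2) is the square of Tr(s y) for s the square root of c. *)
Lemma form_act_scale c v :
  form_act v (shear (fun y => c * y)) = (v.1 + c * v.2 + sqrt2 f m c, v.2).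
Proof.
apply: form_act_shear => [|y]; first exact: symmetric_qmap_scale.
by rewrite -trq_sqr exprMn sqrK; congr tr; ring.
Qed.

Lemma ell_GammaSp (w : {unit K}) : ell w \in GammaSp.
Proof. by apply: (subsetP sSG); exact: ell_Sp. Qed.

Lemma form_act_ell (w : {unit K}) v : form_act v (ell w) = ell w v.
Proof.
apply: form_act_diagonal => [|x|y]; rewrite ?ell_GammaSp //.
  by rewrite ellE /= mulr0.
by rewrite ellE /= mulr0.
Qed.

(** With e = b sqrt(c), the shear adds b (c b + sqrt(c)) = e^2 + e to the product v1 v2, and these
    are all the elements of absolute trace 0. *)
Lemma minus_set_shear_transitive a a' b :
  (a, b) \in minus_set -> (a', b) \in minus_set ->
  exists c, form_act (a, b) (shear (fun y => c * y)) = (a', b).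
Proof.
move=> ab a'b; have /= b0 := minus_set_snd hKq ab.
have [e ee] : exists e, a * b + a' * b = e + e ^+ 2.
  apply: (tr2_ker f0 m0 hKq); move/minus_setP: ab; move/minus_setP: a'b => /= e' e1.
  by rewrite (trkD hK) e' e1 addKK.
exists ((e / b) ^+ 2); rewrite form_act_scale /= (sqr2K f0 m0 hKq); congr (_, _).
transitivity ((a * b + (e + e ^+ 2)) / b); first by field.
by rewrite -ee addrA addKK add0r mulfK.
Qed.

Lemma minus_set_transitive v v' : v \in minus_set -> v' \in minus_set ->
  exists2 g, g \in Sp & form_act v g = v'.
Proof.
case: v v' => [a b] [a' b'] ab a'b'.
have /= b0 := minus_set_snd hKq ab; have /= b'0 := minus_set_snd hKq a'b'.
have wU : b' / b \is a GRing.unit by rewrite unitfE mulf_neq0 ?invr_eq0.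
pose w : {unit K} := FinRing.unit K wU.
have abw : (a / (b' / b), b') \in minus_set.
  apply/minus_setP; move/minus_setP: ab => /= <-; congr trk; field.
  by rewrite b0 b'0.
have [c hc] := minus_set_shear_transitive abw a'b'.
have sS := shear_Sp f0 hKq (symmetric_qmap_scale c).
exists (ell w * shear (fun y => (c * y)%R))%g.
  by apply: SpM; [exact: ell_Sp | exact: sS].
rewrite form_actM ?ell_GammaSp ?(subsetP sSG _ sS) // form_act_ell ellE /= mulfVK //.
by rewrite (mulrC _ a) hc.
Qed.

Section BaseForm.

Variable v0 : V.
Hypothesis v0m : minus_form q m (Qf v0).

Lemma base_minus_set : v0 \in minus_set.
Proof. exact: minus_form_minus_set v0m. Qed.

Lemma form_act_minus_set v g : g \in GammaSp -> v \in minus_set -> form_act v g \in minus_set.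
Proof.
move=> gG vM; have [g1 g1S <-] := minus_set_transitive base_minus_set vM.
rewrite -form_actM ?(subsetP sSG _ g1S) //.
apply: (minus_form_minus_set f0 m0 hKq); apply: minus_form_act => //.
by rewrite groupM // (subsetP sSG).
Qed.

Lemma minus_set_not_fixed : exists2 v, v \in minus_set & v != v0.
Proof.
have v0M := base_minus_set; case: (v0) v0M => a b abM.
have /= b0 := minus_set_snd hKq abM.
have [c /andP[c0 c1]] : exists c, (c != 0) && (c != 1).
  apply/existsP; apply: contraT => /existsPn h.
  have : (#|K| <= #|[set (0%R : K); 1%R]|)%N.
    rewrite -cardsT; apply/subset_leq_card/subsetP=> c _; rewrite !inE.
    by have := h c; rewrite negb_and !negbK.
  rewrite cards2 eq_sym oner_eq0 hK leqNgt -{1}(expn1 2) ltn_exp2l //.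
  by rewrite (leq_trans m2) // leq_pmulr.
exists (a / c, c * b); last first.
  by rewrite xpair_eqE negb_and -{2}[b]mul1r (inj_eq (mulIf b0)) c1 orbT.
apply/minus_setP; move/minus_setP: abM => /= <-; congr trk; field.
by rewrite c0.
Qed.

(** The nonsingular vectors span V. If w were nonzero and orthogonal to all of them, the form would
    vanish off the hyperplane orthogonal to w. Comparison with a fixed v off the hyperplane shows
    that the form equals [kappa u v] on it; being additive there, it makes the hyperplane totally
    isotropic. This forces V to have dimension at most 2, whereas 2m is at least 4. *)
Lemma nonsingular_orthogonal w :
  (forall z : V, Qf v0 z != 0 -> kappa z w = 0) -> w = (0, 0).
Proof.
move=> orth; apply: (kappa_nondeg f0 m0 hKq) => v; apply/eqP/negPn/negP.
rewrite kappaC => vw; have sing (z : V) : kappa z w != 0 -> Qf v0 z = 0.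
  by move=> zw; apply/eqP; apply: contraNT zw => /orth ->.
have Qu u : kappa u w = 0 -> Qf v0 u = kappa u v.
  move=> uw; have := sing (vadd u v); rewrite kDl uw add0r => /(_ vw).
  rewrite (QfD f0 hKq) (sing v vw) addr0 => /eqP.
  by rewrite (addr2_eq0 hK) => /eqP.
have iso u u' : kappa u w = 0 -> kappa u' w = 0 -> kappa u u' = 0.
  move=> uw u'w; have := Qu (vadd u u'); rewrite kDl uw u'w addr0 => /(_ erefl).
  rewrite (QfD f0 hKq) (Qu u uw) (Qu u' u'w) kDl => /eqP.
  by rewrite -subr_eq0 addrAC subrr add0r => /eqP.
pose F u := (kappa u w, kappa u v).
have F_inj : injective F.
  move=> u u' [ew ev]; apply: (vadd_eq0 hKq); set t := vadd u u'.
  have tw : kappa t w = 0 by rewrite kDl ew addKK.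
  have tv : kappa t v = 0 by rewrite kDl ev addKK.
  apply: (kappa_nondeg f0 m0 hKq) => z; pose c := kappa z w / kappa v w.
  have cF : c \in Fq by rewrite FqM ?FqV ?kF.
  have := iso t (vadd z (vscale c v)) tw; rewrite kDr kZr // tv mulr0 addr0; apply.
  by rewrite kDl kZl // /c divfK // addKK.
have : (#|{: V}| <= #|setX Fq Fq|)%N.
  rewrite -cardsT -(card_imset _ F_inj); apply/subset_leq_card/subsetP=> _ /imsetP[u _ ->].
  by rewrite inE /= !kF.
rewrite card_prod cardsX (card_Fq f0 m0 hKq) hKq -!expnM -!expnD leq_exp2l //.
by have := f0; have := m2; nia.
Qed.

Lemma transvection_Ominus (z : V) : Qf v0 z != 0 ->
  exists2 t, t \in Ominus q m (Qf v0) &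
    forall u, t u = vadd u (vscale (kappa u z / Qf v0 z) z).
Proof.
move=> Qz; pose T u := vadd u (vscale (kappa u z / Qf v0 z) z).
have cF u : kappa u z / Qf v0 z \in Fq by rewrite FqM ?FqV ?kF ?Qf_Fq.
have kT u : kappa (T u) z = kappa u z.
  by rewrite /T kDl kZl // (kappa_self f0 hKq) mulr0 addr0.
have TK : involutive T.
  move=> u; rewrite {1}/T kT /T -vaddA.
  have -> : forall w, vadd w w = (0, 0) by exact: vadd_self hKq.
  exact: vaddr0.
have T_inj := can_inj TK; exists (perm T_inj); last by move=> u; rewrite permE.
have TD : {morph T : u v / vadd u v}.
  move=> u v; rewrite /T kDl mulrDl /vadd /vscale /=; congr (_, _); ring.
have TZ c u : c \in Fq -> T (vscale c u) = vscale c (T u).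
  by move=> cFq; rewrite /T kZl // /vadd /vscale /=; congr (_, _); ring.
have TC u v : kappa (T u) (T v) = kappa u v.
  rewrite /T kDl !kDr !kZl // !kZr // (kappa_self f0 hKq) !mulr0 addr0.
  transitivity (kappa u v + (kappa u z * kappa z v / Qf v0 z + kappa u z * kappa z v / Qf v0 z)).
    by rewrite (kappaC f m v z); ring.
  by rewrite addKK addr0.
have TQ u : Qf v0 (T u) = Qf v0 u.
  rewrite /T (QfD f0 hKq) QfZ // kZr //.
  transitivity (Qf v0 u + (kappa u z ^+ 2 / Qf v0 z + kappa u z ^+ 2 / Qf v0 z)).
    by field.
  by rewrite addKK addr0.
rewrite inE; apply/andP; split; last by apply/forallP=> u; rewrite permE TQ.
by apply/SpP; split=> [u v|c v cFq|u v]; rewrite !permE ?TD ?TZ ?TC.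
Qed.

(** The sum of the two forms is the square of [kappa u (vadd v1 v0)], which the orthogonal group
    then preserves. The transvection at a nonsingular z does so only if z is orthogonal to v1 +
    v0. *)
Lemma Ominus_fixed_form v1 :
  (forall t, t \in Ominus q m (Qf v0) -> forall u, Qf v1 (t u) = Qf v1 u) -> v1 = v0.
Proof.
move=> fix1; apply: (vadd_eq0 hKq); apply: nonsingular_orthogonal => z Qz.
have [t tO tE] := transvection_Ominus Qz.
have tw u : kappa (t u) (vadd v1 v0) = kappa u (vadd v1 v0).
  have [_ /forallP/(_ u)/eqP t0] : t \in Sp /\ [forall v, Qf v0 (t v) == Qf v0 v].
    by move: tO; rewrite inE => /andP[].
  have /eqP : (kappa (t u) (vadd v1 v0) + kappa u (vadd v1 v0)) ^+ 2 = 0.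
    by rewrite [LHS](pow2D hK 1) -!(Qf_diff f0 hKq) (fix1 t tO) t0 addKK.
  by rewrite expf_eq0 (addr2_eq0 hK) => /eqP.
have cF u : kappa u z / Qf v0 z \in Fq by rewrite FqM ?FqV ?kF ?Qf_Fq.
have z0 : z != (0, 0).
  apply: contraNneq Qz => ->; apply/eqP; rewrite /Qf /kappa0 /= !mul0r addr0 !tr00.
  by rewrite expr0n addr0.
have [u uz] : exists u, kappa u z != 0.
  apply/existsP; apply: contraR z0 => /existsPn h; apply/eqP/(kappa_nondeg f0 m0 hKq) => u.
  by have := h u; rewrite negbK kappaC => /eqP.
have /eqP := tw u; rewrite tE kDl kZl // addrC -subr_eq0 addrK !mulf_eq0 (negPf uz).
by rewrite invr_eq0 (negPf Qz) /= => /eqP.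
Qed.

(** B normalizes its intersection with Sp, so an element of B sends the form to another form fixed
    by the orthogonal group, which must be the same one. The stabilizer thus contains B; it does not
    contain Sp, and B is maximal. *)
Theorem Ominus_overgroup_stabilizer (G B : {group {perm V}}) :
  Sp \subset G -> G \subset GammaSp ->
  [max B of A | (A \subset G) && ~~ (Sp \subset A)] ->
  B :&: Sp = Ominus q m (Qf v0) ->
  forall g, g \in G -> (g \in B) = (form_act v0 g == v0).
Proof.
move=> sSpG sGG /maxgroupP[/andP[sBG nSB] maxB] BS.
have stab_group : group_set [set g in G | form_act v0 g == v0].
  apply/group_setP; split=> [|g h]; first by rewrite inE group1 form_act1 eqxx.
  rewrite !inE => /andP[gG /eqP gv] /andP[hG /eqP hv]; rewrite groupM //=.
  by rewrite form_actM ?(subsetP sGG) // gv hv.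
pose S := Group stab_group.
have sBS : B \subset S.
  apply/subsetP=> g gB; have gG := subsetP sBG _ gB; have gGG := subsetP sGG _ gG.
  rewrite inE gG /=; apply/eqP/Ominus_fixed_form => t tO u.
  have tg : (t ^ g^-1)%g \in Ominus q m (Qf v0).
    rewrite -BS inE; have : t \in B :&: Sp by rewrite BS.
    case/setIP=> tB tS; rewrite groupJ ?groupV //=.
    by apply: (SpJ f0 m0 hKq tS); rewrite groupV.
  move: tg; rewrite inE => /andP[_ /forallP/(_ ((g^-1)%g u))/eqP].
  move/(congr1 (tauof g)); rewrite -!form_actP // permKV => <-.
  by rewrite conjgE invgK !permM permKV permKV.
have eSB : S :=: B.
  apply: maxB => //; apply/andP; split; first by apply/subsetP=> g; rewrite inE => /andP[].
  apply/subsetPn; have [v vM vv0] := minus_set_not_fixed.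
  have [g gS gv] := minus_set_transitive base_minus_set vM.
  by exists g => //; rewrite inE gv (negPf vv0) andbF.
by move=> g gG; rewrite -eSB inE gG.
Qed.

Definition form_transitive (H : {set {perm V}}) : Prop :=
  forall v v', v \in minus_set -> v' \in minus_set -> exists2 h, h \in H & form_act v h = v'.

Theorem factorization_form_transitive (G H B : {group {perm V}}) :
  Sp \subset G -> G \subset GammaSp -> H \subset G ->
  [max B of A | (A \subset G) && ~~ (Sp \subset A)] ->
  B :&: Sp = Ominus q m (Qf v0) ->
  G :=: (H * B)%g <-> form_transitive H.
Proof.
move=> sSpG sGG sHG maxB BS; have inB := Ominus_overgroup_stabilizer sSpG sGG maxB BS.
have sBG : B \subset G by case/maxgroupP: maxB => /andP[].
have GG g : g \in G -> g \in GammaSp by apply: subsetP.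
split=> [eG|trH].
  have orb v : v \in minus_set -> exists2 h, h \in H & form_act v0 h = v.
    move=> vM; have [g gS gv] := minus_set_transitive base_minus_set vM.
    have gG := subsetP sSpG _ gS.
    have : (g^-1)%g \in (H * B)%g by rewrite -eG groupV.
    case/mulsgP=> h b hH bB e; exists (h^-1)%g; first by rewrite groupV.
    have bG := subsetP sBG _ bB; have hG := subsetP sHG _ hH.
    rewrite -gv -[g]invgK e invMg form_actM ?GG ?groupV //.
    by have := bB; rewrite -groupV inB ?groupV // => /eqP ->.
  move=> v v' vM v'M; have [h hH hv] := orb v vM; have [h' h'H h'v] := orb v' v'M.
  have hG := subsetP sHG _ hH; have h'G := subsetP sHG _ h'H.
  exists (h^-1 * h')%g; first by rewrite groupM ?groupV.
  by rewrite form_actM ?GG ?groupV // -hv form_actVK ?GG.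
apply/eqP; rewrite eqEsubset mul_subG // andbT; apply/subsetP=> g gG.
have vM : form_act v0 (g^-1)%g \in minus_set.
  by apply: form_act_minus_set base_minus_set; rewrite groupV GG.
have [h hH hv] := trH _ _ base_minus_set vM.
have hG := subsetP sHG _ hH.
apply/mulsgP; exists (h^-1)%g (h * g)%g; rewrite ?groupV ?mulKg //.
rewrite inB ?groupM // form_actM ?GG // hv.
by rewrite -{2}[g]invgK form_actVK // groupV GG.
Qed.

Lemma form_transitiveJ (H : {group {perm V}}) g : g \in GammaSp -> H \subset GammaSp ->
  form_transitive (H :^ g)%g -> form_transitive H.
Proof.
move=> gG sHG trH v v' vM v'M.
have [h /imsetP[k kH ->] e] := trH _ _ (form_act_minus_set gG vM) (form_act_minus_set gG v'M).
have kG := subsetP sHG _ kH; exists k => //.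
move: e; rewrite conjgE !form_actM ?groupM ?groupV // form_actVK // => e.
by rewrite -(form_actVK f0 m0 hKq (form_act v k) gG) e form_actVK.
Qed.

End BaseForm.

End MinusStabilizer.

(** * Invariant groups of shears *)

Section ShearModules.

Variables (K : finFieldType) (f m : nat).
Hypotheses (f0 : (0 < f)%N) (m2 : (2 <= m)%N) (hKq : #|K| = ((2 ^ f) ^ m)%N).
Local Notation q := (2 ^ f)%N.
Local Notation V := (K * K)%type.
Local Notation tr := (trq q m).
Let m0 : (0 < m)%N := ltnW m2.
Implicit Types (u v : V) (g : {perm V}) (c d x y z : K) (h k : K -> K) (a : nat -> K).

Let hK := cardK2 hKq.
Let N0 : (0 < m * f)%N. Proof. by rewrite muln_gt0 m0 f0. Qed.
Let trD := trqD f0 hKq.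
Let addKK := addrr2 hK.
Let qm := powqm hKq.

(* The elements of M(i) are the mfun i c with mvalid i c. *)
Definition mfun (i : nat) c y : K :=
  if i == 0%N then c * y
  else if i.*2 == m then c * y ^+ (q ^ i)%N
  else c * y ^+ (q ^ i)%N - c ^+ (q ^ (m - i))%N * y ^+ (q ^ (m - i))%N.

Definition mvalid (i : nat) c : bool := (i.*2 == m) ==> (c ^+ (q ^ i)%N == c).

Lemma mvalid_fixed i c : mvalid i c -> (i.*2 == m) -> c ^+ (q ^ i)%N = c.
Proof. by move/implyP => h /h /eqP. Qed.

Lemma mfun_Mi i c : mvalid i c -> finfun (mfun i c) \in Mi K q m i.
Proof.
move=> vc; rewrite /Mi /mfun; case: ifP => i0; first by apply/imsetP; exists c.
case: ifP => im; last by apply/imsetP; exists c.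
by apply/imsetP; exists c; rewrite // inE (mvalid_fixed vc im) addKK.
Qed.

Lemma MiP i (h : {ffun K -> K}) :
  reflect (exists2 c, mvalid i c & h =1 mfun i c) (h \in Mi K q m i).
Proof.
apply: (iffP idP) => [|[c vc e]]; last first.
  by rewrite (_ : h = finfun (mfun i c)) ?mfun_Mi //; apply/ffunP=> y; rewrite ffunE e.
rewrite /Mi /mvalid /mfun; case: ifP => i0.
  case/imsetP=> c _ ->; exists c => [|y]; last by rewrite ffunE.
  by rewrite (eqP i0) /= eq_sym (gtn_eqF m0).
case: ifP => im; case/imsetP=> c; rewrite ?inE => ce ->.
  exists c => [|y]; last by rewrite ffunE.
  by move: ce; rewrite (addr2_eq0 hK) eq_sym.
by exists c => [|y] //; rewrite ffunE.
Qed.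

Lemma Ui_P i g : reflect (exists2 c, mvalid i c & g = shear (mfun i c)) (g \in Ui K q m i).
Proof.
apply: (iffP imsetP) => [[h /MiP[c vc e] ->]|[c vc ->]].
  by exists c => //; apply: eq_shear.
by exists (finfun (mfun i c)); [exact: mfun_Mi | apply: eq_shear => y; rewrite ffunE].
Qed.

Lemma mfun0 i y : mfun i 0 y = 0.
Proof.
by rewrite /mfun; case: ifP => _; [|case: ifP => _]; rewrite ?expr0n ?expn_eq0 ?mul0r ?subrr //= mul0r subr0.
Qed.

Lemma mfunDl i c d y : mfun i (c + d) y = mfun i c y + mfun i d y.
Proof.
rewrite /mfun; case: ifP => _; [|case: ifP => _]; rewrite ?(powqD hKq); ring.
Qed.

(** Conjugation by the Singer group thus acts on the coefficients of U(i) by the powers of exponent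
    1 + q^i. *)
Lemma mfun_scale i c x y : (i <= m)%N ->
  x * mfun i c (x * y) = mfun i (c * x ^+ (1 + q ^ i)%N) y.
Proof.
move=> im; rewrite /mfun; case: ifP => [/eqP ->|_].
  by rewrite expn0 addn1 expr2; ring.
case: ifP => _; rewrite !exprMn exprD expr1; first by ring.
rewrite !exprMn (powq_powq _ i) subnKC // qm; ring.
Qed.

Lemma mvalid_mul i c d : mvalid i c -> mvalid i d -> mvalid i (c * d).
Proof.
rewrite /mvalid => /implyP vc /implyP vd; apply/implyP=> im; rewrite exprMn.
by rewrite (eqP (vc im)) (eqP (vd im)).
Qed.

Lemma mvalid_inv i c : mvalid i c -> mvalid i c^-1.
Proof.
by rewrite /mvalid => /implyP vc; apply/implyP=> im; rewrite exprVn (eqP (vc im)).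
Qed.

Lemma mvalid0 i : mvalid i 0.
Proof. by rewrite /mvalid expr0n !expn_eq0 /= eqxx implybT. Qed.

Lemma symmetric_qmap_coef h : symmetric_qmap f m h ->
  exists2 a, h =1 qpoly f m a &
    forall k : nat, (0 < k < m)%N -> a k = a (m - k)%N ^+ (q ^ k)%N.
Proof.
case=> hD hZ hS; have [a ha] := qlinear_qpoly f0 m0 hKq hD hZ.
exists a => // k /andP[k0 km].
(* These are the coefficients of the adjoint of [h] for the trace form. *)
pose b (i : nat) := if i == 0%N then a 0%N else a (m - i)%N ^+ (q ^ i)%N.
suff e : qpoly f m a =1 qpoly f m b by rewrite (qpoly_inj f0 hKq e km) /b gtn_eqF.
move=> y; apply/eqP; rewrite -(addr2_eq0 hK); apply/eqP.
apply: (trq_nondeg f0 m0 hKq) => z; rewrite mulrDl trD -ha hS ha.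
suff -> : tr (qpoly f m a z * y) = tr (qpoly f m b y * z) by rewrite addKK.
rewrite /qpoly !mulr_suml !(trq_sum f0 hKq).
have head (F : nat -> K) : \sum_(i < m) F i = F 0%N + \sum_(i < m.-1) F i.+1.
  by move: m0; case: (m) => // l _; rewrite big_ord_recl.
rewrite (head (fun i => tr (a i * z ^+ (q ^ i)%N * y))).
rewrite (head (fun i => tr (b i * y ^+ (q ^ i)%N * z))) /b /= expn0 !expr1 mulrAC.
congr (_ + _); rewrite (reindex_inj rev_ord_inj) /=; apply: eq_bigr=> i _.
have im : (i.+1 <= m)%N by have := ltn_ord i; lia.
have -> : ((m.-1 - i.+1).+1 = m - i.+1)%N by have := ltn_ord i; lia.
rewrite -[LHS](trq_powq f0 m0 hKq i.+1) !exprMn powq_powq subnK // qm.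
by rewrite mulrAC.
Qed.

Lemma sum_mirror (F : nat -> K) :
  \sum_(i < m) F i = \sum_(i < (m./2).+1)
    (if (i == 0%N :> nat) || (i.*2 == m) then F i else F i + F (m - i)%N).
Proof.
pose G (i : nat) := if (i == 0%N) || (i.*2 == m) then 0 else F (m - i)%N.
transitivity (\sum_(i < (m./2).+1) F i + \sum_(i < (m./2).+1) G i); last first.
  by rewrite -big_split; apply: eq_bigr=> i _; rewrite /= /G; case: ifP; rewrite ?addr0.
have lem : ((m./2).+1 <= m)%N by move: m2; lia.
rewrite -(big_mkord predT) (@big_cat_nat _ _ _ (m./2).+1) //= big_mkord; congr (_ + _).
rewrite big_nat_rev -{1}[(m./2).+1]add0n big_addn big_mkord big_ord_recl {1}/G eqxx add0r.
transitivity (\sum_(i < m - (m./2).+1) F (m - i.+1)%N).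
  by apply: eq_bigr=> i _; congr F; have := ltn_ord i; lia.
have Gs (i : nat) : i.+1.*2 != m -> F (m - i.+1)%N = G i.+1 by rewrite /G => /negPf ->.
have [mo|me] := boolP (odd m).
  have -> : (m - (m./2).+1 = m./2)%N by move: mo; lia.
  apply: eq_bigr=> i _; rewrite Gs //.
  by apply: contraTneq mo => <-; rewrite odd_double.
have mE : m = (m./2).*2 by move: me; lia.
have [p ep] : exists p, m./2 = p.+1 by exists (m./2).-1; move: m2; lia.
have -> : (m - (m./2).+1 = p)%N by lia.
rewrite ep big_ord_recr {2}/G /= /bump add1n [in X in _ = _ + X]mE ep eqxx /= addr0.
by apply: eq_bigr=> i _; rewrite Gs // mE ep; have := ltn_ord i; lia.
Qed.

(** Self-adjointness ties the coefficient at m - i to the one at i, so pairing the two terms writes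
    [h] as a sum of elements of the M(i). *)
Lemma symmetric_qmap_sum h : symmetric_qmap f m h ->
  exists2 a, (forall i : nat, (i <= m./2)%N -> mvalid i (a i)) &
    h =1 (fun y => \sum_(i < (m./2).+1) mfun i (a i) y).
Proof.
move/symmetric_qmap_coef=> [a ha amir]; exists a => [i im|y].
  apply/implyP=> /eqP i2; have i0 : (0 < i)%N by rewrite lt0n; apply: contraTneq m2 => i0; rewrite -i2 i0.
  have im' : (i < m)%N by lia.
  by rewrite {2}amir ?i0 // -i2 -addnn addnK.
rewrite ha /qpoly (sum_mirror (fun i => a i * y ^+ (q ^ i)%N)).
apply: eq_bigr=> -[i /= im] _; rewrite /mfun.
case: (i =P 0%N) => [->|/eqP i0] /=; first by rewrite expn0 expr1.
case: ifP => // i2; rewrite (oppr2 hK); congr (_ + _ * _).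
have i0' : (0 < i)%N by rewrite lt0n.
by rewrite amir ?subKn //; lia.
Qed.

Lemma mfun_symmetric i c : (i <= m./2)%N -> mvalid i c -> symmetric_qmap f m (mfun i c).
Proof.
move=> im vc; split=> [x y|d y dF|y z].
- by rewrite /mfun; case: ifP => _; [|case: ifP => _]; rewrite ?(powqD hKq); ring.
- by rewrite /mfun; case: ifP => _; [|case: ifP => _]; rewrite ?exprMn ?(Fq_pow _ dF); ring.
rewrite /mfun; case: ifP => [_|/negbT i0]; first by congr tr; ring.
have mi : (i <= m)%N by lia.
case: ifP => i2.
  have im2 : (i + i = m)%N by rewrite addnn; apply/eqP.
  rewrite -(trq_powq f0 m0 hKq i (c * y ^+ _ * z)) !exprMn powq_powq im2 qm.
  by rewrite (mvalid_fixed vc i2); congr tr; ring.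
rewrite !(oppr2 hK) !mulrDl !trD [RHS]addrC; congr (_ + _).
  rewrite -(trq_powq f0 m0 hKq (m - i)%N (c * y ^+ _ * z)) !exprMn powq_powq.
  by rewrite subnKC // qm; congr tr; ring.
rewrite -(trq_powq f0 m0 hKq (m - i)%N (c * z ^+ _ * y)) !exprMn powq_powq.
by rewrite subnKC // qm; congr tr; ring.
Qed.

Lemma mem_UI (I : {set 'I_(m./2).+1}) (a : 'I_(m./2).+1 -> K) :
  (forall i, i \in I -> mvalid i (a i)) ->
  shear (fun y => \sum_(i in I) mfun i (a i) y) \in UI K q I.
Proof.
move=> va; have -> : shear (fun y => \sum_(i in I) mfun i (a i) y) =
    (\prod_(i in I) shear (mfun i (a i)))%g.
  pose F (r : seq 'I_(m./2).+1) :=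
    shear (fun y => \sum_(i <- r | i \in I) mfun i (a i) y).
  suff prodE r : F r = (\prod_(i <- r | i \in I) shear (mfun i (a i)))%g by exact: prodE.
  rewrite /F; elim: r => [|i r IH].
    by rewrite big_nil -shear0; apply: eq_shear => y; rewrite big_nil.
  rewrite big_cons; case: ifP => iI; last first.
    by rewrite -IH; apply: eq_shear => y; rewrite big_cons iI.
  by rewrite -IH shearM; apply: eq_shear => y; rewrite big_cons iI.
apply: mem_prodg => i iI; apply/Ui_P; exists (a i) => //; exact: va.
Qed.

Lemma Ui_sub_UI (I : {set 'I_(m./2).+1}) (i : 'I_(m./2).+1) :
  i \in I -> Ui K q m i \subset UI K q I.
Proof.
move=> iI; apply/subsetP=> _ /Ui_P[c vc ->].
have := @mem_UI I (fun j => if j == i then c else 0).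
rewrite (eq_shear (k := mfun i c)) => [|y].
  by apply=> j jI; case: eqP => [->|_] //; exact: mvalid0.
rewrite (bigD1 i) //= eqxx big1 ?addr0 // => j /andP[_ /negPf ->].
exact: mfun0.
Qed.

Section InvariantSubgroup.

(** In the application [gam] is the inverse of the scalar of a generator of C, and [t] is the index
    of C in the Singer group; by [shear_ellJ], conjugation by this generator turns h into
    [gam * h (gam * y)]. *)
Variables (t : nat) (gam : K) (N : {group {perm V}}).
Hypotheses (nex : ~~ ((m == 6%N) && (f == 1%N))) (nex2 : ~~ ((m == 2%N) && (f == 1%N)))
  (tN : (t %| m * f)%N) (tM : (t %| 2 ^ (m * f) - 1)%N)
  (gam_ord : forall i j, gam ^+ i = gam ^+ j -> i = j %[mod (2 ^ (m * f) - 1) %/ t]).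

Let g (i : nat) := gam ^+ (1 + q ^ i)%N.

Let g_pow i j : g i ^+ (2 ^ j)%N = gam ^+ (shear_exponent f i j).
Proof. by rewrite /g -exprM /shear_exponent mulnC expnM. Qed.

Lemma twisted_pow_inj (i i' j j' : nat) : (i <= m./2)%N -> (i' <= m./2)%N ->
  (j < Frobenius_period f m i)%N -> (j' < Frobenius_period f m i')%N ->
  g i ^+ (2 ^ j)%N = g i' ^+ (2 ^ j')%N -> i = i' /\ j = j'.
Proof.
move=> im i'm jP j'P; rewrite !g_pow => /gam_ord.
exact: shear_exponent_inj.
Qed.

(** If [g i] were 1 it would equal its own square, against [twisted_pow_inj] once the period exceeds
    1. A period of 1 occurs only for m = 2, f = 1. *)
Lemma twisted_pow_neq1 (i : nat) : (i <= m./2)%N -> g i != 1.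
Proof.
move=> im; apply/eqP=> g1; have per2 : (1 < Frobenius_period f m i)%N.
  rewrite /Frobenius_period; case: ifP => [/eqP i2|_]; last by move: m2 f0; nia.
  suff : (4 <= m * f)%N by lia.
  have [m2'|m2'] := eqVneq m 2%N; first by move: nex2 f0; rewrite m2' /=; lia.
  have m4 : (4 <= m)%N by move: m2 m2'; lia.
  by apply: leq_trans m4 _; rewrite leq_pmulr.
have [] := @twisted_pow_inj i i 0 1 im im (ltnW per2) per2; rewrite // !g1 !expr1n //.
Qed.

Lemma twisted_pow_period (i : nat) : (i <= m./2)%N ->
  g i ^+ (2 ^ Frobenius_period f m i)%N = g i.
Proof.
move=> im; rewrite /Frobenius_period; case: ifP => [/eqP i2|_]; last exact: pow2_card hK _.
have -> : ((m * f)./2 = f * i)%N by rewrite -i2 -doubleMl doubleK mulnC.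
rewrite expnM /g -exprM mulnDl mul1n -expnD addnn i2 exprD qm.
by rewrite exprD expr1 mulrC.
Qed.

Lemma centralizing_shear_trivial h : symmetric_qmap f m h ->
  (forall y, gam * h (gam * y) = h y) -> h =1 (fun=> 0).
Proof.
move=> hS hc; have [a ha amir] := symmetric_qmap_coef hS.
have e (k : nat) : (k < m)%N -> a k * g k = a k.
  move=> km; suff e : qpoly f m (fun i : nat => a i * g i) =1 qpoly f m a.
    exact: (qpoly_inj f0 hKq e km).
  move=> y.
  rewrite -ha -hc ha /qpoly mulr_sumr; apply: eq_bigr=> i _.
  by rewrite exprMn /g exprD expr1; ring.
have a0 (k : nat) : (k <= m./2)%N -> a k = 0.
  move=> km; have km' : (k < m)%N by move: m2; lia.
  have := e k km'; rewrite -[RHS]mulr1 => e1; apply/eqP/negPn/negP=> ak.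
  by case/negP: (twisted_pow_neq1 km); rewrite (mulfI ak e1).
move=> y; rewrite ha /qpoly big1 // => -[k /= km] _.
have [le|gt] := leqP k m./2; first by rewrite a0 ?mul0r.
rewrite amir ?(leq_ltn_trans (leq0n _) gt) // a0; last by lia.
by rewrite expr0n !expn_eq0 /= mul0r.
Qed.

Hypotheses (Nsym : forall n, n \in N -> exists2 h, symmetric_qmap f m h & n = shear h)
  (Ninv : forall h, shear h \in N -> shear (fun y => gam * h (gam * y)) \in N).

(** Polynomials over the prime field in the operator [gam] preserve [N]. By [orbit_eval_surj] one of
    them kills all components of [h] but the i-th and sends that coefficient to any prescribed
    [b]. *)
Lemma invariant_subgroup_component h (a : nat -> K) :
  shear h \in N -> h =1 (fun y => \sum_(i < (m./2).+1) mfun i (a i) y) ->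
  (forall i : nat, (i <= m./2)%N -> mvalid i (a i)) ->
  forall i : 'I_(m./2).+1, a i != 0 -> Ui K q m i \subset N.
Proof.
move=> hN ha va i ai0; apply/subsetP=> _ /Ui_P[b vb ->].
have period_fixed (j : nat) c : (j <= m./2)%N -> mvalid j c -> c ^+ (2 ^ Frobenius_period f m j)%N = c.
  move=> jm vc; rewrite /Frobenius_period; case: ifP => [j2|_]; last exact: pow2_card hK _.
  have -> : ((m * f)./2 = f * j)%N by rewrite -(eqP j2) -doubleMl doubleK mulnC.
  by rewrite expnM (mvalid_fixed vc).
have ile (j : 'I_(m./2).+1) : (j <= m./2)%N by rewrite -ltnS.
(* The value [b / a i] is admissible because for 2 i = m both coefficients lie in the subfield fixed
   by the period. *)
pose al (j : 'I_(m./2).+1) := if j == i then b / a i else 0.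
have [M [p pal]] : exists M (p : 'I_M -> bool),
    forall j : 'I_(m./2).+1, \sum_(k < M) (p k)%:R * g j ^+ k = al j.
  apply: (orbit_eval_surj hK (per := fun j : 'I_(m./2).+1 => Frobenius_period f m j)).
  - move=> j; rewrite /Frobenius_period; case: ifP => _; last by rewrite N0.
    by move: m2 f0; nia.
  - by move=> j j' k k' kP k'P /(twisted_pow_inj (ile j) (ile j') kP k'P)[/val_inj-> ->].
  - by move=> j; exact: twisted_pow_period.
  - move=> j; rewrite /al; case: eqP => [->|_]; last by rewrite expr0n expn_eq0.
    by apply: period_fixed (ile i) _; rewrite mvalid_mul // mvalid_inv // va.
pose hk (k : nat) y := gam ^+ k * h (gam ^+ k * y).
have hkN (k : nat) : shear (hk k) \in N.
  elim: k => [|k IH].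
    by rewrite (eq_shear (k := h)) // => y; rewrite /hk expr0 !mul1r.
  rewrite (eq_shear (k := fun y => gam * hk k (gam * y))) ?Ninv // => y.
  by rewrite /hk mulrA -exprS; congr (_ * h _); rewrite mulrA -exprSr.
have hkE (k : nat) y : hk k y = \sum_(j < (m./2).+1) mfun j (a j * g j ^+ k) y.
  rewrite /hk ha mulr_sumr; apply: eq_bigr=> j _; rewrite mfun_scale; last first.
    by have := ile j; lia.
  by rewrite /g -exprM -exprM (mulnC k).
pose S (r : seq 'I_M) y := \sum_(k <- r | p k) hk k y.
have SN r : shear (S r) \in N.
  elim: r => [|k r IH].
    rewrite (eq_shear (k := fun=> 0)) ?shear0 ?group1 // => y.
    by rewrite /S big_nil.
  case pk : (p k); last first.
    by rewrite (eq_shear (k := S r)) // => y; rewrite /S big_cons pk.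
  rewrite (eq_shear (k := fun y => hk k y + S r y)); last by move=> y; rewrite /S big_cons pk.
  by rewrite -shearM (groupM (hkN _) IH).
have -> : shear (mfun i b) = shear (S (index_enum _)); last exact: SN.
apply: eq_shear => y; rewrite /S.
transitivity (\sum_(j < (m./2).+1) mfun j (a j * al j) y).
  rewrite (bigD1 i) //= /al eqxx mulrC divfK // big1 ?addr0 // => j /negPf ->.
  by rewrite mulr0 mfun0.
under [RHS]eq_bigr do rewrite hkE.
rewrite exchange_big /=; apply: eq_bigr=> j _; rewrite -pal mulr_sumr.
have mfunD : {morph (fun c => mfun j c y) : c d / c + d} by move=> c d; exact: mfunDl.
rewrite (big_morph _ mfunD (mfun0 j y)) [RHS]big_mkcond /=; apply: eq_bigr=> k _.
by case: (p k); rewrite ?mul1r // mul0r mulr0 mfun0.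
Qed.

Lemma invariant_subgroup_UI : exists I : {set 'I_(m./2).+1}, N :=: UI K q I.
Proof.
exists [set i : 'I_(m./2).+1 | Ui K q m i \subset N].
apply/eqP; rewrite eqEsubset; apply/andP; split; last first.
  rewrite /UI; elim/big_rec: _ => [|i A iI sA]; first by rewrite sub1G.
  by apply: mul_subG sA; move: iI; rewrite inE.
apply/subsetP=> n nN; have [h hS eh] := Nsym nN; rewrite eh in nN *.
have [a va ha] := symmetric_qmap_sum hS.
have va' (i : 'I_(m./2).+1) : mvalid i (a i) by apply: va; rewrite -ltnS.
rewrite (eq_shear (k := fun y => \sum_(i in [set i : 'I_(m./2).+1 | Ui K q m i \subset N]) mfun i (a i) y)).
  by apply: mem_UI => i _.
move=> y; rewrite ha [RHS]big_mkcond /=; apply: eq_bigr=> i _; rewrite inE.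
case: ifPn => // ni; have [->|ai0] := eqVneq (a i) 0; first exact: mfun0.
by case/negP: ni; apply: invariant_subgroup_component nN ha va i ai0.
Qed.

End InvariantSubgroup.

End ShearModules.

(** * The group GammaL1 *)

Section OneDimensionalGroup.

Variables (K : finFieldType) (f m : nat) (omega : {unit K}).
Hypotheses (f0 : (0 < f)%N) (m2 : (2 <= m)%N) (hKq : #|K| = ((2 ^ f) ^ m)%N)
  (homega : generator [set: {unit K}] omega).
Local Notation q := (2 ^ f)%N.
Local Notation V := (K * K)%type.
Let m0 : (0 < m)%N := ltnW m2.
Local Notation GammaSp := (GammaSp K q m).
Local Notation form_act := (form_act f0 m0 hKq).
Implicit Types (u v : V) (t : {perm V}) (w : {unit K}) (a b c x y z : K).

Let hK := cardK2 hKq.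
Let N2 : (1 < m * f)%N. Proof. by move: m2 f0; nia. Qed.
Let N0 : (0 < m * f)%N := ltnW N2.

Let T : {group {perm V}} := <<[set ell omega; frob K]>>%G.
Let S0 : {group {perm V}} := <[ell omega]>%G.

Definition tmap a (j : nat) v : V := (a^-1 * v.1 ^+ (2 ^ j)%N, a * v.2 ^+ (2 ^ j)%N).

Lemma val_unit_neq0 w : val w != 0.
Proof. by rewrite -unitfE; exact: valP w. Qed.

Lemma ellM w w' : ell (w * w')%g = (ell w * ell w')%g.
Proof.
apply/permP=> v; rewrite permM !ellE [val (w * w')%g]/(val w * val w') /=.
by rewrite invfM !mulrA (mulrC (val w')^-1) (mulrC (val w')).
Qed.

Lemma ell1 : ell (1%g : {unit K}) = 1%g.
Proof. by apply: (mulgI (ell (1%g : {unit K}))); rewrite -ellM mulg1 mulg1. Qed.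

Lemma ellX w (i : nat) : ell (w ^+ i)%g = (ell w ^+ i)%g.
Proof. by elim: i => [|i IH]; rewrite ?expg0 ?ell1 // !expgS ellM IH. Qed.

Lemma ell_inj : injective (@ell K).
Proof.
move=> w w' e; apply: val_inj; have := congr1 (fun t : {perm V} => (t (0, 1)).2) e.
by rewrite !ellE /= !mulr1.
Qed.

Lemma SingerP t : reflect (exists w, t = ell w) (t \in S0).
Proof.
apply: (iffP idP) => [/cycleP[i ->]|[w ->]]; first by exists (omega ^+ i)%g; rewrite ellX.
apply/cycleP; have /cycleP[i ->] : w \in <[omega]>%g by rewrite -(eqP homega) inE.
by exists i; rewrite ellX.
Qed.

Lemma card_Singer : #|S0| = (2 ^ (m * f) - 1)%N.
Proof.
have -> : #|S0| = #|[set ell w | w : {unit K}]|.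
  apply: eq_card => t; apply/SingerP/imsetP=> [[w ->]|[w _ ->]]; first by exists w.
  by exists w.
rewrite (card_imset _ ell_inj) -cardsT -hK card_finField_unit subn1 //.
Qed.

Lemma frobX (i : nat) v : (frob K ^+ i)%g v = (v.1 ^+ (2 ^ i)%N, v.2 ^+ (2 ^ i)%N).
Proof.
elim: i v => [|i IH] v; first by rewrite expg0 perm1 !expr1; case: v.
by rewrite expgSr permM IH (frobE hKq) /= -!exprM -!expnSr.
Qed.

Lemma tmap_comp a b (i j : nat) v : tmap b j (tmap a i v) = tmap (b * a ^+ (2 ^ j)%N) (i + j) v.
Proof.
by rewrite /tmap /= !exprMn exprVn invfM -!exprM -!expnD !mulrA.
Qed.

Lemma tmap_modn a (j : nat) v : tmap a (j %% (m * f)) v = tmap a j v.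
Proof. by rewrite /tmap !(pow2_modn hK). Qed.

(** The Frobenius map has order m f, so the bound on j loses nothing and makes the condition
    decidable. *)
Definition monomial_perms : {set {perm V}} :=
  [set t : {perm V} | [exists a : K, [exists j : 'I_(m * f),
     (a != 0) && [forall v, t v == tmap a j v]]]].

Lemma monomial_permsP t : reflect (exists a, exists j : nat, a != 0 /\ forall v, t v = tmap a j v)
  (t \in monomial_perms).
Proof.
rewrite inE; apply: (iffP existsP) => [[a /existsP[j /andP[a0 /forallP e]]]|[a [j [a0 e]]]].
  by exists a, j; split=> // v; apply/eqP.
exists a; apply/existsP; exists (Ordinal (ltn_pmod j N0)); rewrite a0.
by apply/forallP=> v; rewrite e tmap_modn.
Qed.

Lemma monomial_perms_group_set : group_set monomial_perms.
Proof.
apply/group_setP; split=> [|s t /monomial_permsP[a [i [a0 ea]]] /monomial_permsP[b [j [b0 eb]]]].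
  apply/monomial_permsP; exists 1, 0%N; split=> [|v]; first exact: oner_neq0.
  by rewrite perm1 /tmap invr1 !mul1r !expr1; case: v.
apply/monomial_permsP; exists (b * a ^+ (2 ^ j)%N), (i + j)%N.
by split=> [|v]; [rewrite mulf_neq0 ?expf_neq0 | rewrite permM ea eb tmap_comp].
Qed.

Canonical monomial_perms_group := Group monomial_perms_group_set.

Lemma frob_ell_tmap w (j : nat) v : (frob K ^+ j * ell w)%g v = tmap (val w) j v.
Proof. by rewrite permM frobX ellE. Qed.

Lemma GammaL1E : T :=: monomial_perms.
Proof.
apply/eqP; rewrite eqEsubset gen_subG; apply/andP; split.
  apply/subsetP=> t; rewrite !inE => /orP[]/eqP->; apply/existsP.
    exists (val omega); apply/existsP; exists (Ordinal N0); rewrite val_unit_neq0.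
    by apply/forallP=> v; rewrite ellE /tmap !expr1.
  exists 1; apply/existsP; exists (Ordinal N2); rewrite oner_neq0.
  by apply/forallP=> v; rewrite (frobE hKq) /tmap invr1 !mul1r.
apply/subsetP=> t /monomial_permsP[a [j [a0 e]]].
have ua : a \is a GRing.unit by rewrite unitfE.
have -> : t = (frob K ^+ j * ell (FinRing.unit K ua))%g.
  by apply/permP=> v; rewrite frob_ell_tmap e.
have fT : frob K \in T by rewrite mem_gen // !inE eqxx orbT.
have lT : ell omega \in T by rewrite mem_gen // !inE eqxx.
rewrite groupM ?groupX //; apply: (subsetP (_ : S0 \subset T)); first by rewrite cycle_subG.
by apply/SingerP; exists (FinRing.unit K ua).
Qed.

Lemma mem_GammaL1P t : reflect (exists a, exists j : nat, a != 0 /\ forall v, t v = tmap a j v)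
  (t \in GammaL1 omega).
Proof. by rewrite -[GammaL1 omega]/(gval T) GammaL1E; exact: monomial_permsP. Qed.

Lemma GammaL1_decomposition t : t \in T ->
  exists w, exists j : nat, t = (frob K ^+ j * ell w)%g /\ forall v, t v = tmap (val w) j v.
Proof.
rewrite GammaL1E => /monomial_permsP[a [j [a0 e]]].
have ua : a \is a GRing.unit by rewrite unitfE.
exists (FinRing.unit K ua), j; split=> //.
by apply/permP=> v; rewrite frob_ell_tmap e.
Qed.

Lemma GammaL1_GammaSp : T \subset GammaSp.
Proof.
rewrite gen_subG; apply/subsetP=> t /set2P[]->.
  exact: ell_GammaSp.
exact: frob_GammaSp.
Qed.

Lemma tmap_stabU t a (j : nat) : a != 0 -> (forall v, t v = tmap a j v) -> stabU t.
Proof.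
by move=> a0 e v; rewrite e /= mulf_eq0 (negPf a0) expf_eq0 expn_gt0.
Qed.

Lemma tmap_wmap t a (j : nat) : t \in GammaSp -> a != 0 -> (forall v, t v = tmap a j v) ->
  forall y, wmap t y = a * y ^+ (2 ^ j)%N.
Proof.
move=> tG a0 e y; rewrite (wmapE f0 m0 hKq tG (tmap_stabU a0 e)) e /=.
by [].
Qed.

Lemma form_act_GammaL1 t v : t \in T -> form_act v t = t v.
Proof.
move=> tT; have [w [j [_ e]]] := GammaL1_decomposition tT.
apply: form_act_diagonal => [|x|y]; first exact: subsetP GammaL1_GammaSp _ tT.
  by rewrite e /tmap /= expr0n expn_eq0 mulr0.
by rewrite e /tmap /= expr0n expn_eq0 mulr0.
Qed.

Lemma ell_tmapJ t a (j : nat) w : t \in T -> (forall v, t v = tmap a j v) -> a != 0 ->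
  (ell w ^ t)%g = ell (w ^+ (2 ^ j))%g.
Proof.
move=> tT e a0; apply/permP=> v; rewrite -{1}(permKV t v) permJ.
set u := (t^-1)%g v; have -> : v = t u by rewrite permKV.
rewrite !e ellE /tmap !ellE /= FinRing.val_unitX !exprMn exprVn /=.
by congr (_, _); rewrite mulrCA.
Qed.

Lemma Singer_normal : S0 <| T.
Proof.
rewrite /normal cycle_subG mem_gen ?inE ?eqxx //=.
apply/subsetP=> t tT; have [w [j [_ e]]] := GammaL1_decomposition tT.
rewrite inE; apply/subsetP=> _ /imsetP[s /SingerP[w' ->] ->].
by apply/SingerP; exists (w' ^+ (2 ^ j))%g; rewrite (ell_tmapJ _ tT e) ?val_unit_neq0.
Qed.

Lemma frob_mem_T : frob K \in T. Proof. by rewrite mem_gen // !inE eqxx orbT. Qed.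

Lemma GammaL1_quotient : (T / S0 = <[coset S0 (frob K)]>)%g.
Proof.
have fN := subsetP (normal_norm Singer_normal) _ frob_mem_T.
apply/eqP; rewrite eqEsubset cycle_subG mem_quotient ?frob_mem_T // andbT.
apply/subsetP=> _ /morphimP[s sN sT ->]; have [w [i [-> _]]] := GammaL1_decomposition sT.
have wS : ell w \in S0 by apply/SingerP; exists w.
by rewrite /= coset_kerr // morphX // mem_cycle.
Qed.

Section Parity.

Variable c : K.
Hypotheses (c4 : c ^+ 4 = c) (c2 : c ^+ 2 != c).

Lemma order3_pow (j : nat) : c ^+ (2 ^ j)%N = if odd j then c ^+ 2 else c.
Proof.
elim: j => [|j IH]; first by rewrite expr1.
by rewrite expnSr exprM IH /=; case: (odd j); rewrite //= -exprM c4.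
Qed.

(* c generates the field of order 4; even_part consists of the elements of T
   whose field automorphism is trivial on it. *)
Definition even_part : {set {perm V}} := [set t in T | (t (0, c)).2 == c * (t (0, 1)).2].

Lemma tmap_even t a (j : nat) : t \in T -> a != 0 -> (forall v, t v = tmap a j v) ->
  (t \in even_part) = ~~ odd j.
Proof.
move=> tT a0 e; rewrite inE tT !e /= expr1n mulr1 (mulrC c) (inj_eq (mulfI a0)) order3_pow.
by case: (odd j) => /=; rewrite ?eqxx // (negPf c2).
Qed.

Lemma even_partM s t : s \in T -> t \in T ->
  ((s * t)%g \in even_part) = ((s \in even_part) == (t \in even_part)).
Proof.
move=> sT tT; have [w [i [_ es]]] := GammaL1_decomposition sT.
have [w' [j [_ et]]] := GammaL1_decomposition tT.
have e v : (s * t)%g v = tmap (val w' * val w ^+ (2 ^ j)%N) (i + j) v.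
  by rewrite permM es et tmap_comp.
rewrite (tmap_even (groupM sT tT) _ e) ?mulf_neq0 ?expf_neq0 ?val_unit_neq0 // oddD.
rewrite (tmap_even sT _ es) ?val_unit_neq0 // (tmap_even tT _ et) ?val_unit_neq0 //.
by case: (odd i); case: (odd j).
Qed.

Lemma even_part_group_set : group_set even_part.
Proof.
apply/group_setP; split=> [|s t sE tE].
  by rewrite inE group1 !perm1 /= mulr1.
have sT : s \in T by move: sE; rewrite inE => /andP[].
have tT : t \in T by move: tE; rewrite inE => /andP[].
by rewrite even_partM // sE tE.
Qed.

Let T1 : {group {perm V}} := Group even_part_group_set.

Lemma even_part_sub : T1 \subset T.
Proof. by apply/subsetP=> t; rewrite inE => /andP[]. Qed.

Lemma card_even_part (S : {group {perm V}}) t : S \subset T -> t \in S -> t \notin T1 ->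
  #|S| = (#|S :&: T1| * 2)%N.
Proof.
move=> sST tS tE; have tT := subsetP sST _ tS.
have eD : S :\: T1 = (S :&: T1) :* t.
  apply/setP=> s; rewrite mem_rcoset in_setD in_setI groupMr ?groupV //.
  have [sS|] := boolP (s \in S); rewrite ?andbF // andbT /=.
  have sT := subsetP sST _ sS.
  have := even_partM (groupM sT (groupVr tT)) tT; rewrite mulgKV.
  by rewrite -![_ \in even_part]/(_ \in T1) (negPf tE) eqbF_neg => ->; rewrite negbK.
by rewrite -(cardsID T1 S) eD card_rcoset muln2 addnn.
Qed.

Lemma frob_notin_even_part : frob K \notin T1.
Proof.
rewrite (tmap_even (a := 1) (j := 1) frob_mem_T) ?oner_neq0 // => v.
by rewrite (frobE hKq) /tmap invr1 !mul1r.
Qed.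

(** The even part has index 2 in T and contains S_0. If S lies in it, so does S S_0, and the index
    is even. Otherwise S S_0 / S_0 contains an odd power of the Frobenius generator of the cyclic
    group T / S_0, so its index divides an odd number. *)
Lemma odd_index_even_part (S : {group {perm V}}) : S \subset T ->
  odd (#|T| %/ #|(S * S0)%g|) = ~~ (S \subset T1).
Proof.
move=> sST; have nS0 := normal_norm Singer_normal; have sS0T := normal_sub Singer_normal.
have eX : (S * S0)%g = (S <*> S0)%G :> {set _}.
  by rewrite /= norm_joinEl // (subset_trans sST).
have S0T1 : S0 \subset T1.
  apply/subsetP=> _ /SingerP[w ->]; have wT : ell w \in T.
    by apply: (subsetP sS0T); apply/SingerP; exists w.
  rewrite (tmap_even (a := val w) (j := 0) wT) ?val_unit_neq0 // => v.
  by rewrite ellE /tmap !expr1.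
have sXT : (S <*> S0)%G \subset T by rewrite join_subG sST.
rewrite eX; have [ST1|/subsetPn[t tS tT1]] := boolP (S \subset T1).
  have sX1 : (S <*> S0)%G \subset T1 by rewrite join_subG ST1.
  rewrite (card_even_part (subxx T) frob_mem_T frob_notin_even_part).
  by rewrite (setIidPr even_part_sub) -(Lagrange sX1) -mulnA mulKn ?cardG_gt0 // oddM andbF.
have tT := subsetP sST _ tS; have [w [j [et e]]] := GammaL1_decomposition tT.
have oj : odd j.
  by move: tT1; rewrite (tmap_even tT _ e) ?val_unit_neq0 // negbK.
rewrite divgS // -(index_quotient_eq _ sXT nS0); last first.
  by apply: subIset; rewrite joing_subr orbT.
have sub : (<[coset S0 (frob K) ^+ j]> \subset (S <*> S0) / S0)%g.
  have wS : ell w \in S0 by apply/SingerP; exists w.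
  have fN : frob K \in 'N(S0) by rewrite (subsetP nS0) ?frob_mem_T.
  rewrite cycle_subG -morphX // mem_quotient //.
  rewrite -(mulgK (ell w) (frob K ^+ j)%g) -et groupM ?groupV //.
    by rewrite (subsetP (joing_subl _ _)).
  by rewrite (subsetP (joing_subr _ _)).
have sXT0 : ((S <*> S0) / S0 \subset <[coset S0 (frob K)]>)%g by rewrite -GammaL1_quotient quotientS.
rewrite GammaL1_quotient; apply: dvdn_odd oj; apply: dvdn_trans (indexgS _ sub) _.
rewrite -divgS ?cycle_subG ?mem_cycle // -!orderE orderXgcd.
set n := #[_]%g; have n0 : (0 < n)%N by exact: order_gt0.
by rewrite -{1}(divnK (dvdn_gcdl n j)) mulKn ?dvdn_gcdr // divn_gt0 ?gcdn_gt0 ?n0 // dvdn_leq ?dvdn_gcdl.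
Qed.

End Parity.

End OneDimensionalGroup.

(** * Orbits of shears *)

Section IndexGcd.

Variables (m : nat) (I : {set 'I_(m./2).+1}).
Hypothesis m0 : (0 < m)%N.

(** Both cases of [dI] agree with this: if m/2 belongs to I, a common divisor of the members of I
    divides m as well. *)
Lemma dvdn_dI (d : nat) :
  (d %| dI I)%N = (d %| m)%N && [forall i in I, (d %| i)%N].
Proof.
have eb : (d %| \big[gcdn/0%N]_(i in I | (0 < i)%N) (i : nat))%N = [forall i in I, (d %| i)%N].
  apply/idP/forall_inP => [db i iI|db]; last first.
    apply: (big_ind (fun e => d %| e)%N) => [|e e' de de'|i /andP[iI _]]; first exact: dvdn0.
      by rewrite dvdn_gcd de.
    exact: db.
  have [->|i0] := posnP i; first exact: dvdn0.
  by move: db; rewrite (bigD1 i) ?iI //= dvdn_gcd => /andP[].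
rewrite /dI; case: existsP => [[i /andP[iI /eqP e]]|_]; last by rewrite dvdn_gcd eb andbC.
rewrite eb andbC; case: forall_inP => //= db.
by rewrite -e -muln2 dvdn_mulr // db.
Qed.

Lemma dI_dvd : (dI I %| m)%N.
Proof. by have := dvdn_dI (dI I); rewrite dvdnn => /esym/andP[]. Qed.

Lemma dI_dvd_mem (i : 'I_(m./2).+1) : i \in I -> (dI I %| i)%N.
Proof. by have := dvdn_dI (dI I); rewrite dvdnn => /esym/andP[_ /forall_inP]; apply. Qed.

Lemma dI_gt0 : (0 < dI I)%N.
Proof. exact: dvdn_gt0 m0 dI_dvd. Qed.

End IndexGcd.

Section ShearOrbits.

Variables (K : finFieldType) (f m : nat).
Hypotheses (f0 : (0 < f)%N) (m2 : (2 <= m)%N) (hKq : #|K| = ((2 ^ f) ^ m)%N).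
Local Notation q := (2 ^ f)%N.
Local Notation V := (K * K)%type.
Let m0 : (0 < m)%N := ltnW m2.
Local Notation tr := (trq q m).
Local Notation GammaSp := (GammaSp K q m).
Local Notation form_act := (form_act f0 m0 hKq).
Implicit Types (u v : V) (g : {perm V}) (a b c e x y z : K) (i k l : nat).

Let hK := cardK2 hKq.
Let N0 : (0 < m * f)%N. Proof. by rewrite muln_gt0 m0. Qed.
Let qm x : x ^+ (q ^ m)%N = x. Proof. by rewrite -hKq expf_card. Qed.

(** An element of the fixed field of index 2 has relative trace x + x = 0, so additive Hilbert 90
    applies. *)
Lemma half_fixed_AS x : ~~ odd m -> x ^+ (q ^ m./2)%N = x -> exists e, x = e + e ^+ (q ^ m./2)%N.
Proof.
move=> om fx; have em : m = (m./2 * 2)%N by rewrite muln2 even_halfK.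
have h0 : (0 < m./2)%N by rewrite half_gt0.
have [e ->] : exists e, x = e + e ^+ (2 ^ (f * m./2))%N; last first.
  by exists e; rewrite expnM.
apply: (trk_ker N0 hK); first by rewrite muln_gt0 f0.
  by rewrite {2}em mulnC dvdn_pmul2r // dvdn_mulr.
rewrite /trk (_ : (m * f %/ (f * m./2) = 2)%N).
  by rewrite big_ord_recl big_ord1 /= muln0 muln1 expr1 expnM fx (addrr2 hK).
by rewrite {1}em mulnAC mulnC (mulnC _ f) mulnK // muln_gt0 f0.
Qed.

(** For 2 i different from m the two terms, multiplied by b, are conjugate. For 2 i = m the single
    term lies in the fixed field of index 2 and is split by [half_fixed_AS]. *)
Lemma mfun_product i c b : (0 < i)%N -> (i <= m./2)%N -> mvalid f m i c ->
  exists e, mfun f m i c b * b = e + e ^+ (q ^ (m - i))%N.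
Proof.
move=> i0 im; have im' : (i <= m)%N by lia.
rewrite /mvalid /mfun (gtn_eqF i0); case: (i.*2 =P m) => [e2 /= /eqP cF|_ _]; last first.
  exists (c * b ^+ (q ^ i)%N * b).
  rewrite mulrBl (oppr2 hK) !exprMn -exprM -expnD subnKC // qm.
  by congr (_ + _); rewrite mulrAC.
have [om ei] : ~~ odd m /\ i = m./2 by lia.
have -> : (m - i = m./2)%N by lia.
move: cF; rewrite ei => cF; apply: (half_fixed_AS om).
rewrite !exprMn cF -exprM -expnD (_ : (m./2 + m./2 = m)%N) ?qm; last by rewrite addnn even_halfK.
by rewrite mulrAC.
Qed.

Lemma mfun_product_surj i e b : (0 < i)%N -> (i <= m./2)%N -> b != 0 ->
  exists2 c, mvalid f m i c & mfun f m i c b * b = e + e ^+ (q ^ (m - i))%N.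
Proof.
move=> i0 im b0; have im' : (i <= m)%N by lia.
have bi : b ^+ (q ^ i)%N * b != 0 by rewrite mulf_neq0 ?expf_neq0.
rewrite /mvalid /mfun (gtn_eqF i0); case: (i.*2 =P m) => [e2|_]; last first.
  exists (e / (b ^+ (q ^ i)%N * b)) => //.
  have -> : e = e / (b ^+ (q ^ i)%N * b) * (b ^+ (q ^ i)%N * b) by rewrite divfK.
  rewrite mulfK //; set c := e / _; rewrite mulrBl (oppr2 hK) !exprMn -exprM -expnD subnKC // qm.
  by rewrite -!mulrA (mulrC b).
have [om ei] : ~~ odd m /\ i = m./2 by lia.
have -> : (m - i = i)%N by lia.
have ii : (i + i = m)%N by lia.
exists ((e + e ^+ (q ^ i)%N) / (b ^+ (q ^ i)%N * b)); last by rewrite -mulrA divfK.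
have powD x y : (x + y) ^+ (q ^ i)%N = x ^+ (q ^ i)%N + y ^+ (q ^ i)%N.
  by rewrite -expnM (pow2D hK).
rewrite /= exprMn exprVn exprMn powD -!exprM -expnD ii !qm.
by rewrite addrC (mulrC b).
Qed.

Lemma trq_mfun_product i c b : (0 < i)%N -> (i <= m./2)%N -> mvalid f m i c ->
  tr (mfun f m i c b * b) = 0.
Proof.
move=> i0 im cv; have [e ->] := mfun_product b i0 im cv.
by rewrite (trqE m f0) -expnM (trk_AS N0 hK) // dvdn_mull.
Qed.

(** For i > 0 the form Tr(h(y) z) is alternating, so the action has no translation part. *)
Lemma form_act_mfun i c v : (0 < i)%N -> (i <= m./2)%N -> mvalid f m i c ->
  form_act v (shear (mfun f m i c)) = (v.1 + mfun f m i c v.2, v.2).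
Proof.
move=> i0 im cv; rewrite (form_act_shear _ _ _ (s := 0)) ?addr0 //.
  exact: mfun_symmetric.
by move=> y; rewrite trq_mfun_product // mul0r (trq0 f0 hKq) expr0n.
Qed.

Lemma Ui_GammaSp i : (i <= m./2)%N -> Ui K q m i \subset GammaSp.
Proof.
move=> im; apply/subsetP=> g /(Ui_P m2 hKq)[c cv ->].
by apply: (subsetP (Sp_GammaSp f0 m0 hKq)); apply: shear_Sp => //; apply: mfun_symmetric.
Qed.

Lemma UI_ind (I : {set 'I_(m./2).+1}) (P : {perm V} -> Prop) :
  P 1%g -> (forall g g', P g -> P g' -> P (g * g')%g) ->
  (forall (i : 'I_(m./2).+1) g, i \in I -> g \in Ui K q m i -> P g) ->
  forall g, g \in UI K q I -> P g.
Proof.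
move=> P1 PM PU; rewrite /UI; apply: (big_ind (fun A : {set {perm V}} => forall g, g \in A -> P g)) => [g /set1P -> //|A A' PA PA' _ /mulsgP[g g' gA gA' ->]|i iI g].
  by apply: PM; [exact: PA | exact: PA'].
exact: PU iI.
Qed.

Lemma UI_GammaSp (I : {set 'I_(m./2).+1}) : UI K q I \subset GammaSp.
Proof.
apply/subsetP; apply: UI_ind => [|g g'|i g iI]; [exact: group1|exact: groupM|].
by apply: (subsetP (Ui_GammaSp _)); rewrite -ltnS.
Qed.

Lemma UI_trk (I : {set 'I_(m./2).+1}) g v : ord0 \notin I -> g \in UI K q I ->
  let v' := form_act v g in
  v'.2 = v.2 /\ trk (m * f) (f * dI I) (v'.1 * v'.2) = trk (m * f) (f * dI I) (v.1 * v.2).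
Proof.
move=> I0 gU /=.
(* Membership in [GammaSp] is carried through the induction because [form_actM] asks for it. *)
suff: g \in GammaSp /\ forall v, (form_act v g).2 = v.2 /\
    trk (m * f) (f * dI I) ((form_act v g).1 * (form_act v g).2) = trk (m * f) (f * dI I) (v.1 * v.2).
  by case=> _ /(_ v).
move: g gU {v}; apply: UI_ind => [|g g' [gG Pg] [g'G Pg']|i _ iI /(Ui_P m2 hKq)[c cv ->]].
- by split=> [|v]; [exact: group1 | rewrite form_act1].
- split=> [|v]; first exact: (groupM gG g'G).
  rewrite form_actM //; have [e1 e2] := Pg v; have [e3 e4] := Pg' (form_act v g).
  by rewrite e3 -e3 e4 e2 e3 e1.
have i0 : (0 < i)%N.
  by rewrite lt0n; apply: contraNneq I0 => e; rewrite -(_ : i = ord0) //; apply: val_inj.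
have im : (i <= m./2)%N by rewrite -ltnS.
split=> [|v].
  by apply: (subsetP (Ui_GammaSp im)); apply/(Ui_P m2 hKq); exists c.
rewrite form_act_mfun //=; split=> //.
have [e he] := mfun_product v.2 i0 im cv.
rewrite mulrDl he (trkD hK) -expnM.
have /dvdnP[s ->] : (f * dI I %| f * (m - i))%N.
  by rewrite dvdn_pmul2l // dvdn_sub ?dI_dvd ?dI_dvd_mem.
rewrite (mulnC s) (trk_AS N0 hK) ?addr0 ?muln_gt0 ?f0 ?dI_gt0 //.
by rewrite mulnC dvdn_pmul2r // dI_dvd.
Qed.

End ShearOrbits.

(** * Structure of transitive solvable subgroups *)

Section MonomialConjugate.

Variables (K : finFieldType) (f m : nat).
Hypotheses (f0 : (0 < f)%N) (m2 : (2 <= m)%N) (hKq : #|K| = ((2 ^ f) ^ m)%N).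
Local Notation q := (2 ^ f)%N.
Local Notation V := (K * K)%type.
Let m0 : (0 < m)%N := ltnW m2.
Local Notation Fq := (Fq K q).
Local Notation GammaSp := (GammaSp K q m).
Local Notation Sp := (Sp K q m).
Local Notation tauof := (tauof f0 m0 hKq).
Local Notation wmap := (@wmap K).
Implicit Types (u v : V) (g h : {perm V}) (a b c x y z : K).

Let hKn : #|K| = (2 ^ (m * f).-1.+1)%N. Proof. by rewrite (cardK2 hKq) prednK // muln_gt0 m0. Qed.

Definition Fq_scalars : {set {perm K}} :=
  [set s : {perm K} | [exists c in Fq, [forall y, s y == c * y]]].

Lemma Fq_scalarsP (s : {perm K}) :
  reflect (exists2 c, c \in Fq & forall y, s y = c * y) (s \in Fq_scalars).
Proof.
rewrite inE; apply: (iffP exists_inP) => -[c cF e]; exists c => //.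
  by move=> y; apply/eqP; apply: (forallP e).
by apply/forallP=> y; rewrite e.
Qed.

Lemma Fq_scalars_group_set : group_set Fq_scalars.
Proof.
apply/group_setP; split=> [|s t /Fq_scalarsP[c cF es] /Fq_scalarsP[d dF et]].
  by apply/Fq_scalarsP; exists 1 => [|y]; [exact: Fq1 | rewrite perm1 mul1r].
by apply/Fq_scalarsP; exists (d * c) => [|y]; [exact: FqM | rewrite permM es et mulrA].
Qed.

Canonical Fq_scalars_group := Group Fq_scalars_group_set.

Lemma Fq_scalars_abelian : abelian Fq_scalars_group.
Proof.
apply/centsP=> s /Fq_scalarsP[c cF es] t /Fq_scalarsP[d dF et].
by apply/permP=> y; rewrite !permM !es !et mulrCA.
Qed.

Lemma Fq_scalars_additive : Fq_scalars_group \subset additive_perms K.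
Proof.
apply/subsetP=> s /Fq_scalarsP[c cF es]; apply/additive_permsP=> x y /=.
by rewrite !es mulrDr.
Qed.

Section Transitive.

Variable H : {group {perm V}}.
Hypotheses (sHG : H \subset GammaSp) (HU : forall h, h \in H -> stabU h).

Let GS := subsetP sHG.

Lemma wmapM_in : {in H &, {morph wmap : h h' / (h * h')%g}}.
Proof. by move=> h h' hH h'H; rewrite (wmapM f0 m0 hKq) ?GS //; apply: HU. Qed.

Canonical wmap_morphism := Morphism wmapM_in.

Let A := (wmap_morphism @* H)%G.

Lemma wmap_imageP (s : {perm K}) : reflect (exists2 h, h \in H & s = wmap h) (s \in A).
Proof.
apply: (iffP morphimP) => [[h _ hH ->]|[h hH ->]]; first by exists h.
by exists h.
Qed.

Lemma wmap_image_norm : A \subset 'N(Fq_scalars_group).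
Proof.
apply/subsetP=> _ /wmap_imageP[h hH ->]; rewrite inE; apply/subsetP=> _ /imsetP[s /Fq_scalarsP[c cF es] ->].
have [[tF _ _ _] _] := GammaSpP f0 m0 hKq _ (GS hH).
apply/Fq_scalarsP; exists (tauof h c) => [|y]; first exact: tF.
by rewrite -{1}(permKV (wmap h) y) permJ es (wmapZ f0 m0 hKq (GS hH) (HU hH)) // permKV.
Qed.

Lemma wmap_image_additive : A \subset additive_perms K.
Proof.
by apply/subsetP=> _ /wmap_imageP[h hH ->]; exact: (wmap_additive f0 m0 hKq (GS hH) (HU hH)).
Qed.

Hypotheses (solH : solvable H) (trH : form_transitive f0 m2 hKq H).
Variable v0 : V.
Hypothesis v0M : v0 \in minus_set K f m.

Lemma wmap_transitive y y' : y != 0 -> y' != 0 -> exists2 h, h \in H & wmap h y = y'.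
Proof.
have mem z : z != 0 -> (v0.1 * v0.2 / z, z) \in minus_set K f m.
  by move=> z0; apply/minus_setP; rewrite /= divfK //; apply/minus_setP.
move=> y0 y'0; have [h hH e] := trH (mem y y0) (mem y' y'0); exists h => //.
by have := congr1 snd e; rewrite /= (form_act_snd f0 m0 hKq _ (GS hH) (HU hH)).
Qed.

(** The scalars of F_q are adjoined to the image of H before Huppert's theorem is applied, which
    makes [e] and with it [lam] linear over F_q. Only then does [levi_Sp] lift [lam] to an isometry
    of V. *)
Lemma monomial_conjugate : exists2 g, g \in Sp & stabU g /\
  forall h, h \in (H :^ g)%g -> exists b, exists j : nat, b != 0 /\ forall y, wmap h y = b * y ^+ (2 ^ j)%N.
Proof.
set Z := Fq_scalars_group; have nZA : A \subset 'N(Z) := wmap_image_norm.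
have nZ : Z <| (A <*> Z)%G by rewrite /= normalYr.
have sA : (A <*> Z)%G \subset additive_perms K.
  by rewrite join_subG wmap_image_additive Fq_scalars_additive.
have sol : solvable (A <*> Z)%G.
  rewrite (series_sol nZ) abelian_sol ?Fq_scalars_abelian //= quotientYidr //.
  by rewrite quotient_sol // morphim_sol.
have tr x y : x != 0 -> y != 0 -> exists2 s, s \in (A <*> Z)%G & s x = y.
  move=> x0 y0; have [h hH e] := wmap_transitive x0 y0; exists (wmap h) => //.
  by apply: (subsetP (joing_subl _ _)); apply/wmap_imageP; exists h.
have [e [eA nA sZ oe te]] := solvable_transitive_perm hKn sA sol tr nZ Fq_scalars_abelian.
(* Multiplication by a nonzero [c] is a power of [e]. *)
have eZ c x : c \in Fq -> e (c * x) = c * e x.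
  move=> cF; have [->|c0] := eqVneq c 0.
    have e0 : e 0 = 0 by apply: additive0; apply/additive_permsP.
    by rewrite !mul0r.
  have cI : injective (fun y : K => c * y) by exact: mulfI.
  have sE : perm cI \in Z by apply/Fq_scalarsP; exists c => // y; rewrite permE.
  have /cycleP[i ei] := subsetP sZ _ sE.
  have := congr1 (fun s : {perm K} => s x) (commuteX i (commute_refl e)).
  by rewrite -ei !permM !permE.
have [lam [lA lZ [a aI la]]] := regular_diagonalizable hKn eA oe te eZ.
have lD := additive_permsP _ lA.
have [g gS [A' gE]] := levi_Sp f0 m0 hKq lD (fun c y => lZ c y).
have gG := subsetP (Sp_GammaSp f0 m0 hKq) _ gS.
have l0 : lam 0 = 0 := additive0 lD.
have gU : stabU g.
  move=> v; rewrite gE /=; apply/eqP/eqP => [e0|->] //.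
  by apply: (@perm_inj _ lam); rewrite l0.
have wg : wmap g = lam by apply/permP=> y; rewrite (wmapE f0 m0 hKq gG gU) gE.
exists g => //; split=> // _ /imsetP[h hH ->].
have [hG hU] := (GS hH, HU hH).
have gVU := stabUV gU; have gVG : (g^-1)%g \in GammaSp by rewrite groupV.
have wgV : wmap g^-1 = (lam^-1)%g.
  apply: (mulgI lam); rewrite -{1}wg -(wmapM f0 m0 hKq) // !mulgV.
  by apply/permP=> y; rewrite (wmapE f0 m0 hKq (group1 _)) ?perm1 // => v; rewrite perm1.
have sN : wmap h \in 'N(<[e]>).
  by apply: (subsetP nA); apply: (subsetP (joing_subl _ _)); apply/wmap_imageP; exists h.
have [b [j [b0 jN ej]]] := normalizes_monomial hKn lA (wmap_additive f0 m0 hKq hG hU) aI la sN.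
exists b, j; split=> // y; rewrite -ej !conjgE.
rewrite (wmapM f0 m0 hKq) ?groupM //; last exact: stabUM.
by rewrite (wmapM f0 m0 hKq) // wgV wg.
Qed.

End Transitive.

End MonomialConjugate.

Lemma card_Wspace (K : finFieldType) : #|Wspace K :\ (0%R, 0%R)| = (#|K| - 1)%N.
Proof.
have -> : Wspace K :\ (0, 0) = [set (0, y) | y in [set~ (0 : K)]].
  apply/setP=> -[x y]; rewrite !inE /= xpair_eqE negb_and.
  apply/andP/imsetP=> [[h /eqP x0]|[z]]; last first.
    by rewrite !inE => z0 [-> ->]; rewrite z0 orbT.
  by exists y; rewrite ?x0 // !inE; move: h; rewrite x0 eqxx.
by rewrite card_imset ?cardsC1 ?subn1 // => y y' [].
Qed.

Section ShearGroup.

Variables (K : finFieldType) (f m : nat).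
Hypotheses (f0 : (0 < f)%N) (m2 : (2 <= m)%N) (hKq : #|K| = ((2 ^ f) ^ m)%N).
Local Notation q := (2 ^ f)%N.
Local Notation V := (K * K)%type.
Let m0 : (0 < m)%N := ltnW m2.
Local Notation GammaSp := (GammaSp K q m).
Local Notation wmap := (@wmap K).
Implicit Types (u v : V) (g : {perm V}) (a b c x y z : K) (h : K -> K).

Let hK := cardK2 hKq.
Let sSG := subsetP (Sp_GammaSp f0 m0 hKq).

(** This is the unipotent radical of the stabilizer of U. *)
Definition shear_group : {set {perm V}} := [set g in GammaSp | [forall v, (g v).2 == v.2]].

Lemma shear_group_snd g v : g \in shear_group -> (g v).2 = v.2.
Proof. by rewrite inE => /andP[_ /forallP/(_ v)/eqP]. Qed.

Lemma mem_shear_group g : g \in GammaSp -> (forall v, (g v).2 = v.2) -> g \in shear_group.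
Proof. by move=> gG e; rewrite inE gG; apply/forallP=> v; rewrite e. Qed.

Lemma shear_groupP g :
  reflect (exists2 h, symmetric_qmap f m h & g = shear h) (g \in shear_group).
Proof.
rewrite inE; apply: (iffP andP) => [[gG /forallP e]|[h hs ->]].
  have gU : stabU g by move=> v; rewrite (eqP (e v)).
  apply: (wmap_eq1 f0 m0 hKq gG gU); apply/permP=> y.
  by rewrite (wmapE f0 m0 hKq gG gU) (eqP (e _)) perm1.
split; first by apply: sSG; apply: shear_Sp.
by apply/forallP=> v; rewrite shearE.
Qed.

Lemma shear_group_wmap g : g \in GammaSp -> stabU g -> wmap g = 1%g -> g \in shear_group.
Proof. by move=> gG gU e; apply/shear_groupP; apply: (wmap_eq1 f0 m0 hKq). Qed.

Lemma wmap_shear_group g : g \in shear_group -> wmap g = 1%g.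
Proof.
move=> /shear_groupP[h hs ->]; apply/permP=> y.
by rewrite (wmapE f0 m0 hKq) ?shearE ?perm1 //; [apply: sSG; apply: shear_Sp | exact: shear_stabU].
Qed.

Lemma shear_group_sub : shear_group \subset GammaSp.
Proof. by apply/subsetP=> g; rewrite inE => /andP[]. Qed.

Lemma shear_group_stabU g : g \in shear_group -> stabU g.
Proof. by case/shear_groupP=> h _ ->; apply: shear_stabU. Qed.

Lemma shear_group_Sp : shear_group \subset Sp K q m.
Proof. by apply/subsetP=> _ /shear_groupP[h hs ->]; apply: shear_Sp. Qed.

Lemma shear_group_group_set : group_set shear_group.
Proof.
have iG := subsetP shear_group_sub.
apply/group_setP; split=> [|g g' gR g'R].
  by apply: mem_shear_group => [|v]; [exact: (group1 (GammaSp_group f0 m0 hKq)) | rewrite perm1].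
apply: mem_shear_group => [|v].
  exact: (groupM (G := GammaSp_group f0 m0 hKq) (iG _ gR) (iG _ g'R)).
by rewrite permM !shear_group_snd.
Qed.

Canonical shear_group_group := Group shear_group_group_set.

Lemma shear_group_abelem : 2.-abelem shear_group_group.
Proof.
apply/abelemP=> //; split=> [|_ /shear_groupP[h _ ->]].
  apply/centsP=> _ /shear_groupP[h _ ->] _ /shear_groupP[h' _ ->].
  by rewrite /commute !shearM; apply: eq_shear => y; rewrite addrC.
by rewrite expgS expg1 shearM -(shear0 K); apply: eq_shear => y; rewrite (addrr2 hK).
Qed.

Lemma shear_ellJ h (w : {unit K}) :
  (shear h ^ ell w)%g = shear (fun y => (val w)^-1 * h ((val w)^-1 * y)).
Proof.
apply/permP=> v; rewrite -{1}(permKV (ell w) v) permJ.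
have -> : ((ell w)^-1)%g v = (val w * v.1, (val w)^-1 * v.2).
  by apply: (@perm_inj _ (ell w)); rewrite permKV ellE /= mulKf ?mulVKf ?val_unit_neq0 //; case: v.
by rewrite !shearE ellE /= mulVKf ?val_unit_neq0 // mulrDr mulKf ?val_unit_neq0.
Qed.

End ShearGroup.

Section MonomialGroup.

Variables (K : finFieldType) (f m : nat) (omega : {unit K}).
Hypotheses (f0 : (0 < f)%N) (m2 : (2 <= m)%N) (hKq : #|K| = ((2 ^ f) ^ m)%N)
  (homega : generator [set: {unit K}] omega).
Local Notation q := (2 ^ f)%N.
Local Notation V := (K * K)%type.
Let m0 : (0 < m)%N := ltnW m2.
Local Notation GammaSp := (GammaSp K q m).
Local Notation wmap := (@wmap K).
Implicit Types (u v : V) (g h : {perm V}) (a b c x y z : K).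

Let hK := cardK2 hKq.
Let N0 : (0 < m * f)%N. Proof. by rewrite muln_gt0 m0. Qed.
Let sSG := subsetP (Sp_GammaSp f0 m0 hKq).

Let T : {group {perm V}} := <<[set ell omega; frob K]>>%G.
Let S0 : {group {perm V}} := <[ell omega]>%G.
Let R := shear_group_group f0 m2 hKq.
Let TG := subsetP (GammaL1_GammaSp omega f0 m2 hKq).

Lemma T_stabU t : t \in T -> stabU t.
Proof.
case/(GammaL1_decomposition f0 m2 hKq homega) => w [j [_ e]].
exact: tmap_stabU (val_unit_neq0 w) e.
Qed.

Lemma S0_sub_T : S0 \subset T.
Proof. by rewrite normal_sub ?(Singer_normal f0 m2 hKq). Qed.

Lemma wmap_ell (w : {unit K}) y : wmap (ell w) y = val w * y.
Proof.
rewrite (wmapE f0 m0 hKq) ?ellE //; last exact: ell_stabU.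
by apply: sSG; apply: ell_Sp.
Qed.

Lemma T_wmap_eq1 t : t \in T -> wmap t = 1%g -> t = 1%g.
Proof.
move=> tT e1; have [w [j [_ e]]] := GammaL1_decomposition f0 m2 hKq homega tT.
have ew y : y = val w * y ^+ (2 ^ j)%N.
  by rewrite -(tmap_wmap f0 m2 hKq (TG tT) (val_unit_neq0 w) e) e1 perm1.
have w1 : val w = 1 by have := ew 1; rewrite expr1n mulr1.
have ej y : y ^+ (2 ^ j)%N = y by rewrite [RHS]ew w1 mul1r.
by apply/permP=> v; rewrite e perm1 /tmap !ej w1 invr1 !mul1r; case: v.
Qed.

Lemma index_Singer : (#|T : S0| %| m * f)%N.
Proof.
have nS0 := Singer_normal f0 m2 hKq homega.
have fT : frob K \in T by exact: frob_mem_T.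
have fN : frob K \in 'N(S0) := subsetP (normal_norm nS0) _ fT.
rewrite -card_quotient ?normal_norm // (GammaL1_quotient f0 m2 hKq homega).
rewrite -orderE order_dvdn -morphX // (_ : frob K ^+ (m * f) = 1)%g ?morph1 //.
apply/permP=> v; rewrite (frobX hKq) perm1.
by rewrite !(pow2_card hK); case: v.
Qed.

Lemma GammaL1_W t y : t \in T -> t (0, y) = (0, wmap t y).
Proof.
move=> tT; have [w [j [_ e]]] := GammaL1_decomposition f0 m2 hKq homega tT.
rewrite (wmapE f0 m0 hKq (TG tT) (T_stabU tT)) e /tmap /=.
by rewrite expr0n expn_eq0 mulr0.
Qed.

Lemma GammaL1_transitive (S : {group {perm V}}) : S \subset T ->
  (forall y, y != 0 -> exists2 t, t \in S & wmap t 1 = y) ->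
  [transitive S, on Wspace K :\ (0, 0)%R | 'P].
Proof.
move=> sST tr; apply/imsetP; exists (0, 1).
  by rewrite !inE /= xpair_eqE oner_eq0 andbF eqxx.
apply/setP=> -[x y]; rewrite !inE /= xpair_eqE negb_and.
apply/andP/orbitP=> [[h /eqP x0]|[t tS]]; last first.
  rewrite /= /aperm (GammaL1_W _ (subsetP sST _ tS)) => -[<- <-]; rewrite eqxx; split=> //.
  have [w [j [_ e]]] := GammaL1_decomposition f0 m2 hKq homega (subsetP sST _ tS).
  rewrite (tmap_wmap f0 m2 hKq (TG (subsetP sST _ tS)) (val_unit_neq0 w) e).
  by rewrite expr1n mulr1 val_unit_neq0.
have y0 : y != 0 by move: h; rewrite x0 eqxx.
have [t tS et] := tr y y0; exists t => //.
by rewrite /= /aperm (GammaL1_W _ (subsetP sST _ tS)) et x0.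
Qed.

Variable H : {group {perm V}}.
Hypotheses (sHG : H \subset GammaSp) (HU : forall h, h \in H -> stabU h)
  (mono : forall h, h \in H -> exists b, exists j : nat,
            b != 0 /\ forall y, wmap h y = b * y ^+ (2 ^ j)%N)
  (trW : forall y y', y != 0 -> y' != 0 -> exists2 h, h \in H & wmap h y = y').

Let GS := subsetP sHG.

Lemma mono_T h : h \in H -> exists2 t, t \in T & wmap t = wmap h.
Proof.
move=> hH; have [b [j [b0 e]]] := mono hH.
have ub : b \is a GRing.unit by rewrite unitfE.
set w := FinRing.unit K ub; have et v : (frob K ^+ j * ell w)%g v = tmap b j v.
  by rewrite (frob_ell_tmap hKq).
have tT : (frob K ^+ j * ell w)%g \in T.
  by apply/(mem_GammaL1P f0 m2 hKq homega); exists b, j.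
exists (frob K ^+ j * ell w)%g => //; apply/permP=> y.
by rewrite (tmap_wmap f0 m2 hKq (TG tT) b0 et) e.
Qed.

(* levi_part is H modulo shears; it is not a subgroup of H in general. *)
Definition levi_part : {set {perm V}} := [set t in T | [exists h in H, wmap t == wmap h]].

Lemma levi_partP t :
  reflect (t \in T /\ exists2 h, h \in H & wmap t = wmap h) (t \in levi_part).
Proof.
rewrite inE; apply: (iffP andP) => -[tT].
  by case/exists_inP=> h hH /eqP e; split=> //; exists h.
by case=> h hH e; split=> //; apply/exists_inP; exists h; rewrite ?e.
Qed.

Lemma levi_part_group_set : group_set levi_part.
Proof.
apply/group_setP; split=> [|s t /levi_partP[sT [h hH es]] /levi_partP[tT [k kH et]]].
  by apply/levi_partP; split; [exact: group1 | exists 1%g; rewrite ?group1].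
apply/levi_partP; split; [exact: groupM | exists (h * k)%g; first exact: groupM].
rewrite (wmapM f0 m0 hKq (TG sT) (T_stabU sT) (TG tT) (T_stabU tT)) es et.
by rewrite (wmapM f0 m0 hKq (GS hH) (HU hH) (GS kH) (HU kH)).
Qed.

Let A := Group levi_part_group_set.
Let C := (A :&: S0)%G.

Lemma levi_part_sub : A \subset T.
Proof. by apply/subsetP=> t /levi_partP[]. Qed.

(** By transitivity q^m - 1 divides the order of [A], while the index of [C] in [A] divides that of
    S_0 in T, a divisor of m f. *)
Lemma card_singer_part : exists2 t, (t %| m * f)%N & (2 ^ (m * f) - 1 = #|C| * t)%N.
Proof.
have dC : (#|C| %| 2 ^ (m * f) - 1)%N.
  by rewrite -(card_Singer hKq homega) cardSg ?subsetIr.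
exists ((2 ^ (m * f) - 1) %/ #|C|)%N; last by rewrite (mulnC #|C|%g) divnK.
have dA : (2 ^ (m * f) - 1 %| #|A|)%N.
  rewrite -hK -card_Wspace.
  apply: (atrans_dvd (G := A) (to := 'P%act)); apply: (GammaL1_transitive levi_part_sub).
  move=> y y0; have [k kH ek] := trW (oner_neq0 K) y0; have [t tT et] := mono_T kH.
  by exists t; [apply/levi_partP; split=> //; exists k | rewrite et].
have nS0 := Singer_normal f0 m2 hKq homega.
have iA : (#|A : S0| %| m * f)%N.
  apply: dvdn_trans index_Singer.
  have nA : A \subset 'N(S0) := subset_trans levi_part_sub (normal_norm nS0).
  rewrite -[X in (_ %| X)%N]card_quotient ?normal_norm // -card_quotient //.
  by rewrite cardSg // quotientS // levi_part_sub.
apply: dvdn_trans iA; rewrite -indexgI.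
by rewrite -(dvdn_pmul2l (cardG_gt0 C)) Lagrange ?subsetIl // (mulnC #|C|%g) divnK.
Qed.

(** The inverse appears because conjugation by [ell w] acts on a shear through the inverse of [w],
    see [shear_ellJ]. *)
Lemma singer_part_generator : exists2 w : {unit K}, C :=: <[ell w]>%g &
  forall i j : nat, ((val w)^-1) ^+ i = ((val w)^-1) ^+ j -> i = j %[mod #|C|].
Proof.
have /cyclicP[c ec] : cyclic C by rewrite (cyclicS (subsetIr _ _)) // cycle_cyclic.
have /setIP[_ /(SingerP homega)[w ew]] : c \in C by rewrite ec cycle_id.
exists w => [|i j e]; first by rewrite ec ew.
apply/eqP; rewrite ec -orderE ew -eq_expg_mod_order.
rewrite -!ellX; apply/eqP; congr ell; apply: val_inj; rewrite !FinRing.val_unitX.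
by apply: invr_inj; rewrite -!exprVn.
Qed.

Lemma singer_partP (c : {perm V}) : reflect
  (exists w : {unit K}, c = ell w /\ exists2 h, h \in H & forall y, wmap h y = val w * y) (c \in C).
Proof.
apply: (iffP idP) => [/setIP[/levi_partP[_ [h hH e]] /(SingerP homega)[w ew]]|[w [-> [h hH e]]]].
  by exists w; split=> //; exists h => // y; rewrite -e ew wmap_ell.
have cS : ell w \in S0 by apply/(SingerP homega); exists w.
apply/setIP; split=> //; apply/levi_partP; split; first exact: subsetP S0_sub_T _ cS.
by exists h => //; apply/permP=> y; rewrite wmap_ell e.
Qed.

Lemma odd_singer_part : odd #|C|.
Proof.
have [t _ e] := card_singer_part; have : odd (2 ^ (m * f) - 1).
  by rewrite oddB ?expn_gt0 // oddX (gtn_eqF N0).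
by rewrite e oddM => /andP[].
Qed.

Lemma coprime_shear_singer : coprime #|R| #|C|.
Proof.
apply: (@pnat_coprime 2%N); first exact: abelem_pgroup (shear_group_abelem f0 m2 hKq).
by rewrite -odd_2'nat odd_singer_part.
Qed.

Lemma singer_part_norm : C \subset 'N(R).
Proof.
apply/subsetP=> _ /singer_partP[w [-> _]]; rewrite inE; apply/subsetP=> _ /imsetP[r rR ->].
have wG : ell w \in GammaSp by apply: sSG; apply: ell_Sp.
have rG := subsetP (shear_group_sub _ _ _) _ rR.
apply: mem_shear_group => [|v]; first by rewrite groupJ.
by rewrite -{1}(permKV (ell w) v) permJ ellE (shear_group_snd _ rR) -[in RHS](permKV (ell w) v) ellE.
Qed.

End MonomialGroup.

(** * The complement to the shears in H *)

Section Splitting.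

Variables (K : finFieldType) (f m : nat) (omega : {unit K}).
Hypotheses (f0 : (0 < f)%N) (m2 : (2 <= m)%N) (hKq : #|K| = ((2 ^ f) ^ m)%N)
  (homega : generator [set: {unit K}] omega).
Local Notation q := (2 ^ f)%N.
Local Notation V := (K * K)%type.
Let m0 : (0 < m)%N := ltnW m2.
Local Notation GammaSp := (GammaSp K q m).
Local Notation wmap := (@wmap K).
Implicit Types (u v : V) (c g h : {perm V}) (a b y z : K).

Let N0 : (0 < m * f)%N. Proof. by rewrite muln_gt0 m0. Qed.

Let T : {group {perm V}} := <<[set ell omega; frob K]>>%G.
Let S0 : {group {perm V}} := <[ell omega]>%G.
Let R := shear_group_group f0 m2 hKq.
Let TG := subsetP (GammaL1_GammaSp omega f0 m2 hKq).
Let RG := subsetP (shear_group_sub K f m).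

Lemma stabU_norm_shear g : g \in GammaSp -> stabU g -> g \in 'N(R).
Proof.
move=> gG gU; rewrite inE; apply/subsetP=> _ /imsetP[r rR ->].
apply: mem_shear_group => [|v].
  exact: (groupJ (G := GammaSp_group f0 m0 hKq) (RG rR) gG).
rewrite -{1}(permKV g v) permJ (wmap_snd f0 m0 hKq gG gU) (shear_group_snd _ rR).
by rewrite -(wmap_snd f0 m0 hKq gG gU) permKV.
Qed.

Section Group.

Variable H : {group {perm V}}.
Hypotheses (sHG : H \subset GammaSp) (HU : forall h, h \in H -> stabU h)
  (mono : forall h, h \in H -> exists b, exists j : nat,
            b != 0 /\ forall y, wmap h y = b * y ^+ (2 ^ j)%N)
  (trW : forall y y', y != 0 -> y' != 0 -> exists2 h, h \in H & wmap h y = y').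

Let GS := subsetP sHG.
Let A := Group (levi_part_group_set f0 m2 hKq homega sHG HU).
Let C := (A :&: S0)%G.
Let coRC : coprime #|R| #|C| := coprime_shear_singer f0 m2 hKq homega sHG HU mono trW.
Let nRC : C \subset 'N(R) := singer_part_norm f0 m2 hKq homega sHG HU.
Let CP := singer_partP f0 m2 hKq homega sHG HU.

Lemma shear_quotient g g' : g \in GammaSp -> stabU g -> g' \in GammaSp -> stabU g' ->
  wmap g = wmap g' -> (g * g'^-1)%g \in R.
Proof.
move=> gG gU g'G g'U e; have g'VU := stabUV g'U.
have g'VG : (g'^-1)%g \in GammaSp by exact: (groupVr (G := GammaSp_group f0 m0 hKq)).
apply: (shear_group_wmap f0 m2 hKq).
- exact: (groupM (G := GammaSp_group f0 m0 hKq)).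
- exact: stabUM.
rewrite (wmapM f0 m0 hKq) // e -(wmapM f0 m0 hKq) // mulgV.
apply: (wmap_shear_group f0 m2 hKq); exact: (group1 R).
Qed.

Let CG c : c \in C -> c \in GammaSp.
Proof. by case/setIP=> /levi_partP[/TG]. Qed.

Let CU c : c \in C -> stabU c.
Proof. by case/setIP=> /levi_partP[cT _] _; exact: T_stabU f0 m2 hKq homega _ cT. Qed.

Lemma singer_part_conj : exists2 x, x \in R & C \subset (H :^ x)%g.
Proof.
pose H0 := (H :&: (R <*> C))%G; pose N := (R :&: H0)%G.
have eRC : (R <*> C = R * C)%g by rewrite norm_joinEr.
have eR : (R * H0 = R * C)%g.
  apply/eqP; rewrite eqEsubset; apply/andP; split.
    by rewrite -eRC mul_subG ?joing_subl // subsetIr.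
  apply/subsetP=> _ /mulsgP[r c rR cC ->].
  have /CP[w [ew [h hH eh]]] := cC.
  have whc : wmap h = wmap c.
    by apply/permP=> y; rewrite eh ew (wmap_ell f0 m2 hKq).
  have rhc := shear_quotient (GS hH) (HU hH) (CG cC) (CU cC) whc.
  have hH0 : h \in H0.
    rewrite inE hH -(mulgKV c h) groupM //.
      by rewrite (subsetP (joing_subl _ _)).
    by rewrite (subsetP (joing_subr _ _)).
  apply/mulsgP; exists (r * (h * c^-1)^-1)%g h => //.
    by rewrite groupM ?groupV.
  by rewrite invMg invgK !mulgA mulgKV.
have cH0 : (#|H0| = #|N| * #|C|)%N.
  have := mul_cardG R H0; rewrite eR (coprime_cardMg coRC) -mulnA => /eqP.
  by rewrite eqn_pmul2l ?cardG_gt0 // => /eqP ->; rewrite mulnC.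
have sNH0 : N \subset H0 := subsetIr _ _.
have nN : N <| H0.
  rewrite /normal sNH0 normsI ?normG //.
  apply: subset_trans (subsetIr _ _) _; by rewrite join_subG normG.
have iN : #|H0 : N| = #|C| by rewrite -divgS // cH0 mulKn.
have hN : Hall H0 N.
  by rewrite /Hall sNH0 iN (coprime_dvdl _ coRC) // cardSg // subsetIl.
have /splitsP[K0 /complP[tiNK eNK]] := SchurZassenhaus_split hN nN.
have cK0 : #|K0| = #|C|.
  apply/eqP; rewrite -(eqn_pmul2l (cardG_gt0 N)) -cH0 -eNK.
  by rewrite TI_cardMg.
have /subsetIP[sK0H sK0] : K0 \subset H0 by have := mulG_subr N K0; rewrite eNK.
have {}sK0 : K0 \subset (R * C)%g by rewrite -eRC.
have solR : solvable R.
  exact: abelian_sol (abelem_abelian (shear_group_abelem f0 m2 hKq)).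
have [x xR e] := SchurZassenhaus_trans_sol solR nRC sK0 coRC cK0.
by exists (x^-1)%g; rewrite ?groupV // -sub_conjg -e.
Qed.

Hypothesis sCH : C \subset H.
Hypotheses (nex : ~~ ((m == 6%N) && (f == 1%N))) (nex2 : ~~ ((m == 2%N) && (f == 1%N))).

Let N := (H :&: R)%G.

Lemma singer_part_normT : T \subset 'N(C).
Proof.
have nS0 := Singer_normal f0 m2 hKq homega.
apply: normal_norm; apply: char_normal_trans nS0.
by rewrite sub_cyclic_char ?subsetIr // cycle_cyclic.
Qed.

(** A shear normalizing [C] commutes with it, since commutators lie in both [R] and [C], of coprime
    orders; and [C] fixes no nontrivial shear. *)
Lemma shear_norm_singer_trivial r : r \in R -> r \in 'N(C) -> r = 1%g.
Proof.
move=> rR rN; have tiRC := coprime_TIg coRC.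
have [w eC gam] := singer_part_generator f0 m2 hKq homega sHG HU.
have [t tN et] := card_singer_part f0 m2 hKq homega sHG HU mono trW.
have cC : ell w \in C by rewrite /= eC cycle_id.
have rc : (r ^ ell w)%g = r.
  apply/eqP; rewrite eq_sym eq_mulVg1 -commgEl; apply/eqP.
  suff : [~ r, ell w]%g \in (R :&: C)%g by rewrite tiRC => /set1P.
  apply/setIP; split; last by rewrite commgEr (groupM (G := C)) // memJ_norm ?groupV.
  by rewrite commgEl groupM ?groupV ?memJ_norm ?(subsetP nRC).
have /(shear_groupP f0 m2 hKq)[h hs er] := rR.
move: rc; rewrite er shear_ellJ => /shear_inj eh.
have C0 : (0 < #|C|)%N := cardG_gt0 C.
have tn : (t %| 2 ^ (m * f) - 1)%N by rewrite et dvdn_mull.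
have tdiv : ((2 ^ (m * f) - 1) %/ t = #|C|)%N.
  by rewrite et mulnK // (dvdn_gt0 N0).
rewrite -tdiv in gam.
by rewrite (eq_shear (centralizing_shear_trivial f0 m2 hKq nex nex2 tN tn gam hs eh)) (shear0 K).
Qed.

(** The Frattini argument: the conjugate of [C] by h lies in [N C], hence is a conjugate of [C]
    under some x in [N], and h x^-1 normalizes [C]. Its counterpart in T does so too, and the two
    differ by a shear, which is then trivial; so h x^-1 lies in T. *)
Lemma monomial_split : (N ><| (H :&: T))%g = H.
Proof.
have nRH : H \subset 'N(R).
  by apply/subsetP=> h hH; apply: stabU_norm_shear; [exact: GS | exact: HU].
have nNH : H \subset 'N(N) by rewrite normsI ?normG.
have nNT : (H :&: T)%g \subset 'N(N) by exact: subset_trans (subsetIl _ _) nNH.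
have tiNT : (N :&: (H :&: T) = 1)%g.
  apply/trivgP; apply/subsetP=> t /setIP[/setIP[_ tR] /setIP[_ tT]].
  by rewrite inE (T_wmap_eq1 f0 m2 hKq homega tT) ?(wmap_shear_group f0 m2 hKq).
rewrite sdprodE //.
apply/eqP; rewrite eqEsubset mul_subG ?subsetIl //=; apply/subsetP=> h hH.
have sCh : (C :^ h)%g \subset (N * C)%g.
  rewrite /= group_modr // subsetI conj_subG //.
  have [t tT et] := mono_T f0 m2 hKq homega mono hH.
  have tG := TG tT; have tU := T_stabU f0 m2 hKq homega tT.
  have rR := shear_quotient (GS hH) (HU hH) tG tU (esym et).
  rewrite -[h](mulgKV t) conjsgM.
  have nTR : T \subset 'N(R).
    by apply/subsetP=> u uT; exact: stabU_norm_shear (TG uT) (T_stabU f0 m2 hKq homega uT).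
  have nt : t \in 'N(R * C)%g.
    by rewrite -norm_joinEr // (subsetP (normsY nTR singer_part_normT)).
  rewrite -(normP nt) conjSg -norm_joinEr // conj_subG ?joing_subr //.
  by rewrite (subsetP (joing_subl _ _)).
have coNC : coprime #|N| #|C| by rewrite (coprime_dvdl _ coRC) // cardSg // subsetIr.
have solN : solvable N.
  apply: (solvableS (subsetIr _ _)).
  exact: abelian_sol (abelem_abelian (shear_group_abelem f0 m2 hKq)).
have [x xN e] := SchurZassenhaus_trans_sol solN (subset_trans sCH nNH) sCh coNC (cardJg _ _).
have /setIP[xH xR] := xN.
set k := (h * x^-1)%g; have kH : k \in H by rewrite groupM ?groupV.
have kC : k \in 'N(C) by apply/normP; rewrite conjsgM e conjsgK.
have [t tT et] := mono_T f0 m2 hKq homega mono kH.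
have rR := shear_quotient (GS kH) (HU kH) (TG tT) (T_stabU f0 m2 hKq homega tT) (esym et).
have /eqP : (k * t^-1 = 1)%g.
  by apply: shear_norm_singer_trivial rR _; rewrite groupM ?groupV // (subsetP singer_part_normT).
rewrite -eq_mulgV1 => /eqP ek.
have kT : k \in (H :&: T)%G by rewrite inE kH ek.
have kN : k \in 'N(N) by rewrite (subsetP nNH).
apply/mulsgP; exists (x ^ k^-1)%g k; rewrite ?memJ_norm ?groupV //.
by rewrite conjgE invgK -!mulgA mulVg !mulg1 mulVg mulg1.
Qed.

Lemma shear_part_UI : exists I : {set 'I_(m./2).+1}, N :=: UI K q I.
Proof.
have [w eC gam] := singer_part_generator f0 m2 hKq homega sHG HU.
have [t tN et] := card_singer_part f0 m2 hKq homega sHG HU mono trW.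
have cC : ell w \in C by rewrite /= eC cycle_id.
have C0 : (0 < #|C|)%N := cardG_gt0 C.
have tn : (t %| 2 ^ (m * f) - 1)%N by rewrite et dvdn_mull.
have tdiv : ((2 ^ (m * f) - 1) %/ t = #|C|)%N.
  by rewrite et mulnK // (dvdn_gt0 N0).
rewrite -tdiv in gam.
apply: (invariant_subgroup_UI f0 m2 hKq nex nex2 tN tn gam) => [n /setIP[_]|h hN].
  by move/(shear_groupP f0 m2 hKq).
rewrite -shear_ellJ memJ_norm // (subsetP _ _ cC) //.
by rewrite normsI ?nRC // (subset_trans sCH) ?normG.
Qed.

End Group.

End Splitting.

Section Structure.

Variables (K : finFieldType) (f m : nat) (omega : {unit K}).
Hypotheses (f0 : (0 < f)%N) (m2 : (2 <= m)%N) (hKq : #|K| = ((2 ^ f) ^ m)%N)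
  (homega : generator [set: {unit K}] omega).
Local Notation q := (2 ^ f)%N.
Local Notation V := (K * K)%type.
Let m0 : (0 < m)%N := ltnW m2.
Local Notation GammaSp := (GammaSp K q m).
Local Notation Sp := (Sp K q m).
Local Notation wmap := (@wmap K).
Implicit Types (u v : V) (c g h : {perm V}) (a b y z : K).

Let sSG := subsetP (Sp_GammaSp f0 m0 hKq).

Let T : {group {perm V}} := <<[set ell omega; frob K]>>%G.

Hypotheses (nex : ~~ ((m == 6%N) && (f == 1%N))) (nex2 : ~~ ((m == 2%N) && (f == 1%N))).
Variable v0 : V.
Hypothesis mv0 : minus_form q m (Qf f m v0).

Let GG := GammaSp_group f0 m0 hKq.

(** Two conjugations are needed: one makes the action on V / U monomial, and one by a shear then
    brings C into the group itself. *)
Lemma transitive_solvable_structure (H : {group {perm V}}) :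
  H \subset GammaSp -> (forall h, h \in H -> stabU h) -> solvable H ->
  form_transitive f0 m2 hKq H ->
  exists g (I : {set 'I_(m./2).+1}) (S : {group {perm V}}),
    [/\ g \in Sp, (UI K q I ><| S)%g = (H :^ g)%g, S \subset T &
      [transitive S, on Wspace K :\ (0, 0)%R | 'P]].
Proof.
move=> sHG HU solH trH; have v0M := base_minus_set f0 m2 hKq mv0.
have conjU (X : {group {perm V}}) g : X \subset GammaSp -> (forall h, h \in X -> stabU h) ->
    g \in GammaSp -> stabU g ->
    (X :^ g)%g \subset GammaSp /\ (forall h, h \in (X :^ g)%g -> stabU h).
  move=> sX XU gG gU; split=> [|_ /imsetP[h hX ->]].
    by rewrite (_ : GammaSp = GG :^ g)%g ?conjSg // conjGid.
  by rewrite conjgE; apply: stabUM; [exact: stabUV | apply: stabUM => //; exact: XU].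
have conjT (X : {group {perm V}}) g : X \subset GammaSp -> g \in GammaSp ->
    form_transitive f0 m2 hKq X -> form_transitive f0 m2 hKq (X :^ g)%g.
  move=> sX gG trX; apply: (form_transitiveJ mv0 (H := (X :^ g)%G) (g := (g^-1)%g)).
  - by rewrite (groupV GG).
  - by rewrite (_ : GammaSp = GG :^ g)%g ?conjSg // conjGid.
  by rewrite /= conjsgK.
have [g1 g1S [g1U mono]] := monomial_conjugate sHG HU solH trH v0M.
have g1G := sSG g1S; pose H1 := (H :^ g1)%G.
have [sH1 H1U] := conjU H g1 sHG HU g1G g1U.
have tr1 := conjT H g1 sHG g1G trH.
have trW1 := wmap_transitive (H := H1) sH1 H1U tr1 v0M.
have [x xR sC] := singer_part_conj f0 m2 hKq homega sH1 H1U mono trW1.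
have xS := subsetP (shear_group_Sp f0 m2 hKq) _ xR.
have xG := sSG xS; have xU := shear_group_stabU f0 m2 hKq xR.
pose H2 := (H1 :^ x)%G.
have [sH2 H2U] := conjU H1 x sH1 H1U xG xU.
have tr2 := conjT H1 x sH1 xG tr1.
have trW2 := wmap_transitive (H := H2) sH2 H2U tr2 v0M.
have wx h : h \in H1 -> wmap (h ^ x)%g = wmap h.
  move=> hH1; have hG := subsetP sH1 _ hH1; have hU := H1U _ hH1.
  have xVR : (x^-1)%g \in shear_group_group f0 m2 hKq by rewrite groupV.
  have xVG : (x^-1)%g \in GammaSp by rewrite (groupV GG).
  rewrite conjgE (wmapM f0 m0 hKq) ?(stabUM hU xU) ?(stabUV xU) ?(groupM (G := GG)) //.
  - rewrite (wmapM f0 m0 hKq) // (wmap_shear_group f0 m2 hKq xVR) (wmap_shear_group f0 m2 hKq xR).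
    by rewrite mul1g mulg1.
  - exact: stabUV.
  exact: stabUM.
have mono2 h : h \in H2 -> exists b, exists j : nat, b != 0 /\ forall y, wmap h y = b * y ^+ (2 ^ j)%N.
  by case/imsetP=> k kH1 ->; have [b [j e]] := mono k kH1; exists b, j; rewrite wx.
(* Conjugation by a shear does not affect the action on V / U, so C is the same for [H1] and
   [H2]. *)
have sC2 : (Group (levi_part_group_set f0 m2 hKq homega sH2 H2U) :&: <[ell omega]>)%G \subset H2.
  apply/subsetP=> c /(singer_partP f0 m2 hKq homega sH2 H2U)[w [ec [_ /imsetP[h hH1 ->] e]]].
  apply: (subsetP sC); apply/(singer_partP f0 m2 hKq homega sH1 H1U).
  by exists w; split=> //; exists h => // y; rewrite -e wx.
have split := monomial_split mono2 trW2 sC2 nex nex2.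
have [I eI] := shear_part_UI mono2 trW2 sC2 nex nex2.
have sST : (H2 :&: T)%G \subset T by exact: subsetIr.
exists (g1 * x)%g, I, (H2 :&: T)%G; split=> //.
- exact: (SpM g1S xS).
- by rewrite -eI split conjsgM.
apply: (GammaL1_transitive f0 m2 hKq homega sST) => y y0.
have [h hH2 eh] := trW2 1 y (oner_neq0 K) y0.
move: hH2; rewrite -(sdprodW split) => /mulsgP[n t /setIP[_ nR] tHT e].
exists t => //; rewrite -eh e; have /setIP[tH2 _] := tHT.
have nG := subsetP (shear_group_sub K f m) _ nR.
rewrite (wmapM f0 m0 hKq) ?(subsetP sH2 _ tH2) //.
- by rewrite permM (wmap_shear_group f0 m2 hKq nR) perm1.
- exact: (shear_group_stabU f0 m2 hKq nR).
exact: (H2U _ tH2).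
Qed.

End Structure.

(** * Transitivity criteria *)

Lemma leq_exp2_pred (k : nat) : (2 ^ k.-1 <= k)%N -> (k <= 2)%N.
Proof.
case: k => [|[|[|k]]] //=; rewrite leqNgt => /negP[].
elim: k => // k IH; rewrite expnS; lia.
Qed.

Section TraceToQuartic.

Variables (K : finFieldType) (N : nat).
Hypotheses (N0 : (0 < N)%N) (hK : #|K| = (2 ^ N)%N).
Implicit Types x : K.

Lemma sum_even_odd (F : nat -> K) (n n2 : nat) : n2 = n.*2 ->
  \sum_(i < n2) F i = \sum_(i < n) (F i.*2 + F i.*2.+1).
Proof.
move=> ->; elim: n => [|n IH]; first by rewrite !big_ord0.
by rewrite doubleS !big_ord_recr /= IH addrA.
Qed.

Lemma trk1_trk2 x : (2 %| N)%N -> trk N 1 x = trk N 2 x + trk N 2 x ^+ 2.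
Proof.
move=> dN; have eN : N = (N %/ 2).*2 by rewrite -muln2 divnK.
have <- : trk N 2 (x ^+ 2) = trk N 2 x ^+ 2 := trk_pow2 hK 2 1 x.
rewrite /trk divn1 (sum_even_odd (fun i => x ^+ (2 ^ (1 * i))%N) eN) big_split /=.
congr (_ + _); apply: eq_bigr => i _; first by rewrite mul1n mul2n.
by rewrite mul1n -exprM -expnS mul2n.
Qed.

Lemma trk1_two_values x : (2 %| N)%N -> trk N 1 x = 1 ->
  trk N 2 x ^+ 4 = trk N 2 x /\ trk N 2 x ^+ 2 != trk N 2 x.
Proof.
move=> dN t1; split; first exact: (trk_fixed N0 hK).
apply: contra_eq_neq t1 => e; rewrite trk1_trk2 // e (addrr2 hK) eq_sym; exact: oner_neq0.
Qed.

End TraceToQuartic.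

Lemma quartic_field (F : fieldType) (c x : F) :
  c ^+ 4 = c -> c ^+ 2 != c -> x ^+ 4 = x -> [|| x == 0, x == 1, x == c | x == c ^+ 2].
Proof.
move=> c4 c2 x4.
have fac (y : F) : y ^+ 4 = y -> y * (y - 1) * (y ^+ 2 + y + 1) = 0.
  by move=> y4; transitivity (y ^+ 4 - y); [ring | rewrite y4 subrr].
have c0 : c != 0 by apply: contra_neq c2 => ->; rewrite expr0n.
have c1 : c - 1 != 0 by rewrite subr_eq0; apply: contra_neq c2 => ->; rewrite expr1n.
have /eqP := fac c c4; rewrite !mulf_eq0 (negPf c0) (negPf c1) /= => /eqP ec.
have /eqP := fac x x4; rewrite !mulf_eq0 subr_eq0 orbA => /orP[/orP[]->|/eqP ex]; rewrite ?orbT //.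
have : (x - c) * (x - c ^+ 2) == 0.
  apply/eqP; transitivity ((x ^+ 2 + x + 1) - (c ^+ 2 + c + 1) * (x + 1 - c)); first by ring.
  by rewrite ex ec mul0r subrr.
by rewrite mulf_eq0 !subr_eq0 => /orP[]->; rewrite !orbT.
Qed.

(** * Necessity of the numerical conditions *)

Section Conditions.

Variables (K : finFieldType) (f m : nat) (omega : {unit K}).
Hypotheses (f0 : (0 < f)%N) (m2 : (2 <= m)%N) (hKq : #|K| = ((2 ^ f) ^ m)%N)
  (homega : generator [set: {unit K}] omega).
Local Notation q := (2 ^ f)%N.
Local Notation V := (K * K)%type.
Let m0 : (0 < m)%N := ltnW m2.
Implicit Types (u v : V) (c g h : {perm V}) (a b x y z : K).

Let hK := cardK2 hKq.
Let N0 : (0 < m * f)%N. Proof. by rewrite muln_gt0 m0. Qed.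

Let T : {group {perm V}} := <<[set ell omega; frob K]>>%G.

Variables (I : {set 'I_(m./2).+1}) (S H : {group {perm V}}).
Hypotheses (eH : (UI K q I ><| S)%g = H) (sST : S \subset T)
  (I0 : ord0 \notin I) (trH : form_transitive f0 m2 hKq H).

Local Notation k := (f * dI I)%N.

Let k0 : (0 < k)%N. Proof. by rewrite muln_gt0 f0 dI_gt0. Qed.
Let kN : (k %| m * f)%N. Proof. by rewrite mulnC dvdn_pmul2r // dI_dvd. Qed.

(** U(I) preserves the trace of v1 v2, and the scalar of an element of T cancels in this product,
    which leaves only its Frobenius power. *)
Lemma trk_conjugate v v' : v \in minus_set K f m -> v' \in minus_set K f m ->
  exists t a (j : nat), [/\ t \in S, a != 0, forall v, t v = tmap a j v &
    trk (m * f) k (v'.1 * v'.2) = trk (m * f) k (v.1 * v.2) ^+ (2 ^ j)%N].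
Proof.
move=> vM v'M; have [h hH e] := trH vM v'M.
move: hH; rewrite -(sdprodW eH) => /mulsgP[n t nU tS eh].
have [w [j [_ et]]] := GammaL1_decomposition f0 m2 hKq homega (subsetP sST _ tS).
exists t, (val w), j; split=> //; first exact: val_unit_neq0.
have nG := subsetP (UI_GammaSp f0 m2 hKq I) _ nU.
have tG := subsetP (GammaL1_GammaSp omega f0 m2 hKq) _ (subsetP sST _ tS).
have [e1 e2] := UI_trk f0 m2 hKq v I0 nU.
rewrite -e eh (form_actM f0 m0 hKq v nG tG).
rewrite (form_act_GammaL1 f0 m2 hKq homega _ (subsetP sST _ tS)) et /tmap /=.
rewrite -e2 -(trk_pow2 hK); congr trk.
by rewrite mulrACA mulVf ?val_unit_neq0 // mul1r exprMn.
Qed.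

Variable v0 : V.
Hypothesis mv0 : v0 \in minus_set K f m.

Lemma minus_product z : trk (m * f) 1 z = 1 -> (z, 1) \in minus_set K f m.
Proof. by move=> e; apply/minus_setP; rewrite mulr1. Qed.

(** The count is made on elements rather than on traces: at least 2^(N - 1) elements have absolute
    trace 1, and they are covered by k translates of the kernel of the trace, of size at most 2^(N -
    k), where N = m f. *)
Lemma dI_bound : (k <= 2)%N.
Proof.
pose z0 := v0.1 * v0.2; have tz0 : trk (m * f) 1 z0 = 1 by apply/minus_setP.
pose X := [set x : K | trk (m * f) 1 x == 1]; pose F := [set x : K | trk (m * f) k x == 0].
have cX : (2 ^ (m * f) <= #|X| + 2 ^ (m * f - 1))%N.
  rewrite -hK -(cardsC X) leq_add2l.
  apply: leq_trans (card_trk_ker K N0 (ltn0Sn 0) (dvd1n _)).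
  apply: subset_leq_card; apply/subsetP=> x; rewrite !inE.
  by have [->|->] := tr2_01 f0 m0 hKq x; rewrite ?eqxx.
have sX : X \subset [set z0 ^+ (2 ^ (p.1 : 'I_k))%N + p.2 | p in setX [set: 'I_k] F].
  apply/subsetP=> x; rewrite inE => /eqP tx.
  have [t [a [j [_ _ _ e]]]] := trk_conjugate (minus_product tz0) (minus_product tx).
  rewrite /= !mulr1 in e; apply/imsetP.
  have ej : trk (m * f) k z0 ^+ (2 ^ (j %% k))%N = trk (m * f) k z0 ^+ (2 ^ j)%N.
    rewrite {2}(divn_eq j k) -pow2_pow2 (mulnC (j %/ k)%N).
    by rewrite (trk_fixed_mul N0 hK _ _ k0 kN).
  exists (Ordinal (ltn_pmod j k0), x + z0 ^+ (2 ^ (j %% k))%N).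
    by rewrite !inE /= (trkD hK) (trk_pow2 hK) e ej (addrr2 hK).
  by rewrite /= addrCA (addrr2 hK) addr0.
have cF : (#|F| <= 2 ^ (m * f - k))%N := card_trk_ker K N0 k0 kN.
have : (#|X| <= k * 2 ^ (m * f - k))%N.
  apply: leq_trans (subset_leq_card sX) _; apply: leq_trans (leq_imset_card _ _) _.
  by rewrite cardsX cardsT card_ord leq_mul2l cF orbT.
have kle := dvdn_leq N0 kN.
move=> c2; apply: leq_exp2_pred; rewrite -(leq_pmul2r (expn_gt0 2 (m * f - k))).
rewrite -expnD; have -> : (k.-1 + (m * f - k) = m * f - 1)%N.
  by move: k0 kle; clear; set n := (m * f)%N; lia.
apply: leq_trans c2; rewrite -(leq_add2r (2 ^ (m * f - 1))); apply: leq_trans cX.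
by rewrite addnn -mul2n -expnS subn1 prednK.
Qed.

(** Both z0 and its square have absolute trace 1, but their traces to F_4 are different conjugates.
    The element of S that connects them therefore acts nontrivially on F_4. *)
Lemma odd_element : k = 2%N -> exists z,
  [/\ z ^+ 4 = z, z ^+ 2 != z & exists t a (j : nat), [/\ t \in S, a != 0, odd j & forall v, t v = tmap a j v]].
Proof.
move=> k2; have kN2 := kN; rewrite k2 in kN2.
pose z0 := v0.1 * v0.2; have tz0 : trk (m * f) 1 z0 = 1 by apply/minus_setP.
have [e4 e2] := trk1_two_values N0 hK kN2 tz0.
exists (trk (m * f) 2 z0); split=> //.
have tz02 : trk (m * f) 1 (z0 ^+ 2) = 1 by rewrite (trk_pow2 hK 1 1) tz0 expr1n.
have [t [a [j [tS a0 et e]]]] := trk_conjugate (minus_product tz0) (minus_product tz02).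
exists t, a, j; split=> //; move: e; rewrite /= !mulr1 k2 (trk_pow2 hK 2 1) expn1 (order3_pow e4).
by case: (odd j) => // e; move: e2; rewrite e eqxx.
Qed.

End Conditions.

Section FieldAutomorphism.

Variables (K : finFieldType) (m : nat).
Hypotheses (m2 : (2 <= m)%N) (hKq : #|K| = ((2 ^ 2) ^ m)%N).
Local Notation V := (K * K)%type.
Let m0 : (0 < m)%N := ltnW m2.
Let f0 : (0 < 2)%N := isT.
Local Notation GammaSp := (GammaSp K (2 ^ 2) m).
Local Notation Sp := (Sp K (2 ^ 2) m).
Local Notation tauof := (tauof f0 m0 hKq).
Implicit Types (g t : {perm V}) (c x y z : K).

(** As j is odd, t induces squaring on F_4. Any semilinear isometry, possibly after multiplication
    by t, is then linear and lies in Sp. *)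
Lemma GammaSp4_sub (G : {group {perm V}}) (z : K) t a (j : nat) :
  z ^+ 4 = z -> z ^+ 2 != z ->
  Sp \subset G -> G \subset GammaSp -> t \in G -> a != 0 -> odd j -> (forall v, t v = tmap a j v) ->
  G :=: GammaSp.
Proof.
move=> z4 z2 sSG sG tG a0 oj et; apply/eqP; rewrite eqEsubset sG /=.
have tGa := subsetP sG _ tG.
have FqE c : (c \in Fq K (2 ^ 2)) = (c ^+ 4 == c) by rewrite inE.
have zF : z \in Fq K (2 ^ 2) by rewrite FqE z4.
have wE := tmap_wmap f0 m2 hKq tGa a0 et.
have tU : stabU t := tmap_stabU a0 et.
have tauE c : c ^+ 4 = c -> c ^+ 2 != c -> tauof t c = c ^+ 2.
  move=> c4 c2; have cF : c \in Fq K (2 ^ 2) by rewrite FqE c4.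
  have := wmapZ f0 m0 hKq tGa tU 1 cF; rewrite !wE mulr1 expr1n mulr1 (order3_pow c4) oj mulrC.
  by move/(mulIf a0).
have idS g : g \in GammaSp -> tauof g z = z -> g \in G.
  move=> gG gz; apply: (subsetP sSG); apply: (tauof_Sp gG) => c.
  rewrite FqE => /eqP c4; have [[tF tD tM _] _] := GammaSpP f0 m0 hKq _ gG.
  have t0 : tauof g 0 = 0.
    by apply: (addrI (tauof g 0)); rewrite -tD ?addr0 //; exact: Fq0.
  have t1 : tauof g 1 = 1.
    have z0 : z != 0 by apply: contra_neq z2 => ->; rewrite expr0n.
    apply: (mulfI z0); rewrite -{1}gz -tM ?mulr1 //; exact: Fq1.
  have /or4P[/eqP->|/eqP->|/eqP->|/eqP->] := quartic_field z4 z2 c4; rewrite ?t0 ?t1 ?gz //.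
  by rewrite !expr2 tM // gz.
apply/subsetP=> g gG; have [[tF tD tM tI] _] := GammaSpP f0 m0 hKq _ gG.
have gz4 : tauof g z ^+ 4 = tauof g z by apply/eqP; rewrite -FqE tF.
have gz2 : tauof g z ^+ 2 != tauof g z.
  rewrite expr2 -tM //; apply: contra_neq z2 => e; rewrite expr2.
  by apply: tI => //; exact: FqM.
have /or4P[/eqP e|/eqP e|/eqP e|/eqP e] := quartic_field z4 z2 gz4.
- by move: gz2; rewrite e expr0n eqxx.
- by move: gz2; rewrite e expr1n eqxx.
- exact: idS.
have gtG : (g * t)%g \in GammaSp := groupM (G := GammaSp_group f0 m0 hKq) gG tGa.
rewrite -(mulgK t g) groupM ?groupV //; apply: idS => //.
by rewrite (tauofM f0 m0 hKq gG tGa zF) e tauE -?e // e -exprM z4.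
Qed.

End FieldAutomorphism.

(** * Sufficiency of the numerical conditions *)

Section Sufficiency.

Variables (K : finFieldType) (f m : nat) (omega : {unit K}).
Hypotheses (f0 : (0 < f)%N) (m2 : (2 <= m)%N) (hKq : #|K| = ((2 ^ f) ^ m)%N)
  (homega : generator [set: {unit K}] omega).
Local Notation q := (2 ^ f)%N.
Local Notation V := (K * K)%type.
Let m0 : (0 < m)%N := ltnW m2.
Local Notation GammaSp := (GammaSp K q m).
Local Notation form_act := (form_act f0 m0 hKq).
Implicit Types (u v : V) (c g h : {perm V}) (a b e x y z : K).

Let hK := cardK2 hKq.
Let N0 : (0 < m * f)%N. Proof. by rewrite muln_gt0 m0. Qed.

Let T : {group {perm V}} := <<[set ell omega; frob K]>>%G.
Let TG := subsetP (GammaL1_GammaSp omega f0 m2 hKq).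

Variables (I : {set 'I_(m./2).+1}) (S H : {group {perm V}}).
Hypotheses (eH : (UI K q I ><| S)%g = H) (sST : S \subset T) (sHG : H \subset GammaSp)
  (trS : [transitive S, on Wspace K :\ (0, 0)%R | 'P]).

Let HG := subsetP sHG.
Let UH : {subset UI K q I <= H}.
Proof.
have [[X Y eX eY] _ _ _] := sdprodP eH; rewrite -(sdprodW eH) eX eY.
by apply/subsetP; exact: mulG_subl.
Qed.
Let SH : {subset S <= H}.
Proof.
have [[X Y eX eY] _ _ _] := sdprodP eH; rewrite -(sdprodW eH) eX eY.
by apply/subsetP; exact: mulG_subr.
Qed.

Definition reachable v v' := exists2 h, h \in H & form_act v h = v'.

Lemma reachable_refl v : reachable v v.
Proof. by exists 1%g; [exact: group1 | rewrite form_act1]. Qed.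

Lemma reachable_trans v v' v'' : reachable v v' -> reachable v' v'' -> reachable v v''.
Proof.
move=> [h hH <-] [h' h'H <-]; exists (h * h')%g; first exact: groupM.
by rewrite (form_actM f0 m0 hKq v (HG hH) (HG h'H)).
Qed.

Lemma reachable_GammaL1 v s : s \in S -> reachable v (s v).
Proof.
move=> sS; exists s; first exact: SH.
exact: (form_act_GammaL1 f0 m2 hKq homega _ (subsetP sST _ sS)).
Qed.

Lemma W_transitive b b' : b != 0 -> b' != 0 -> exists2 s, s \in S & s (0, b) = (0, b').
Proof.
move=> b0 b'0; have mem z : z != 0 -> (0, z) \in Wspace K :\ (0, 0).
  by move=> z0; rewrite !inE /= xpair_eqE eqxx (negPf z0).
by have [s sS e] := atransP2 trS (mem b b0) (mem b' b'0); exists s.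
Qed.

(* The l with this property form a submonoid of Z/m, hence a subgroup. *)
Definition shift_step (l : nat) := forall a b e, b != 0 ->
  reachable (a, b) (a + (e + e ^+ (q ^ l)%N) / b, b).

Lemma shift_step0 : shift_step 0.
Proof.
by move=> a b e b0; rewrite expr1 (addrr2 hK) mul0r addr0; exact: reachable_refl.
Qed.

Lemma shift_stepD l l' : shift_step l -> shift_step l' -> shift_step (l + l').
Proof.
move=> sl sl' a b e b0; apply: reachable_trans (sl a b e b0) _.
have := sl' (a + (e + e ^+ (q ^ l)%N) / b) b (e ^+ (q ^ l)%N) b0.
rewrite -exprM -expnD -addrA -mulrDl.
by rewrite -(addrA e) (addrA (e ^+ _)) (addrr2 hK) add0r.
Qed.

Lemma shift_step_mod l n : shift_step (l + n * m) -> shift_step l.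
Proof.
move=> sl a b e b0; have := sl a b e b0.
rewrite expnD exprM; have qm x : x ^+ (q ^ (n * m))%N = x.
  elim: n {sl} => [|n IH]; first by rewrite expr1.
  by rewrite mulSn expnD exprM -hKq expf_card.
by rewrite qm.
Qed.

Lemma shift_stepM l n : shift_step l -> shift_step (n * l).
Proof.
by move=> sl; elim: n => [|n IH]; [exact: shift_step0 | rewrite mulSn; apply: shift_stepD].
Qed.

Lemma shift_step_gcdn l l' : shift_step l -> shift_step l' -> shift_step (gcdn l l').
Proof.
have [->|l0] := posnP l; first by rewrite gcd0n.
move=> sl sl'; case: (egcdnP l' l0) => u v e _.
apply: (shift_step_mod (n := v * l')).
(* The subtraction in the Bezout relation is replaced by adding m - 1 times the same term, which
   changes the total by a multiple of m. *)
rewrite (_ : gcdn l l' + v * l' * m = u * l + v * m.-1 * l')%N; last first.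
  by rewrite e -{1}(prednK m0); nia.
by apply: shift_stepD; apply: shift_stepM.
Qed.

Hypothesis I0 : ord0 \notin I.

Lemma mem_gt0 (i : 'I_(m./2).+1) : i \in I -> (0 < i)%N.
Proof.
move=> iI; rewrite lt0n; apply: contraNneq I0 => e.
by rewrite -(_ : i = ord0) //; apply: val_inj.
Qed.

Lemma shift_step_mem (i : 'I_(m./2).+1) : i \in I -> shift_step i.
Proof.
move=> iI a b e b0; have i0 := mem_gt0 iI; have im : (i <= m./2)%N by rewrite -ltnS.
(* The conjugate of e is chosen so that its power with exponent q^(m - i) is e itself. *)
have [c cv ec] := mfun_product_surj f0 m2 hKq (e ^+ (q ^ i)%N) i0 im b0.
exists (shear (mfun f m i c)).
  apply: UH; apply: (subsetP (Ui_sub_UI m2 hKq iI)); apply/(Ui_P m2 hKq); by exists c.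
rewrite (form_act_mfun f0 m2 hKq _ i0 im cv) /=; congr (_ + _, _).
apply: (mulIf b0); rewrite ec divfK // -exprM -expnD subnKC.
  by rewrite -hKq expf_card addrC.
by apply: leq_trans im _; rewrite -divn2 leq_div.
Qed.

Lemma shift_step_dI : shift_step (dI I).
Proof.
have sd : shift_step (\big[gcdn/0%N]_(i in I | (0 < i)%N) (i : nat)).
  apply: (big_ind shift_step) => [|l l'|i /andP[iI _]]; first exact: shift_step0.
    exact: shift_step_gcdn.
  exact: shift_step_mem.
rewrite /dI; case: ifP => // _; apply: shift_step_gcdn => //.
by rewrite -[m]add0n -{1}[m]mul1n; apply: (@shift_step_mod _ 0); rewrite addn0 add0n mul1n => a b e b0;
  rewrite -hKq expf_card (addrr2 hK) mul0r addr0; exact: reachable_refl.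
Qed.

Local Notation k := (f * dI I)%N.

Lemma reachable_trk a a' b : b != 0 ->
  trk (m * f) k (a * b) = trk (m * f) k (a' * b) -> reachable (a, b) (a', b).
Proof.
move=> b0 e; have k0 : (0 < k)%N by rewrite muln_gt0 f0 dI_gt0.
have kN : (k %| m * f)%N by rewrite mulnC dvdn_pmul2r // dI_dvd.
have [z ez] : exists z, (a + a') * b = z + z ^+ (2 ^ k)%N.
  by apply: (trk_ker N0 hK k0 kN); rewrite mulrDl (trkD hK) e (addrr2 hK).
have := shift_step_dI a z b0; rewrite -expnM -ez mulfK //.
by rewrite addrA (addrr2 hK) add0r.
Qed.

Variable v0 : V.
Hypothesis mv0 : minus_form q m (Qf f m v0).

Lemma reduce_snd : (forall a a' b, (a, b) \in minus_set K f m -> (a', b) \in minus_set K f m ->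
  reachable (a, b) (a', b)) -> form_transitive f0 m2 hKq H.
Proof.
move=> red [a b] [a' b'] vM v'M; rewrite -/(reachable _ _).
have b0 := minus_set_snd hKq vM; have b'0 := minus_set_snd hKq v'M.
have [s sS es] := W_transitive b0 b'0; have sT := subsetP sST _ sS.
have es2 : s (a, b) = ((s (a, b)).1, b').
  have [w [j [_ et]]] := GammaL1_decomposition f0 m2 hKq homega sT.
  by move: es; rewrite !et /tmap /= => -[_ ->].
apply: reachable_trans (reachable_GammaL1 (a, b) sS) _; rewrite es2; apply: red => //.
rewrite -es2 -(form_act_GammaL1 f0 m2 hKq homega _ sT).
exact: (form_act_minus_set f0 m2 hKq mv0 (TG sT)).
Qed.

Lemma transitive_ord0 : ord0 \in I -> form_transitive f0 m2 hKq H.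
Proof.
move=> I1; apply: reduce_snd => a a' b vM v'M.
have [c ec] := minus_set_shear_transitive f0 m2 hKq vM v'M.
exists (shear (fun y => c * y)) => //; apply: UH; apply: (subsetP (Ui_sub_UI m2 hKq I1)).
apply/(Ui_P m2 hKq); exists c; last exact: eq_shear.
by rewrite /mvalid ltn_eqF.
Qed.

Lemma transitive_dI1 : k = 1%N -> form_transitive f0 m2 hKq H.
Proof.
move=> k1; apply: reduce_snd => a a' b vM v'M.
apply: reachable_trk; first exact: minus_set_snd hKq _ vM.
by rewrite k1; move/minus_setP: vM => ->; move/minus_setP: v'M => ->.
Qed.

(** The even part of S has index 2. If it contained the stabilizer of (0, b), the orbit length q^m -
    1 would be even. *)
Lemma odd_stabilizer z b (c4 : z ^+ 4 = z) (c2 : z ^+ 2 != z) : b != 0 ->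
  odd (#|GammaL1 omega| %/ #|(S * Singer omega)%g|) ->
  exists s a (j : nat), [/\ s \in S, s (0, b) = (0, b), a != 0, odd j & forall v, s v = tmap a j v].
Proof.
move=> b0; rewrite -[GammaL1 omega]/(gval T) -[Singer omega]/(gval <[ell omega]>%G).
rewrite (odd_index_even_part f0 m2 hKq homega c4 c2 sST).
set T1 := Group _ => /subsetPn[t tS tE].
have cS : #|S| = (#|S :&: T1| * 2)%N := card_even_part sST tS tE.
have [s sC sE] : exists2 s, s \in ('C_S[(0, b) | 'P])%g & s \notin T1.
  apply/subsetPn; apply/negP => sub.
  have sub2 : ('C_S[(0, b) | 'P])%g \subset S :&: T1 by rewrite subsetI subsetIl.
  have := Lagrange_index (subsetIl S T1) sub2.
  rewrite -card_orbit (atransP trS); last first.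
    by rewrite !inE /= xpair_eqE eqxx (negPf b0).
  rewrite -[X in (X * _)%N]divgS ?subsetIl // cS mulKn ?cardG_gt0 //.
  rewrite card_Wspace hK => /(congr1 odd); rewrite oddM.
  by rewrite oddB ?expn_gt0 // oddX (gtn_eqF N0).
have /setIP[sS /astab1P es] := sC; have sT := subsetP sST _ sS.
have [w [j [_ et]]] := GammaL1_decomposition f0 m2 hKq homega sT.
have w0 := val_unit_neq0 w.
exists s, (val w), j; split=> //.
by move: sE; rewrite [_ \in T1](tmap_even c4 c2 sT w0 et) negbK.
Qed.

(** The trace of v1 v2 to F_4 takes two values, swapped by an element of S that acts nontrivially on
    F_4 and, by [odd_stabilizer], can be chosen to fix the second coordinate. *)
Lemma transitive_dI2 : k = 2%N -> odd (#|GammaL1 omega| %/ #|(S * Singer omega)%g|) ->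
  form_transitive f0 m2 hKq H.
Proof.
move=> k2 od; apply: reduce_snd => a a' b vM v'M; have b0 := minus_set_snd hKq vM.
have kN : (2 %| m * f)%N by rewrite -k2 mulnC dvdn_pmul2r // dI_dvd.
have /minus_setP t1 := vM; have /minus_setP t1' := v'M.
rewrite /= in t1 t1'.
have [c4 c2] := trk1_two_values N0 hK kN t1.
have [c4' c2'] := trk1_two_values N0 hK kN t1'.
have /or4P[/eqP e|/eqP e|/eqP e|/eqP e] := quartic_field c4 c2 c4'.
- by move: c2'; rewrite e expr0n eqxx.
- by move: c2'; rewrite e expr1n eqxx.
- by apply: reachable_trk; rewrite ?k2.
have [s [d [j [sS es d0 oj et]]]] := odd_stabilizer c4 c2 b0 od.
apply: reachable_trans (reachable_GammaL1 (a, b) sS) _.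
have es2 : s (a, b) = (d^-1 * a ^+ (2 ^ j)%N, b).
  by move: es; rewrite !et /tmap /= => -[_ ->].
rewrite es2; apply: reachable_trk; rewrite ?k2 // e.
have eb : d * b ^+ (2 ^ j)%N = b by move: es; rewrite et => -[].
rewrite -{1}eb mulrACA mulVf // mul1r -exprMn (trk_pow2 hK) (order3_pow c4) oj.
by [].
Qed.

End Sufficiency.

(** * The equivalence *)

Lemma eq_minus_form (K : finFieldType) (q m : nat) (Q Q' : K * K -> K) : Q =1 Q' ->
  minus_form q m Q -> minus_form q m Q'.
Proof.
move=> e [[QF QZ QD] w]; split; first by split=> [v|c v cF|u v]; rewrite -!e; auto.
rewrite -w; congr _.+1; apply: eq_bigl => E; congr (_ && _).
by apply: eq_forallb => v; rewrite e.
Qed.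

Lemma eq_Ominus (K : finFieldType) (q m : nat) (Q Q' : K * K -> K) : Q =1 Q' ->
  Ominus q m Q = Ominus q m Q'.
Proof.
move=> e; apply/setP=> g; rewrite !in_set; congr (_ && _).
by apply: eq_forallb => v; rewrite !e.
Qed.

Lemma sdprod_subr (gT : finGroupType) (A : {set gT}) (S X : {group gT}) :
  (A ><| S)%g = X -> {subset S <= X}.
Proof.
move=> e; have [[Y Z eY eZ] _ _ _] := sdprodP e; rewrite -(sdprodW e) eY eZ.
by apply/subsetP; exact: mulG_subr.
Qed.

Lemma odd_indexP (K : finFieldType) (f m : nat) (omega : {unit K}) (z a : K) (j : nat)
    (S : {group {perm K * K}}) t :
  (0 < f)%N -> (2 <= m)%N -> #|K| = ((2 ^ f) ^ m)%N -> generator [set: {unit K}] omega ->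
  z ^+ 4 = z -> z ^+ 2 != z -> S \subset GammaL1 omega -> t \in S -> a != 0 -> odd j ->
  (forall v, t v = tmap a j v) -> odd (#|GammaL1 omega| %/ #|(S * Singer omega)%g|).
Proof.
move=> f0 m2 hK homega z4 z2 sST tS a0 oj et.
rewrite [odd _](odd_index_even_part f0 m2 hK homega z4 z2 sST); apply/subsetPn; exists t => //.
by rewrite [_ \in _](tmap_even z4 z2 (subsetP sST _ tS) a0 et) negbK.
Qed.

Lemma mul_le2_cases (a b : nat) : (0 < a)%N -> (0 < b)%N -> (a * b <= 2)%N ->
  [\/ a = 1%N /\ b = 1%N, a = 1%N /\ b = 2%N | a = 2%N /\ b = 1%N].
Proof.
case: a b => [|[|[|a]]] // [|[|[|b]]] //= _ _; do ?by [constructor 1|constructor 2|constructor 3].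
all: by move=> h; exfalso; move: h; rewrite !mulnS; lia.
Qed.

Close Scope ring_scope.

Theorem theorem2p8 (q m : nat) (K : finFieldType)
    (hq : exists2 f : nat, (0 < f)%N & q = (2 ^ f)%N)
    (hm : (2 <= m)%N)
    (hmq : (m, q) \notin [:: (2, 2); (2, 8); (6, 2)]%N)
    (hK : #|K| = (q ^ m)%N)
    (omega : {unit K}) (homega : generator [set: {unit K}] omega)
    (G H B : {group {perm (K * K)%type}})
    (hLG : Sp K q m \subset G) (hG : G \subset GammaSp K q m)
    (hH : H \subset Pm G) (hsol : solvable H)
    (hB : [max B of A | (A \subset G) && ~~ (Sp K q m \subset A)])
    (hBL : exists2 Q : K * K -> K, minus_form q m Q
                                 & B :&: Sp K q m = Ominus q m Q) :
  G :=: H * B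
  <->
  exists (g : {perm (K * K)%type}) (I : {set 'I_(m./2).+1})
         (S : {group {perm (K * K)%type}}),
    [/\ g \in G,
        UI K q I ><| S = H :^ g,
        S \subset GammaL1 omega,
        [transitive S, on Wspace K :\ (0, 0)%R | 'P]
      & [\/ ord0 \in I,
            [/\ ord0 \notin I, dI I = 1%N & q = 2%N],
            [/\ ord0 \notin I, dI I = 2%N, q = 2%N
              & odd (#|GammaL1 omega| %/ #|S * Singer omega|)]
          | [/\ ord0 \notin I, dI I = 1%N, q = 4%N,
                G :=: GammaSp K q m
              & odd (#|GammaL1 omega| %/ #|S * Singer omega|)] ] ].
Proof.
have [f f0 eq] := hq; subst q; have m0 : (0 < m)%N := ltnW hm.
have nex : ~~ ((m == 6%N) && (f == 1%N)).
  by apply: contra hmq => /andP[/eqP-> /eqP->].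
have nex2 : ~~ ((m == 2%N) && (f == 1%N)).
  by apply: contra hmq => /andP[/eqP-> /eqP->].
have [Q mQ BQ] := hBL.
have [v0 eQ] : exists v0, Q =1 Qf f m v0 by apply: (quadratic_form_Qf f0 m0 hK); case: mQ.
have mv0 := eq_minus_form eQ mQ; rewrite (eq_Ominus _ _ eQ) in BQ.
have v0M := base_minus_set f0 hm hK mv0.
have sHG : H \subset G := subset_trans hH (subsetIl _ _).
have HU h : h \in H -> stabU h by move=> hin; case/PmP: (subsetP hH _ hin).
have sHGa := subset_trans sHG hG.
have GaJ g (X : {group {perm (K * K)%type}}) : g \in G -> X \subset G ->
    (X :^ g)%g \subset GammaSp K (2 ^ f) m.
  by move=> gG sX; apply: subset_trans hG; rewrite -(conjGid gG) conjSg.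
have fact := factorization_form_transitive f0 hm hK mv0 hLG hG sHG hB BQ.
apply: (iff_trans fact); split=> [trH | [g [I [S [gG eH sST trS cases]]]]].
  have [g [I [S [gS eH sST trS]]]] :=
    transitive_solvable_structure homega nex nex2 mv0 sHGa HU hsol trH.
  have gG := subsetP hLG _ gS; exists g, I, S; split=> //.
  have [I0|I0] := boolP (ord0 \in I); first exact: Or41.
  have trHg : form_transitive f0 hm hK (H :^ g)%G.
    apply: (form_transitiveJ mv0 (g := (g^-1)%g)); last by rewrite /= conjsgK.
      by apply: (subsetP hG); rewrite groupV.
    exact: GaJ.
  have kle := dI_bound homega eH sST I0 trHg v0M.
  have odd2 := odd_element homega eH sST I0 trHg v0M.
  have d0 := dI_gt0 I m0.
  have [k1|[f1 d2]|[f2 d1]] : [\/ f = 1%N /\ dI I = 1%N, f = 1%N /\ dI I = 2%N | f = 2%N /\ dI I = 1%N].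
    exact: mul_le2_cases.
  - by apply: Or42; case: k1 => -> ->.
  - have [z [z4 z2 [t [a [j [tS a0 oj et]]]]]] := odd2 ltac:(by rewrite f1 d2).
    apply: Or43; split=> //; first by rewrite f1.
    exact: (odd_indexP f0 hm hK homega z4 z2 sST tS a0 oj et).
  have [z [z4 z2 [t [a [j [tS a0 oj et]]]]]] := odd2 ltac:(by rewrite f2 d1).
  have tG : t \in G.
    have tHg : t \in (H :^ g)%G := sdprod_subr eH tS.
    by move: tHg; rewrite -(conjGid gG) => /(subsetP _) ->; rewrite ?conjSg.
  have eG : G :=: GammaSp K (2 ^ f) m.
    (* Stated for a variable n so that n = 2 can be substituted in all hypotheses at once. *)
    have quartic n : n = 2%N -> #|K| = ((2 ^ n) ^ m)%N -> Sp K (2 ^ n) m \subset G ->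
        G \subset GammaSp K (2 ^ n) m -> G :=: GammaSp K (2 ^ n) m.
      by move=> -> hK4 hLG4 hG4; exact: (GammaSp4_sub hm hK4 z4 z2 hLG4 hG4 tG a0 oj et).
    exact: quartic.
  apply: Or44; split=> //; first by rewrite f2.
  exact: (odd_indexP f0 hm hK homega z4 z2 sST tS a0 oj et).
have sHgGa := GaJ g H gG sHG.
apply: (form_transitiveJ mv0 (g := g)) => //; first exact: subsetP hG _ gG.
have f_pow : forall n, (2 ^ f = 2 ^ n)%N -> f = n.
  by move=> n /eqP; rewrite eqn_exp2l // => /eqP.
case: cases => [I0|[I0 d1 q2]|[I0 d2 q2 od]|[I0 d1 q4 _ od]].
- exact: (transitive_ord0 f0 hm hK homega eH sST sHgGa trS mv0 I0).
- have k1 : (f * dI I = 1)%N by rewrite d1 (f_pow 1%N).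
  exact: (transitive_dI1 f0 hm hK homega eH sST sHgGa trS I0 mv0 k1).
- have k2 : (f * dI I = 2)%N by rewrite d2 (f_pow 1%N).
  exact: (transitive_dI2 f0 hm hK homega eH sST sHgGa trS I0 mv0 k2 od).
have k2 : (f * dI I = 2)%N by rewrite d1 (f_pow 2%N).
exact: (transitive_dI2 f0 hm hK homega eH sST sHgGa trS I0 mv0 k2 od).
Qed.
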